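(* Let $m\ge n+2$, let $A\in Y_{n,m}$, let $\tau$ (with $\mathrm{Im}\,\tau>0$) and $\iota_A:T=\mathbb{C}/(\mathbb{Z}+\mathbb{Z}\tau)\to\mathbb{P}^n$ be an embedding of degree $n+1$ whose image contains all the points $P_1,\dots,P_m$ determined by $A$, let $w\in W(n,m)$, and put $A'=w(A)$, $\iota_{A'}=w\circ\iota_A$. Let $u_i\in T$ be the point with $\iota_A(u_i)=P_i$, let $u_i'\in T$ be the point with $\iota_{A'}(u_i')=P_i'$, where $P_i'$ is the point determined by the $i$-th column of $A'$ ($1\le i\le m$), let $v\in T$ be a point with $(n+1)[v]=\tilde\iota_A^*(E)$ in $\mathrm{Pic}(T)$ and let $v'\in T$ be a point with $(n+1)[v']=\tilde\iota_{A'}^*(E')$. For $u\in T$ put $u'=\iota_{A'}^{-1}\circ w\circ\iota_A(u)$. Suppose that the pull-backs $w^*(E'),w^*(E_i')\in\mathrm{Pic}(X_A)$ are represented as $$w^*(E')=b_0^0E+\sum_{j=1}^m b_0^jE_j,\qquad w^*(E_i')=b_i^0E+\sum_{j=1}^m b_i^jE_j\quad(1\le i\le m),$$ with integers $b_i^j$. Then the following equalities hold in the group $T$: $$u_i'=(n+1)b_i^0\,v+\sum_{j=1}^m b_i^j\,u_j\quad(1\le i\le m),\qquad u'=u,$$ and moreover $$(n+1)v'=(n+1)b_0^0\,v+\sum_{j=1}^m b_0^j\,u_j.$$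
   Context: Configuration space. For $m\ge n+2$, $X_{n,m}$ is the set of complex $(n+1)\times m$ matrices $A$ all of whose $(n+1)\times(n+1)$ minors are nonzero, modulo left multiplication by $\mathrm{PGL}(n+1)$ and scaling of columns by $(\mathbb{C}^\times)^m$ (one works with a representative matrix of $A$). $P_i$ denotes the point of $\mathbb{P}^n=\mathbb{P}^n(\mathbb{C})$ with homogeneous coordinates the $i$-th column of $A$, and $\rho_A:X_A\to\mathbb{P}^n$ is the blow-up of $\mathbb{P}^n$ at $P_1,\dots,P_m$. $E$ is the class of the total transform of a hyperplane, $E_i$ the class of the exceptional divisor over $P_i$; $\mathrm{Pic}(X_A)\simeq H^2(X_A,\mathbb{Z})=\mathbb{Z}E\oplus\mathbb{Z}E_1\oplus\cdots\oplus\mathbb{Z}E_m$. $H_2(X_A,\mathbb{Z})$ has basis $e$ (class of a generic line in $\mathbb{P}^n$), $e_i$ (class of a generic line in the $i$-th exceptional divisor), with $\langle E,e\rangle=1$, $\langle E,e_j\rangle=\langle E_i,e\rangle=0$, $\langle E_i,e_j\rangle=-\delta_{ij}$. The corresponding classes on $X_{A'}$ are denoted $E',E_1',\dots,E_m'$. Weyl group. $W(n,m)$ is the group generated by the following birational transformations acting on pairs $(A\,|\,\mathbf{x})$ with $A\in X_{n,m}$, $\mathbf{x}\in\mathbb{P}^n$ (modulo $\mathrm{PGL}(n+1)$ acting simultaneously on $A$ and $\mathbf{x}$): $r_{i,i+1}$ ($1\le i\le m-1$), which exchanges the $i$-th and $(i+1)$-st columns of $A$ and fixes $\mathbf{x}$;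 and $r_{1,2,\dots,n+1}$, which first multiplies $(A\,|\,\mathbf{x})$ on the left by the inverse of the matrix formed by the first $n+1$ columns of $A$, obtaining $(I_{n+1}\,|\,a_{ij}''\,|\,x_i'')$, and then replaces it by $(I_{n+1}\,|\,(a_{ij}'')^{-1}\,|\,(x_i'')^{-1})$ (standard Cremona transformation). Each $w\in W(n,m)$ thus acts on the parameter $A$ and induces a birational map $\mathbb{P}^n\dashrightarrow\mathbb{P}^n$, hence $w:X_A\dashrightarrow X_{w(A)}$. Put $\alpha_0=E-E_1-\cdots-E_{n+1}$, $\alpha_i=E_i-E_{i+1}$, $\alpha_0^\vee=(n-1)e-e_1-\cdots-e_{n+1}$, $\alpha_i^\vee=e_i-e_{i+1}$ ($1\le i\le m-1$), and let $W_*(n,m)$ be the group generated by the reflections $D\mapsto D+\langle D,\alpha_i^\vee\rangle\alpha_i$ ($0\le i\le m-1$) on $H^2(X_A,\mathbb{Z})$. A hypersurface in $X_A$ is nodal if its class is $w_*(\alpha_0)$ for some $w_*\in W_*(n,m)$; $N_{n,m}\subset X_{n,m}$ is the set of $A$ such that $X_A$ contains a nodal hypersurface. It is known (Coble, Dolgachev–Ortland) that $W(n,m)$ acts over $X_{n,m}\setminus N_{n,m}$, that each $w:X_A\dashrightarrow X_{w(A)}$ is there a pseudo-isomorphism (an isomorphism outside subvarieties of codimension $\ge2$), and that the push-forwards of $r_{1,\dots,n+1}$ and $r_{i,i+1}$ on $H^2$ are the reflections for $\alpha_0$ and $\alpha_i$, and on $H_2$ they are $d\mapsto d+\langle\alpha_i,d\rangle\alpha_i^\vee$.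 $w^*:\mathrm{Pic}(X_{w(A)})\to\mathrm{Pic}(X_A)$ is the pull-back (inverse of push-forward). Elliptic curves. The degree of an embedding $\iota:T\to\mathbb{P}^n$ is $\deg\iota^*\mathcal{O}_{\mathbb{P}^n}(1)$. $Y_{n,m}$ is the set of $A\in X_{n,m}\setminus N_{n,m}$ for which there exist $\tau$ with $\mathrm{Im}\,\tau>0$ and an embedding $\iota_A:T=\mathbb{C}/(\mathbb{Z}+\mathbb{Z}\tau)\to\mathbb{P}^n$ of degree $n+1$ with all $P_i\in\iota_A(T)$. The unique lift of $\iota_A$ to $X_A$ is $\tilde\iota_A:T\to X_A$, $\rho_A\circ\tilde\iota_A=\iota_A$. The action of $W(n,m)$ restricts over $Y_{n,m}$; $w$ maps the curve $\tilde\iota_A(T)$ isomorphically onto its image in $X_{w(A)}$ (extending the restriction of $w$ to the curve), and $\iota_{w(A)}:=w\circ\iota_A:T\to\mathbb{P}^n$ is the resulting embedding of degree $n+1$, with lift $\tilde\iota_{w(A)}$. For $u\in T$, $[u]\in\mathrm{Pic}(T)$ denotes the class of the divisor $u$. Sums and integer multiples of points of $T$ are taken with respect to the group law of $T=\mathbb{C}/(\mathbb{Z}+\mathbb{Z}\tau)$. *)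

(* Defs.v *)
From HB Require Import structures.
From mathcomp Require Import all_boot all_order all_algebra.
From mathcomp Require Import complex.
From mathcomp Require Import -(notations) mpoly.
From mathcomp Require Import boolp classical_sets functions cardinality fsbigop.
From mathcomp Require Import reals topology normedtype derive.

Set Implicit Arguments.
Unset Strict Implicit.
Unset Printing Implicit Defensive.

Import Order.TTheory GRing.Theory Num.Theory.
Import numFieldNormedType.Exports.

Local Open Scope classical_set_scope.
Local Open Scope ring_scope.

(* Typing R[i] as a numClosedFieldType gives access to its norm topology. *)
Definition complexes (R : realType) : numClosedFieldType := R[i].

(* A point of P^n is represented by any of its nonzero vectors of homogeneous
   coordinates; [proj_eq] is equality of points of P^n, and holds only between
   nonzero vectors. *)
Definition proj_eq (K : fieldType) (n : nat) (x y : 'cV[K]_n.+1) : Prop :=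
  x != 0 /\ exists2 c : K, c != 0 & y = c *: x.

Section Torus.
Variables (R : realType) (tau : complexes R).
Local Notation C := (complexes R).

Definition lattice (z : C) : bool :=
  `[< exists a b : int, z = a%:~R + b%:~R * tau >].

Lemma lattice_zmod_closed : zmod_closed lattice.
Proof.
split; first by apply/asboolP; exists 0, 0; rewrite mul0r addr0.
move=> x y /asboolP[a [b ->]] /asboolP[c [d ->]].
by apply/asboolP; exists (a - c), (b - d); rewrite !rmorphB mulrBl /= opprD addrACA.
Qed.

HB.instance Definition _ := GRing.isZmodClosed.Build C lattice lattice_zmod_closed.

Definition lattice_group : zmodClosed C := GRing.ZmodClosed.clone C lattice _.

Definition torus : zmodType := Quotient.quot lattice_group.

Definition to_torus (z : C) : torus :=
  (\pi_(Quotient.quot lattice_group) z)%qT.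

End Torus.

Section Curves.
Variable R : realType.
Local Notation C := (complexes R).

Definition holomorphic_at (f : C -> C) (z : C) : Prop :=
  \forall t \near z, derivable (f : C -> C) (t : C) 1.

(* The order at z of a function meromorphic near z; the value f z is
   irrelevant. No k works when f vanishes identically near z. *)
Definition has_order (f : C -> C) (z : C) (k : int) : Prop :=
  exists g : C -> C,
    [/\ holomorphic_at g z, g z != 0
      & \forall t \near (z : C)^', f t = ((t : C) - z) ^ k * g t].

Section Maps.
Variables (tau : C) (n : nat).
Implicit Types (iota : torus tau -> 'cV[C]_n.+1) (D : torus tau -> int).

Definition holomorphic_vec_at (F : C -> 'cV[C]_n.+1) (z : C) : Prop :=
  forall i, holomorphic_at (fun t => F t i 0) z.

(* F gives holomorphic homogeneous coordinates for the map iota : T -> P^n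
   in a neighbourhood of the point z mod the lattice. *)
Definition local_lift iota (z : C) (F : C -> 'cV[C]_n.+1) : Prop :=
  holomorphic_vec_at F z /\
  \forall t \near z, proj_eq (F t) (iota (to_torus tau (t : C))).

(* The differential of the map [F] to P^n at z is injective if and only if
   the vectors F z and F' z are linearly independent. *)
Definition immersive_at (F : C -> 'cV[C]_n.+1) (z : C) : Prop :=
  \rank (row_mx (F z) (\col_i ('D_1 (fun t : C => F t i 0 : C) z : C))) = 2%N.

(* As the torus is compact, an embedding is an injective holomorphic
   immersion. *)
Definition embedding iota : Prop :=
  (forall u u', proj_eq (iota u) (iota u') -> u = u') /\
  forall z : C, exists2 F, local_lift iota z F & immersive_at F z.

(* D is the divisor iota^* H on the torus, where H is the hyperplane of
   equation a x = 0; such a D exists only if H does not contain the image. *)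
Definition hyperplane_divisor iota (a : 'rV[C]_n.+1) D : Prop :=
  forall z : C, exists2 F, local_lift iota z F &
    has_order (fun t => (a *m F t) 0 0) z (D (to_torus tau z)).

(* deg iota^* O(1) = d. *)
Definition has_degree iota (d : nat) : Prop :=
  exists a D, hyperplane_divisor iota a D /\
    (\sum_(u \in [set: torus tau]) D u)%R = d%:Z.

(* Equality of classes in Pic(T): the difference is the divisor of a
   meromorphic function on the torus. *)
Definition same_class D1 D2 : Prop :=
  exists f : torus tau -> C, forall z : C,
    has_order (fun t => f (to_torus tau t)) z
              (D1 (to_torus tau z) - D2 (to_torus tau z)).

Definition point_divisor (u : torus tau) : torus tau -> int :=
  fun x => (x == u)%:Z.

(* The class of D is the pull-back of the hyperplane class E of a blow-up
   rho : X_A -> P^n by the lift of iota to X_A. Since E is the class of the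
   total transform rho^* H of a hyperplane H and rho composed with the lift
   is iota, this pull-back is the class of iota^* H. *)
Definition is_pullback_of_E iota D : Prop :=
  exists a D', hyperplane_divisor iota a D' /\ same_class D D'.

End Maps.
End Curves.

(* The lattices H^2(X_A, Z) = Pic(X_A) and H_2(X_A, Z), in coordinates with
   respect to (E, E_1, ..., E_m) and (e, e_1, ..., e_m). *)
Section Lattices.
Variable m : nat.

Definition H2 := 'rV[int]_m.+1.
Definition H_2 := 'rV[int]_m.+1.

Definition cE : H2 := delta_mx 0 ord0.
Definition cEi (j : 'I_m) : H2 := delta_mx 0 (lift ord0 j).
Definition ce : H_2 := delta_mx 0 ord0.
Definition cei (j : 'I_m) : H_2 := delta_mx 0 (lift ord0 j).

Definition pairing (D : H2) (d : H_2) : int :=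
  D 0 ord0 * d 0 ord0 - \sum_(j < m) D 0 (lift ord0 j) * d 0 (lift ord0 j).

(* Labels common to the generators of the groups W(n,m) and W_*(n,m). *)
Inductive generator : Type :=
| Exchange (i j : 'I_m) of (j == i.+1 :> nat)
| Cremona.

Variable n : nat.

Definition root (g : generator) : H2 :=
  match g with
  | Exchange i j _ => cEi i - cEi j
  | Cremona => cE - \sum_(j < m | (j < n.+1)%N) cEi j
  end.

Definition coroot (g : generator) : H_2 :=
  match g with
  | Exchange i j _ => cei i - cei j
  | Cremona => ce *~ (n%:Z - 1) - \sum_(j < m | (j < n.+1)%N) cei j
  end.

Definition reflection (g : generator) (D : H2) : H2 :=
  D + root g *~ pairing D (coroot g).

(* The elements of W_*(n,m); the generators are involutions. *)
Definition reflections (s : seq generator) (D : H2) : H2 :=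
  foldr reflection D s.

End Lattices.
Arguments Cremona {m}.

Section Polynomials.
Variables (K : fieldType) (n : nat).
Local Notation poly := (mpoly n.+1 K).

Definition var (i : 'I_n.+1) : poly := mpolyX K (mnm1 i).

Definition homogeneous (d : nat) (F : poly) : Prop :=
  F \is ishomog1 d mdeg.

Definition divides (G F : poly) : Prop := exists Q, F = Q * G.

Definition is_gcd (I : Type) (f : I -> poly) (G : poly) : Prop :=
  (forall i, divides G (f i)) /\
  (forall H, (forall i, divides H (f i)) -> divides H G).

(* F(p + X) has no term of degree < k. For F homogeneous and p != 0 this
   says that F has multiplicity at least k at the point p of P^n, as the
   affine cone over P^n is locally a product. *)
Definition mult_ge (F : poly) (p : 'cV[K]_n.+1) (k : nat) : Prop :=
  forall mon : multinom n.+1, (mdeg mon < k)%N ->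
    mcoeff mon
      (comp_mpoly [tuple mpolyC n.+1 (p i 0) + var i | i < n.+1] F)
    = 0.

Definition has_mult (F : poly) (p : 'cV[K]_n.+1) (k : nat) : Prop :=
  mult_ge F p k /\ ~ mult_ge F p k.+1.

Definition has_min_mult (I : Type) (f : I -> poly) (p : 'cV[K]_n.+1)
    (k : nat) : Prop :=
  (forall i, mult_ge (f i) p k) /\ exists i, ~ mult_ge (f i) p k.+1.

Definition eval (Phi : 'I_n.+1 -> poly) (x : 'cV[K]_n.+1) : 'cV[K]_n.+1 :=
  \col_k meval (fun i => x i 0) (Phi k).

End Polynomials.

Section Configurations.
Variables (R : realType) (n m : nat).
Local Notation C := (complexes R).
Local Notation poly := (mpoly n.+1 C).
Implicit Types (A : 'M[C]_(n.+1, m)) (D : H2 m).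

(* A is a representative matrix of an element of X_{n,m}. *)
Definition in_X A : Prop :=
  forall f : 'I_n.+1 -> 'I_m, injective f -> \det (colsub f A) != 0.

(* The effective divisors on X_A are the sums Z + \sum_j c_j E_j, where Z is the
   strict transform of a hypersurface G = 0 of P^n (possibly empty or with
   multiple components), E_j the exceptional divisor over P_j and c_j >= 0. As
   the total transform of G = 0, of class (deg G) E, is
   Z + \sum_j (mult_{P_j} G) E_j, the class of Z + \sum_j c_j E_j is
   (deg G) E + \sum_j (c_j - mult_{P_j} G) E_j. *)
Definition divisor_class A (G : poly) (c : 'I_m -> nat) D : Prop :=
  exists (d : nat) (mu : 'I_m -> nat),
    [/\ G != 0, homogeneous d G, forall j, has_mult G (col j A) (mu j)
      & D = cE m *~ d%:Z + \sum_j cEi j *~ ((c j)%:Z - (mu j)%:Z)].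

(* A is in N_{n,m}. The hypersurfaces of X_A are its effective divisors, which may
   be reducible and contain exceptional divisors; with irreducible ones only,
   W(n,m) would not act over the complement of N_{n,m}. *)
Definition in_N A : Prop :=
  exists (s : seq (generator m)) (G : poly) (c : 'I_m -> nat),
    divisor_class A G c (reflections n s (root n Cremona)).

Definition in_Y A : Prop :=
  [/\ in_X A, ~ in_N A
    & exists (tau : C) (iota : torus tau -> 'cV[C]_n.+1),
        [/\ 0 < 'Im tau, embedding iota, has_degree iota n.+1
          & forall i, exists u, proj_eq (iota u) (col i A)]].

(* The fixed part of the linear system spanned on X_A by a family f of forms
   of degree d, i.e. the largest effective divisor contained in the total
   transforms of all the f i, and its class. Its multiplicity along E_j is
   the least multiplicity of the f i at P_j, and its other components are
   those of the strict transform of gcd f = 0. *)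
Definition fixed_part_class (I : Type) A (f : I -> poly) D : Prop :=
  exists (G : poly) (c : 'I_m -> nat),
    [/\ is_gcd f G, forall j, has_min_mult f (col j A) (c j)
      & divisor_class A G c D].

(* Pull-backs by the rational map X_A --> X_A' induced by the rational map
   P^n --> P^n, x |-> [Phi_0(x) : ... : Phi_n(x)]. This map is regular outside
   a subvariety of codimension >= 2, which affects neither divisors nor their
   classes. The forms Phi_k may have common factors. On X_A they generate, up
   to codimension 2, the ideal of their fixed part B, so that the pull-back of
   O(1) = O(E') is O(d E - B), where d is the degree of the Phi_k. *)
Definition pullback_E A (Phi : 'I_n.+1 -> poly) D : Prop :=
  exists (d : nat) (B : H2 m),
    [/\ forall k, homogeneous d (Phi k), fixed_part_class A Phi B
      & D = cE m *~ d%:Z - B].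

(* The ideal of the exceptional divisor E'_i of X_A' is generated by the ideal
   of P'_i in P^n, i.e. by the forms p_k x_l - p_l x_k where p = P'_i. It pulls
   back to the ideal generated by the p_k Phi_l - p_l Phi_k, divided by the
   fixed part of the Phi_k. *)
Definition minors_at (p : 'cV[C]_n.+1) (Phi : 'I_n.+1 -> poly)
    (kl : 'I_n.+1 * 'I_n.+1) : poly :=
  p kl.1 0 *: Phi kl.2 - p kl.2 0 *: Phi kl.1.

Definition pullback_Ei A (Phi : 'I_n.+1 -> poly) (p : 'cV[C]_n.+1) D : Prop :=
  exists B1 B : H2 m,
    [/\ fixed_part_class A (minors_at p Phi) B1, fixed_part_class A Phi B
      & D = B1 - B].

(* The elements of the Weyl group W(n,m) are written as words in the
   generators, which are involutions; a word acts from right to left. *)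

Hypothesis hm : (n.+2 <= m)%N.

Definition left_block A : 'M[C]_n.+1 := colsub (widen_ord (ltnW hm)) A.

(* On A. The entries inverted are nonzero when A is in X_{n,m}. *)
Definition gen_matrix (g : generator m) A : 'M[C]_(n.+1, m) :=
  match g with
  | Exchange i j _ => xcol i j A
  | Cremona =>
      let A'' := invmx (left_block A) *m A in
      \matrix_(i, j) if (j < n.+1)%N then (i == j :> nat)%:R else (A'' i j)^-1
  end.

Definition word_matrix (w : seq (generator m)) A : 'M[C]_(n.+1, m) :=
  foldr gen_matrix A w.

(* On x, in homogeneous coordinates: if x'' = (left block of A)^-1 x, the
   point with coordinates (x''_k)^-1 also has the polynomial coordinates
   \prod_(l != k) x''_l. *)
Definition gen_map (g : generator m) A (Phi : 'I_n.+1 -> poly) :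
    'I_n.+1 -> poly :=
  match g with
  | Exchange _ _ _ => Phi
  | Cremona =>
      fun k => \prod_(l < n.+1 | l != k)
                 \sum_(i < n.+1) invmx (left_block A) l i *: Phi i
  end.

(* Forms of the same degree defining the birational map P^n --> P^n induced
   by the word w on the fibre over A. *)
Fixpoint word_map (w : seq (generator m)) A : 'I_n.+1 -> poly :=
  match w with
  | [::] => @var C n
  | g :: w' => gen_map g (word_matrix w' A) (word_map w' A)
  end.

(* q is the image of the point u of the curve iota(T) by the map induced by w
   on this curve, extended holomorphically across the points where the forms
   defining w vanish. *)
Definition image_on_curve (w : seq (generator m)) A (tau : C)
    (iota : torus tau -> 'cV[C]_n.+1) (u : torus tau) (q : 'cV[C]_n.+1) : Prop :=
  exists (z : C) (F G : C -> 'cV[C]_n.+1),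
    [/\ to_torus tau z = u, local_lift iota z F, holomorphic_vec_at G z,
        \forall t \near (z : C)^', proj_eq (eval (word_map w A) (F t)) (G t)
      & proj_eq (G z) q].

End Configurations.

(* Main.v *)
(** Everything is computed on the curve. By Abel's theorem, the zeros on the curve
    of a form of degree d which does not vanish identically there add up to
    d (n + 1) v. In coordinates adapted to P_1, ..., P_{n+1} this gives explicitly the
    image of the curve by one Cremona transformation and the new points u'_i.

    For a word w, follow families of forms whose common zeros on the curve are just
    those imposed by their multiplicities at the points P_j. Pulled back by a
    generator, such a family becomes a family of the same kind for the reflected
    class, multiplied by a fixed form. Comparing orders at each point of the curve,
    the fixed part of the pulled back linear system cuts out on the curve exactly the
    common zeros of the forms defining w, together with the base points of the
    family. For the coordinate forms, and for the minors vanishing at P'_i, the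
    difference is the point u'_i, and Abel's theorem gives its value. *)

(* The matrix [b] is never computed: nothing shows that it is a product of reflections. It enters
   only through gcds and least multiplicities, which are polynomial data on P^n, whereas the
   conclusion concerns points of the curve. The obstacle is that restriction to the curve does not
   commute with gcds: forms without common factor may still have common zeros on the curve. Hence
   the invariant [tight], which demands at every point of the curve a member of the family with the
   least order that the class allows. It lets divisors be compared exactly, not only up to linear
   equivalence; exactness matters because the difference of two fixed parts has to be the single
   point u'_i.

   That A lies outside N is used once, to keep all minors nonzero along the word. The case n <= 1 is
   excluded at the start, since tightness of the forms vanishing at a point rests on hyperplanes
   that separate points of the curve. Only (n + 1) v enters, as the sum of a hyperplane section; v
   itself is determined up to torsion. Abel's theorem is obtained from contour integrals over period
   parallelograms, built on antiderivatives along segments. *)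
Require Import Defs.
From HB Require Import structures.
From mathcomp Require Import all_boot all_order all_algebra.
From mathcomp Require Import reals.
From mathcomp Require Import perm complex ring lra zify.
From mathcomp Require Import -(notations) mpoly.
From mathcomp Require Import boolp classical_sets functions topology normedtype derive.
From mathcomp Require Import ereal measure lebesgue_measure lebesgue_integral ftc.
From mathcomp Require Import sequences exp trigo realfun.
Require Import Defs.
Set Implicit Arguments. Unset Strict Implicit. Unset Printing Implicit Defensive.
Import Order.TTheory GRing.Theory Num.Theory numFieldNormedType.Exports.
Local Open Scope ring_scope.

(** * Complex derivatives *)

Section ComplexCalculus.
Local Open Scope classical_set_scope.
Local Open Scope ring_scope.
Variable R : realType.
Local Notation C := (complexes R).
Implicit Types (z w t l : C) (f g : C -> C).

(** The norm of [complexes R] takes its values in [complexes R] itself; this copy with values in R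
    opens estimates to real arithmetic. *)
Definition nrm (z : C) : R := Normc.normc (z : R[i]).

Lemma nrmE z : `|z| = ((nrm z)%:C)%C.
Proof. by []. Qed.

Lemma nrmM z w : nrm (z * w) = nrm z * nrm w.
Proof. exact: Normc.normcM. Qed.

Lemma nrmV z : nrm z^-1 = (nrm z)^-1.
Proof. exact: Normc.normcV. Qed.

Lemma nrmN z : nrm (- z) = nrm z.
Proof. exact: normcN. Qed.

Lemma nrmB z w : nrm (z - w) = nrm (w - z).
Proof. by rewrite -opprB nrmN. Qed.

Lemma le_nrmD z w : nrm (z + w) <= nrm z + nrm w.
Proof. exact: le_normcD. Qed.

Lemma le_nrmB z w : nrm (z - w) <= nrm z + nrm w.
Proof. by rewrite -(nrmN w); exact: le_nrmD. Qed.

Lemma nrm_ge0 z : 0 <= nrm z.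
Proof. by case: z => a b; exact: sqrtr_ge0. Qed.

Lemma nrm0 : nrm 0 = 0.
Proof. exact: Normc.normc0. Qed.

Lemma nrm1 : nrm 1 = 1.
Proof. exact: Normc.normc1. Qed.

Lemma nrm_eq0 z : (nrm z == 0) = (z == 0).
Proof.
apply/eqP/eqP => [/Normc.eq0_normc //|->]; exact: nrm0.
Qed.

Lemma nrm_gt0 z : (0 < nrm z) = (z != 0).
Proof. by rewrite lt_neqAle nrm_ge0 andbT eq_sym nrm_eq0. Qed.

Lemma nrm_real (x : R) : nrm (x%:C)%C = `|x|.
Proof. by rewrite /nrm /= expr0n addr0 sqrtr_sqr. Qed.

Lemma le_Re_nrm z : `|complex.Re z| <= nrm z.
Proof. by case: z => a b /=; rewrite -sqrtr_sqr ler_wsqrtr // lerDl sqr_ge0. Qed.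

Lemma le_Im_nrm z : `|complex.Im z| <= nrm z.
Proof. by case: z => a b /=; rewrite -sqrtr_sqr ler_wsqrtr // lerDr sqr_ge0. Qed.

Lemma le_nrm_ReIm z : nrm z <= `|complex.Re z| + `|complex.Im z|.
Proof.
have -> : z = ((complex.Re z)%:C)%C + ('i)%C * ((complex.Im z)%:C)%C by rewrite -complexE.
apply: le_trans (le_nrmD _ _) _; rewrite nrmM !nrm_real.
have -> : nrm ('i)%C = 1 by rewrite /nrm /= expr0n expr1n add0r sqrtr1.
by rewrite mul1r -complexE.
Qed.

Lemma nearC_P z (P : C -> Prop) :
  (\forall t \near z, P t) <-> exists2 d : R, 0 < d & forall t, nrm (t - z) < d -> P t.
Proof.
split.
- move=> /nbhs_ballP[e /= e0 Pe].
  have eR : e = ((complex.Re e)%:C)%C by rewrite (RRe_real (gtr0_real e0)).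
  exists (complex.Re e) => [|t te]; first by move: e0; rewrite [X in _ < X]eR ltcR.
  apply: Pe; rewrite /ball /= eR nrmB in te *.
  by rewrite nrmE ltcR.
- move=> [d d0 Pd]; apply/nbhs_ballP; exists (d%:C)%C; first by rewrite /= ltcR.
  by move=> t; rewrite /ball /= nrmE ltcR nrmB => /Pd.
Qed.

Lemma dnearC_P z (P : C -> Prop) :
  (\forall t \near (z : C)^', P t) <->
  exists2 d : R, 0 < d & forall t, t != z -> nrm (t - z) < d -> P t.
Proof.
split.
- move=> H; have : \forall t \near z, t != z -> P t by apply: H.
  by move=> /nearC_P[d d0 H']; exists d => // t tz td; apply: H'.
- move=> [d d0 H]; have : \forall t \near z, t != z -> P t; last by [].
  by apply/nearC_P; exists d => // t td tz; exact: H.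
Qed.

Definition cder f z l : Prop := forall e : R, 0 < e -> exists2 d : R, 0 < d &
  forall t, nrm (t - z) < d -> nrm (f t - f z - l * (t - z)) <= e * nrm (t - z).

Definition ccont f z : Prop := forall e : R, 0 < e -> exists2 d : R, 0 < d &
  forall t, nrm (t - z) < d -> nrm (f t - f z) < e.

Lemma cder_ccont f z l : cder f z l -> ccont f z.
Proof.
move=> H e e0; have [d d0 Hd] := H 1 ltr01.
have L0 : 0 < nrm l + 1 by rewrite ltr_wpDl // nrm_ge0.
exists (Num.min d (e / (nrm l + 1))); first by rewrite lt_min d0 divr_gt0.
move=> t; rewrite lt_min => /andP[/Hd h1 h2].
have -> : f t - f z = (f t - f z - l * (t - z)) + l * (t - z) by ring.
apply: le_lt_trans (le_nrmD _ _) _; rewrite nrmM.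
move: h2; rewrite ltr_pdivlMr //; lra.
Qed.

Lemma cder_is_derive f z l : is_derive (z : C) (1 : C) (f : C -> C) l <-> cder f z l.
Proof.
have key : (h^-1 *: ((f \o shift z) (h *: (1 : C)) - f z) @[h --> (0 : C)^']) --> l <->
    cder f z l.
  split.
  - move=> /cvgrPdist_le H e e0.
    have e0' : (0 : C) < (e%:C)%C by rewrite ltcR.
    have /dnearC_P[d d0 Hd] := H _ e0'.
    exists d => // t td.
    have [->|tz] := eqVneq t z; first by rewrite !subrr mulr0 subr0 nrm0 mulr0.
    have tz0 : t - z != 0 by rewrite subr_eq0.
    have := Hd (t - z) tz0; rewrite subr0 => /(_ td) /=.
    rewrite /GRing.scale /= mulr1 subrK nrmE lecR => hh; rewrite nrmB in hh.
    have -> : f t - f z - l * (t - z) = ((t - z)^-1 * (f t - f z) - l) * (t - z).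
      by field.
    by rewrite nrmM ler_wpM2r // nrm_ge0.
  - move=> H; apply/cvgrPdist_le => e e0.
    have eR : e = ((complex.Re e)%:C)%C by rewrite (RRe_real (gtr0_real e0)).
    have e0' : 0 < complex.Re e by move: e0; rewrite [X in _ < X]eR ltcR.
    have [d d0 Hd] := H _ e0'.
    apply/dnearC_P; exists d => // h h0; rewrite subr0 => hd /=.
    have := Hd (h + z); rewrite addrK => /(_ hd) hh.
    rewrite eR nrmE lecR nrmB -[(_ *: _ : C)]/(_ * _) -[(_ *: _ : C)]/(_ * _) mulr1.
    have -> : h^-1 * (f (h + z) - f z) - l = (f (h + z) - f z - l * h) / h by field.
    by rewrite nrmM nrmV ler_pdivrMr // nrm_gt0.
split=> [[dv dl]|/key H].
  by apply/key; rewrite -dl; exact: dv.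
by apply: DeriveDef; [apply/cvg_ex; exists l|exact: cvg_lim].
Qed.

Lemma derivable_cder f z : derivable (f : C -> C) (z : C) 1 <-> exists l, cder f z l.
Proof.
split=> [/derivableP /cder_is_derive H|[l /cder_is_derive H]].
  by exists ('D_1 (f : C -> C) z).
by case: H.
Qed.

Lemma cderD f g z l k : cder f z l -> cder g z k -> cder (fun t => f t + g t) z (l + k).
Proof.
by move=> /cder_is_derive H /cder_is_derive H'; apply/cder_is_derive; exact: is_deriveD.
Qed.

Lemma cderB f g z l k : cder f z l -> cder g z k -> cder (fun t => f t - g t) z (l - k).
Proof.
by move=> /cder_is_derive H /cder_is_derive H'; apply/cder_is_derive; exact: is_deriveB.
Qed.

Lemma cderM f g z l k :
  cder f z l -> cder g z k -> cder (fun t => f t * g t) z (l * g z + f z * k).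
Proof.
move=> /cder_is_derive H /cder_is_derive H'; apply/cder_is_derive.
apply: is_derive_eq (is_deriveM H H') _.
by rewrite addrC /GRing.scale /= [g z * _]mulrC.
Qed.

Lemma cder_cst (c : C) z : cder (fun=> c) z 0.
Proof. by apply/cder_is_derive; exact: is_derive_cst. Qed.

Lemma cder_id z : cder id z 1.
Proof. by apply/cder_is_derive; exact: is_derive_id. Qed.

Lemma cderV f z l : f z != 0 -> cder f z l -> cder (fun t => (f t)^-1) z (- l / f z ^+ 2).
Proof.
move=> f0 /cder_is_derive H; apply/cder_is_derive.
have [dv dl] := H.
have -> : - l / f z ^+ 2 = 'D_1 (fun t : C => (f t)^-1) z.
  by rewrite deriveV // dl /GRing.scale /= mulNr mulrC mulNr.
by apply/derivableP/derivableV.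
Qed.

Lemma cder_near f g z l : (\forall t \near z, f t = g t) -> cder f z l -> cder g z l.
Proof.
move=> H /cder_is_derive H'; apply/cder_is_derive; exact: near_eq_is_derive H'.
Qed.

Lemma cder_eq f z l k : l = k -> cder f z l -> cder f z k.
Proof. by move=> ->. Qed.

End ComplexCalculus.

(** * Primitives on a segment *)

Section Primitives.
Local Open Scope classical_set_scope.
Local Open Scope ring_scope.
Variable R : realType.
Local Notation C := (complexes R).
Local Notation Re := (@complex.Re R).
Local Notation Im := (@complex.Im R).
Implicit Types (a b : R) (h H : R -> C).

Definition toC (x : R) : C := (x%:C)%C.

Lemma toC0 : toC 0 = 0. Proof. by []. Qed.
Lemma toC1 : toC 1 = 1. Proof. by []. Qed.
Lemma toCD x y : toC (x + y) = toC x + toC y. Proof. exact: (rmorphD (real_complex R)). Qed.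
Lemma toCB x y : toC (x - y) = toC x - toC y. Proof. exact: (rmorphB (real_complex R)). Qed.
Lemma toCN x : toC (- x) = - toC x. Proof. exact: (rmorphN (real_complex R)). Qed.
Lemma toCM x y : toC (x * y) = toC x * toC y. Proof. exact: (rmorphM (real_complex R)). Qed.
Lemma nrm_toC x : nrm (toC x) = `|x|. Proof. exact: nrm_real. Qed.

Lemma cReD (z w : C) : Re (z + w) = Re z + Re w. Proof. by case: z; case: w. Qed.
Lemma cImD (z w : C) : Im (z + w) = Im z + Im w. Proof. by case: z; case: w. Qed.
Lemma cReN (z : C) : Re (- z) = - Re z. Proof. by case: z. Qed.
Lemma cImN (z : C) : Im (- z) = - Im z. Proof. by case: z. Qed.
Lemma cReM (z w : C) : Re (z * w) = Re z * Re w - Im z * Im w.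
Proof. by case: z; case: w. Qed.
Lemma cImM (z w : C) : Im (z * w) = Re z * Im w + Im z * Re w.
Proof. by case: z => x y; case: w => x' y' /=; rewrite [y * _]mulrC. Qed.
Lemma complex_ext (z w : C) : Re z = Re w -> Im z = Im w -> z = w.
Proof. by case: z => a b; case: w => c d /= -> ->. Qed.

Lemma nearR_P (x : R) (P : R -> Prop) :
  (\forall t \near x, P t) <-> exists2 d : R, 0 < d & forall t, `|t - x| < d -> P t.
Proof.
split=> [/nbhs_ballP[e /= e0 Pe]|[d d0 H]].
  by exists e => // t te; apply: Pe; rewrite /ball /= distrC.
by apply/nbhs_ballP; exists d => // t; rewrite /ball /= distrC => /H.
Qed.

Lemma rder_is_derive (f : R -> R) (x l : R) :
  (forall e : R, 0 < e -> exists2 d : R, 0 < d &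
    forall t, `|t - x| < d -> `|f t - f x - l * (t - x)| <= e * `|t - x|) <->
  is_derive (x : R) (1 : R) f l.
Proof.
have key : (h^-1 *: ((f \o shift x) (h *: (1 : R)) - f x) @[h --> (0 : R)^']) --> l <->
    (forall e : R, 0 < e -> exists2 d : R, 0 < d &
    forall t, `|t - x| < d -> `|f t - f x - l * (t - x)| <= e * `|t - x|).
  split.
  - move=> /cvgrPdist_le H e e0.
    have /= := H _ e0; rewrite near_withinE => /nearR_P[d d0 Hd].
    exists d => // t td.
    have [->|tz] := eqVneq t x; first by rewrite !subrr mulr0 subr0 normr0 mulr0.
    have tz0 : t - x != 0 by rewrite subr_eq0.
    have := Hd (t - x); rewrite subr0 => /(_ td tz0) /=.
    rewrite /GRing.scale /= mulr1 subrK => hh; rewrite distrC in hh.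
    have -> : f t - f x - l * (t - x) = ((t - x)^-1 * (f t - f x) - l) * (t - x).
      by field.
    by rewrite normrM ler_wpM2r.
  - move=> H; apply/cvgrPdist_le => e e0.
    have [d d0 Hd] := H _ e0.
    rewrite near_withinE; apply/nearR_P; exists d => // h; rewrite subr0 => hd h0 /=.
    have := Hd (h + x); rewrite addrK => /(_ hd) hh.
    rewrite /GRing.scale /= mulr1 distrC.
    have -> : h^-1 * (f (h + x) - f x) - l = (f (h + x) - f x - l * h) / h by field.
    by rewrite normrM normfV ler_pdivrMr // normr_gt0.
split=> [/key H|[dv dl]].
  by apply: DeriveDef; [apply/cvg_ex; exists l|exact: cvg_lim].
by apply/key; rewrite -dl; exact: dv.
Qed.

(* [H] is an antiderivative of [h] on [a, b], one-sided at the endpoints. *)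
Definition prim a b h H : Prop := forall x, a <= x <= b -> forall e : R, 0 < e ->
  exists2 d : R, 0 < d & forall y, a <= y <= b -> `|y - x| < d ->
    nrm (H y - H x - h x * toC (y - x)) <= e * `|y - x|.

Definition rcont a b h : Prop := forall x, a <= x <= b -> forall e : R, 0 < e ->
  exists2 d : R, 0 < d & forall y, a <= y <= b -> `|y - x| < d -> nrm (h y - h x) < e.

Lemma prim_sub a b a' b' h H : a <= a' -> b' <= b -> prim a b h H -> prim a' b' h H.
Proof.
move=> aa bb P x /andP[ax xb] e e0.
have [|d d0 Hd] := P x _ e e0; first by rewrite (le_trans aa ax) (le_trans xb bb).
exists d => // y /andP[ay yb]; apply: Hd; by rewrite (le_trans aa ay) (le_trans yb bb).
Qed.

Lemma eq_prim a b h h' H : (forall x, a <= x <= b -> h x = h' x) ->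
  prim a b h H -> prim a b h' H.
Proof. by move=> E P x xab e e0; have := P x xab e e0; rewrite E. Qed.

Lemma primD a b h h' H H' : prim a b h H -> prim a b h' H' ->
  prim a b (fun x => h x + h' x) (fun x => H x + H' x).
Proof.
move=> P P' x xab e e0.
have e2 : 0 < e / 2 by lra.
have [d d0 Hd] := P x xab _ e2; have [d' d0' Hd'] := P' x xab _ e2.
exists (Num.min d d'); first by rewrite lt_min d0.
move=> y yab; rewrite lt_min => /andP[/(Hd y yab) h1 /(Hd' y yab) h2].
have -> : H y + H' y - (H x + H' x) - (h x + h' x) * toC (y - x) =
  (H y - H x - h x * toC (y - x)) + (H' y - H' x - h' x * toC (y - x)) by ring.
apply: le_trans (le_nrmD _ _) _; lra.
Qed.

Lemma primZ a b h H (c : C) : prim a b h H ->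
  prim a b (fun x => c * h x) (fun x => c * H x).
Proof.
move=> P x xab e e0.
have L0 : 0 < nrm c + 1 by rewrite ltr_wpDl // nrm_ge0.
have [d d0 Hd] := P x xab (e / (nrm c + 1)) (divr_gt0 e0 L0).
exists d => // y yab yd.
have -> : c * H y - c * H x - c * h x * toC (y - x) =
  c * (H y - H x - h x * toC (y - x)) by ring.
rewrite nrmM.
apply: (@le_trans _ _ ((nrm c + 1) * (e / (nrm c + 1) * `|y - x|))).
  apply: ler_pM; rewrite ?nrm_ge0 //; last exact: Hd.
  lra.
by rewrite mulrA mulrCA divff ?mulr1 // gt_eqF.
Qed.

Lemma prim_opp a b h H : prim a b h H ->
  prim (- b) (- a) (fun s => - h (- s)) (fun s => H (- s)).
Proof.
move=> P x xab e e0.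
have [|d d0 Hd] := P (- x) _ e e0; first by move: xab; lra.
exists d => // y yab yd.
have := Hd (- y); rewrite -opprD normrN => /(_ _ yd).
rewrite toCN mulrN mulNr; apply.
by move: yab; lra.
Qed.

Lemma prim_affine a b p v (f F : C -> C) :
  (forall s, a <= s <= b -> cder F (p + toC s * v) (f (p + toC s * v))) ->
  prim a b (fun s => v * f (p + toC s * v)) (fun s => F (p + toC s * v)).
Proof.
move=> D s sab e e0.
have L0 : 0 < nrm v + 1 by rewrite ltr_wpDl // nrm_ge0.
have [d d0 Hd] := D s sab _ (divr_gt0 e0 L0).
have E y : p + toC y * v - (p + toC s * v) = toC (y - s) * v by rewrite toCB; ring.
exists (d / (nrm v + 1)); first by rewrite divr_gt0.
move=> y _; rewrite ltr_pdivlMr // => yd.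
have := Hd (p + toC y * v); rewrite E nrmM nrm_toC => hh.
have : `|y - s| * nrm v < d.
  by apply: le_lt_trans yd; apply: ler_wpM2l => //; lra.
move=> /hh; rewrite -mulrA [v * (_ * _)]mulrCA [v * toC _]mulrC => /le_trans; apply.
rewrite [leRHS](_ : _ = e / (nrm v + 1) * (`|y - s| * (nrm v + 1))); last first.
  by field; rewrite gt_eqF.
by rewrite ler_wpM2l ?divr_ge0 ?ler_wpM2l // ?ltW //; lra.
Qed.

(** A complex antiderivative has no mean value point, but the real function Re (c H) has one. The
    free factor c turns a chosen direction onto the real axis. *)
Lemma prim_MVT a b h H (c : C) : a <= b -> prim a b h H ->
  exists2 x, a <= x <= b & Re (c * (H b - H a)) = Re (c * h x) * (b - a).
Proof.
move=> ab P.
have P' := @primZ a b h H c P.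
have small (x : R) (xab : a <= x <= b) (e : R) (e0 : 0 < e) : exists2 d : R, 0 < d &
    forall y, a <= y <= b -> `|y - x| < d ->
    `|Re (c * H y) - Re (c * H x) - Re (c * h x) * (y - x)| <= e * `|y - x|.
  have [d d0 Hd] := P' x xab e e0; exists d => // y yab yd.
  apply: le_trans (Hd y yab yd); apply: le_trans (le_Re_nrm _).
  rewrite !(cReD, cReN, cReM) /= -[0]/(0:R).
  by rewrite !mulr0 subr0.
have wc (x e : R) : a <= x <= b -> 0 < e -> exists2 d : R, 0 < d &
    forall t, a <= t <= b -> `|t - x| < d -> `|Re (c * H x) - Re (c * H t)| < e.
  move=> xab e0; have [d d0 Hd] := small x xab 1 ltr01.
  pose L : R := `|Re (c * h x)|.
  have L0 : 0 < L + 1 by rewrite ltr_wpDl // /L.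
  exists (Num.min d (e / (L + 1))); first by rewrite lt_min d0 divr_gt0.
  move=> t tab; rewrite lt_min ltr_pdivlMr // => /andP[td te].
  have := Hd t tab td; rewrite mul1r distrC => h1.
  have -> : Re (c * H x) - Re (c * H t) = - (Re (c * H t) - Re (c * H x) -
    Re (c * h x) * (t - x)) - Re (c * h x) * (t - x) by ring.
  apply: le_lt_trans (ler_normB _ _) _; rewrite normrN normrM -/L distrC; move: te h1; lra.
have [] := @MVT_segment R (fun x => Re (c * H x)) (fun x => Re (c * h x)) a b ab.
- move=> x; rewrite in_itv /= => /andP[ax xb]; apply/rder_is_derive => e e0.
  have [|d d0 Hd] := small x _ e e0; first by rewrite !ltW.
  exists (Num.min d (Num.min (x - a) (b - x))).
    by rewrite !lt_min d0 !subr_gt0 ax xb.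
  move=> t; rewrite !lt_min => /andP[td /andP[ta tb]].
  by apply: Hd => //; move: ta tb; rewrite !ltr_norml; lra.
- apply/subspace_continuousP => x; rewrite /= in_itv /= => xab.
  apply/cvgrPdist_lt => e e0; rewrite near_withinE.
  have [d d0 Hd] := wc x e xab e0.
  apply/nearR_P; exists d => // t td; rewrite /= in_itv /= => tab; exact: Hd.
move=> x; rewrite in_itv /= => xab E; exists x => //.
by rewrite -E mulrBr cReD cReN.
Qed.

(** With D = H b - H a and c its conjugate, the mean value theorem for Re (c H) gives |D|^2 = Re (c
    h(x)) (b - a); dividing by |D| yields the bound. *)
Lemma prim_bound a b h H M : a <= b -> prim a b h H ->
  (forall x, a <= x <= b -> nrm (h x) <= M) -> nrm (H b - H a) <= M * (b - a).
Proof.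
move=> ab P B; set D := H b - H a.
have [->|D0] := eqVneq D 0.
  rewrite nrm0 mulr_ge0 ?subr_ge0 //.
  by apply: le_trans (B a _); rewrite ?nrm_ge0 // lexx.
have [x xab E] := prim_MVT (D^*)%C ab P.
have Dp : 0 < nrm D by rewrite nrm_gt0.
have E1 : Re ((D^*)%C * D) = nrm D ^+ 2.
  case: (D) => p q /=; rewrite mulNr opprK sqr_sqrtr ?addr_ge0 ?sqr_ge0 //.
have ND : nrm (D^*)%C = nrm D by case: (D) => p q /=; rewrite sqrrN.
rewrite -(ler_pM2l Dp) -expr2 -E1 E mulrA ler_wpM2r ?subr_ge0 //.
apply: le_trans (ler_norm _) _; apply: le_trans (le_Re_nrm _) _.
by rewrite nrmM ND ler_wpM2l ?B // nrm_ge0.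
Qed.

Lemma prim_uniq a b h H H' : a <= b -> prim a b h H -> prim a b h H' ->
  H b - H a = H' b - H' a.
Proof.
move=> ab P P'; apply/eqP; rewrite -subr_eq0 -nrm_eq0.
have Q := primD P (primZ (-1) P').
have := @prim_bound a b _ _ 0 ab Q.
rewrite mul0r => K; rewrite eq_le nrm_ge0 andbT.
have -> : H b - H a - (H' b - H' a) = H b + -1 * H' b - (H a + -1 * H' a) by ring.
by apply: K => x _; rewrite mulN1r subrr nrm0.
Qed.

(** Composition with the clamp onto [a, b] extends a function continuous on the segment to a
    continuous function on the line. *)
Lemma clamp_lip a b x y : `|Num.max a (Num.min b y) - Num.max a (Num.min b x)| <= `|y - x|.
Proof.
have max_lip (c u v : R) : `|Num.max c u - Num.max c v| <= `|u - v|.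
  rewrite ler_norml; case: (leP c u) => cu; case: (leP c v) => cv;
    have := ler_norm (u - v); have := ler_norm (v - u); rewrite [`|v - u|]distrC; lra.
have min_lip (c u v : R) : `|Num.min c u - Num.min c v| <= `|u - v|.
  rewrite ler_norml; case: (leP c u) => cu; case: (leP c v) => cv;
    have := ler_norm (u - v); have := ler_norm (v - u); rewrite [`|v - u|]distrC; lra.
exact: le_trans (max_lip _ _ _) (min_lip _ _ _).
Qed.

Lemma real_prim (f : R -> R) a b : a <= b ->
  (forall x, a <= x <= b -> forall e : R, 0 < e ->
    exists2 d : R, 0 < d & forall y, a <= y <= b -> `|y - x| < d -> `|f y - f x| < e) ->
  exists F : R -> R, forall x, a <= x <= b -> is_derive (x : R) (1 : R) F (f x).
Proof.
move=> ab cf; pose k x := Num.max a (Num.min b x).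
have kab x : a <= k x <= b by rewrite /k le_max lexx /= ge_max ab ge_min lexx.
have kid x : a <= x <= b -> k x = x.
  by move=> /andP[ax xb]; rewrite /k min_r // max_r.
have klip x y : `|k y - k x| <= `|y - x| by exact: clamp_lip.
have cfk : continuous (f \o k).
  move=> x; apply/cvgrPdist_lt => e e0.
  have [d d0 Hd] := cf (k x) (kab x) e e0.
  apply/nearR_P; exists d => // t td; rewrite distrC /=; apply: Hd => //.
  exact: le_lt_trans (klip _ _) td.
(* Starting at a - 1 makes a an interior point of the domain of integration, so that the derivative
   at a is two-sided; b + 1 plays the same part for b. *)
exists (fun x => (\int[@lebesgue_measure R]_(t in `[(a - 1), x]) ((f \o k) t)))%R.
move=> x xab.
have [||||dF F'] := @continuous_FTC1_closed R (f \o k) (a - 1) x (b + 1).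
- by move: xab; lra.
- apply: continuous_compact_integrable; first exact: segment_compact.
  exact: continuous_subspaceT.
- by move: xab; lra.
- exact: cfk.
apply: DeriveDef; first exact: dF.
by rewrite -derive1E F' /= kid.
Qed.

Lemma prim_exists a b h : a <= b -> rcont a b h -> exists H, prim a b h H.
Proof.
move=> ab ch.
have [F DF] : exists F : R -> R, forall x, a <= x <= b -> is_derive (x : R) (1 : R) F (Re (h x)).
  apply: real_prim => // x xab e e0; have [d d0 Hd] := ch x xab e e0.
  exists d => // y yab yd; apply: le_lt_trans (Hd y yab yd).
  by rewrite -cReN -cReD le_Re_nrm.
have [G DG] : exists F : R -> R, forall x, a <= x <= b -> is_derive (x : R) (1 : R) F (Im (h x)).
  apply: real_prim => // x xab e e0; have [d d0 Hd] := ch x xab e e0.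
  exists d => // y yab yd; apply: le_lt_trans (Hd y yab yd).
  by rewrite -cImN -cImD le_Im_nrm.
exists (fun x => (F x +i* G x)%C) => x xab e e0.
have e2 : 0 < e / 2 by lra.
have [d d0 Hd] := (rder_is_derive F x _).2 (DF x xab) _ e2.
have [d' d0' Hd'] := (rder_is_derive G x _).2 (DG x xab) _ e2.
exists (Num.min d d'); first by rewrite lt_min d0.
move=> y _; rewrite lt_min => /andP[/Hd h1 /Hd' h2].
apply: le_trans (le_nrm_ReIm _) _.
rewrite !(cReD, cImD, cReN, cImN, cReM, cImM) /= -[0]/(0:R) !mulr0 subr0 add0r; lra.
Qed.

(** The increment of any antiderivative, independent of the choice for a <= b by [prim_uniq]; the
    default value is 0 if there is none. *)
Definition cint a b h : C :=
  xget 0 [set v | exists H, prim a b h H /\ v = H b - H a].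

Lemma cintE a b h H : a <= b -> prim a b h H -> cint a b h = H b - H a.
Proof.
move=> ab P; rewrite /cint; case: xgetP => [v _ [H' [P' ->]]|/(_ (H b - H a)) []].
  exact: prim_uniq P' P.
by exists H.
Qed.

Lemma eq_cint a b h h' : a <= b -> rcont a b h ->
  (forall x, a <= x <= b -> h x = h' x) -> cint a b h = cint a b h'.
Proof.
move=> ab /(prim_exists ab)[H P] E.
by rewrite (cintE ab P) (cintE ab (eq_prim E P)).
Qed.

Lemma cintD a b h h' : a <= b -> rcont a b h -> rcont a b h' ->
  cint a b (fun x => h x + h' x) = cint a b h + cint a b h'.
Proof.
move=> ab /(prim_exists ab)[H P] /(prim_exists ab)[H' P'].
by rewrite (cintE ab P) (cintE ab P') (cintE ab (primD P P')); ring.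
Qed.

Lemma cintZ a b h c : a <= b -> rcont a b h ->
  cint a b (fun x => c * h x) = c * cint a b h.
Proof.
move=> ab /(prim_exists ab)[H P].
by rewrite (cintE ab P) (cintE ab (primZ c P)); ring.
Qed.

Lemma cint_chasles a b c h : a <= b -> b <= c -> rcont a c h ->
  cint a c h = cint a b h + cint b c h.
Proof.
move=> ab bc /(prim_exists (le_trans ab bc))[H P].
rewrite (cintE (le_trans ab bc) P) (cintE ab (prim_sub _ _ P)) //.
by rewrite (cintE bc (prim_sub _ _ P)) //; ring.
Qed.

Lemma cint_bound a b h M : a <= b -> rcont a b h ->
  (forall x, a <= x <= b -> nrm (h x) <= M) -> nrm (cint a b h) <= M * (b - a).
Proof.
move=> ab /(prim_exists ab)[H P] B; rewrite (cintE ab P); exact: prim_bound P B.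
Qed.

End Primitives.

(** * The complex exponential *)

Section Exponential.
Local Open Scope classical_set_scope.
Local Open Scope ring_scope.
Variable R : realType.
Local Notation C := (complexes R).
Local Notation Re := (@complex.Re R).
Local Notation Im := (@complex.Im R).
Local Notation toC := (@toC R).
Implicit Types (a b : R) (h H p : R -> C) (z w : C).

Definition cexp (z : C) : C :=
  (expR (Re z) * cos (Im z) +i* (expR (Re z) * sin (Im z)))%C.

Lemma cexpD z w : cexp (z + w) = cexp z * cexp w.
Proof.
apply: complex_ext; rewrite !(cReM, cImM) /= cReD cImD expRD ?cosD ?sinD; ring.
Qed.

Lemma cexp0 : cexp 0 = 1.
Proof. by rewrite /cexp /= expR0 cos0 sin0 !mul1r. Qed.

Lemma cexp_neq0 z : cexp z != 0.
Proof.
apply/eqP => E; have := cexpD z (- z); rewrite subrr cexp0 E mul0r.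
by move/eqP; rewrite oner_eq0.
Qed.

Lemma cexp_eq1 z : cexp z = 1 -> Re z = 0 /\ cos (Im z) = 1.
Proof.
move=> [] /= E1 E2.
have s0 : sin (Im z) = 0.
  by move/eqP: E2; rewrite mulf_eq0 gt_eqF ?expR_gt0 //= => /eqP.
have c2 : cos (Im z) ^+ 2 = 1 by rewrite -[RHS](cos2Dsin2 (Im z)) s0 expr0n addr0.
have c0 : 0 < cos (Im z) by rewrite -(pmulr_rgt0 _ (expR_gt0 (Re z))) E1.
have c1 : cos (Im z) = 1.
  by apply/eqP; rewrite -(@eqrXn2 _ 2) ?c2 ?expr1n // ltW.
split=> //; apply: expR_inj; by rewrite expR0 -[LHS]mulr1 -c1 E1.
Qed.

Lemma cos_eq1_small (c : R) : - (pi *+ 2) < c < pi *+ 2 -> cos c = 1 -> c = 0.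
Proof.
move=> /andP[cl cu] cE.
have E : sin (c / 2) = 0.
  have : cos ((c / 2) *+ 2) = 1 by rewrite -mulr_natr divfK ?pnatr_eq0.
  rewrite cos_mulr2n cos2sin2 => E; apply/eqP; rewrite -sqrf_eq0; apply/eqP.
  by move: E; rewrite mulr2n; lra.
have [c0|c0|//] := ltgtP c 0.
  have : 0 < sin (- (c / 2)) by apply: sin_gt0_pi; move: cl cu; rewrite mulr2n; lra.
  by rewrite sinN E oppr0 ltxx.
have : 0 < sin (c / 2) by apply: sin_gt0_pi; move: cl cu; rewrite mulr2n; lra.
by rewrite E ltxx.
Qed.

Lemma cexp_ker z : cexp z = 1 -> exists k : int, z = (0 +i* (k%:~R * (pi *+ 2)))%C.
Proof.
move=> /cexp_eq1[r0 c1].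
have pi2 : 0 < pi *+ 2 :> R by rewrite pmulrn_rgt0 ?pi_gt0.
pose k := Num.floor (Im z / (pi *+ 2)); exists k.
suff E : Im z - k%:~R * (pi *+ 2) = 0.
  by apply: complex_ext => //=; apply/eqP; rewrite -subr_eq0 E.
apply: cos_eq1_small.
  have /andP[k1 k2] := floor_itv (Im z / (pi *+ 2)).
  rewrite ler_pdivlMr // in k1; rewrite ltr_pdivrMr // intrD mulrDl mul1r in k2.
  by move: k1 k2 pi2; rewrite -/k; lra.
apply: etrans c1; case: (k) => j.
  by rewrite -[LHS](periodicn (@cosD2pi R) j) -pmulrn mulr_natl subrK.
by rewrite -[RHS](periodicn (@cosD2pi R) j.+1) NegzE mulrNz mulNr opprK -pmulrn mulr_natl.
Qed.

Lemma cexp_2pi z : cexp z = 1 -> 0 < Im z < pi *+ 4 -> z = (0 +i* (pi *+ 2))%C.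
Proof.
move=> /cexp_eq1[r0 c1] /andP[i0 i4]; apply: complex_ext => //=.
apply/eqP; rewrite -subr_eq0; apply/eqP; apply: cos_eq1_small.
  by rewrite !mulr2n; move: i0 i4; rewrite !mulrS mulr0n; lra.
by rewrite -[LHS](@cosD2pi R) subrK.
Qed.

(** The derivative at 0 comes from those of the three real functions, and [cexpD] carries it to any
    z. *)
Lemma cder_cexp z : cder cexp z (cexp z).
Proof.
have base : cder cexp 0 1.
  have De : is_derive (0 : R) (1 : R) (@expR R) 1 by have := is_derive_expR (0 : R); rewrite expR0.
  have Dc : is_derive (0 : R) (1 : R) (@cos R) 0 by have := is_derive_cos (0 : R); rewrite sin0 oppr0.
  have Ds : is_derive (0 : R) (1 : R) (@sin R) 1 by have := is_derive_sin (0 : R); rewrite cos0.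
  (* The errors collected at the end amount to at most 6 e' |t|, which e / 8 absorbs; e' <= 1 bounds
     the auxiliary factors. *)
  move=> e e0; pose e' := Num.min (e / 8) 1.
  have e'0 : 0 < e' by rewrite lt_min divr_gt0 //=; lra.
  have e'1 : e' <= 1 by rewrite ge_min lexx orbT.
  have e'8 : e' <= e / 8 by rewrite ge_min lexx.
  have [d1 d10 H1] := (rder_is_derive _ _ _).2 De _ e'0.
  have [d2 d20 H2] := (rder_is_derive _ _ _).2 Dc _ e'0.
  have [d3 d30 H3] := (rder_is_derive _ _ _).2 Ds _ e'0.
  exists (Num.min (Num.min d1 d2) (Num.min d3 (e' / 2))).
    by rewrite !lt_min d10 d20 d30 divr_gt0.
  move=> t; rewrite subr0 mul1r !lt_min => /andP[/andP[t1 t2] /andP[t3 t4]].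
  have ra : `|Re t| <= nrm t := le_Re_nrm t.
  have ia : `|Im t| <= nrm t := le_Im_nrm t.
  have := H1 (Re t); rewrite subr0 expR0 mul1r => /(_ (le_lt_trans ra t1)) h1.
  have := H2 (Im t); rewrite subr0 cos0 mul0r subr0 => /(_ (le_lt_trans ia t2)) h2.
  have := H3 (Im t); rewrite subr0 sin0 subr0 mul1r => /(_ (le_lt_trans ia t3)) h3.
  apply: le_trans (le_nrm_ReIm _) _; rewrite cexp0 !(cReD, cImD, cReN, cImN) /= -[0]/(0:R) subr0.
  have N0 := nrm_ge0 t.
  set a := Re t in ra h1 *; set b := Im t in ia h2 h3 *; set n := nrm t in ra ia t4 N0 *.
  set E := expR a in h1 *; set c := cos b in h2 *; set s := sin b in h3 *.
  have h1' : `|E - 1 - a| <= e' * n by apply: le_trans h1 _; rewrite ler_wpM2l // ltW.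
  have h2' : `|c - 1| <= e' * n by apply: le_trans h2 _; rewrite ler_wpM2l // ltW.
  have h3' : `|s - b| <= e' * n by apply: le_trans h3 _; rewrite ler_wpM2l // ltW.
  have n1 : e' * n <= n by rewrite ler_piMl.
  have E1 : `|E - 1| <= e'.
    have -> : E - 1 = (E - 1 - a) + a by ring.
    apply: le_trans (ler_normD _ _) _; lra.
  have E2 : `|E| <= 2.
    have -> : E = (E - 1) + 1 by ring.
    apply: le_trans (ler_normD _ _) _; rewrite normr1; lra.
  have S2 : `|s| <= 2 * n.
    have -> : s = (s - b) + b by ring.
    apply: le_trans (ler_normD _ _) _; lra.
  have -> : E * c - 1 - a = (E - 1 - a) + E * (c - 1) by ring.
  have -> : E * s - b = (s - b) + (E - 1) * s by ring.
  have P1 : `|E * (c - 1)| <= 2 * (e' * n) by rewrite normrM ler_pM.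
  have P2 : `|(E - 1) * s| <= e' * (2 * n) by rewrite normrM ler_pM.
  apply: (@le_trans _ _ (6 * (e' * n))).
    have := ler_normD (E - 1 - a) (E * (c - 1)); have := ler_normD (s - b) ((E - 1) * s); lra.
  have : e' * n <= e / 8 * n by rewrite ler_wpM2r.
  have : 0 <= e * n by rewrite mulr_ge0 // ltW.
  lra.
move=> e e0.
have L0 : 0 < nrm (cexp z) by rewrite nrm_gt0 cexp_neq0.
have [d d0 Hd] := base _ (divr_gt0 e0 L0).
exists d => // t td; have := Hd (t - z); rewrite subr0 cexp0 mul1r => /(_ td) hh.
have -> : cexp t - cexp z - cexp z * (t - z) = cexp z * (cexp (t - z) - 1 - (t - z)).
  have -> : cexp t = cexp z * cexp (t - z) by rewrite -cexpD addrC subrK.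
  ring.
by rewrite nrmM mulrC -ler_pdivlMr // mulrAC.
Qed.

Lemma prim_cont a b h H : prim a b h H -> rcont a b H.
Proof.
move=> P x xab e e0; have [d d0 Hd] := P x xab 1 ltr01.
have L0 : 0 < nrm (h x) + 1 by rewrite ltr_wpDl // nrm_ge0.
exists (Num.min d (e / (nrm (h x) + 1))); first by rewrite lt_min d0 divr_gt0.
move=> y yab; rewrite lt_min => /andP[/(Hd y yab) h1 h2].
have -> : H y - H x = (H y - H x - h x * toC (y - x)) + h x * toC (y - x) by ring.
apply: le_lt_trans (le_nrmD _ _) _; rewrite nrmM nrm_toC.
move: h2; rewrite ltr_pdivlMr //; lra.
Qed.

Lemma prim_comp a b h H (F f : C -> C) : prim a b h H ->
  (forall x, a <= x <= b -> cder F (H x) (f (H x))) ->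
  prim a b (fun x => f (H x) * h x) (fun x => F (H x)).
Proof.
move=> P D x xab e e0.
pose K := nrm (f (H x)) + nrm (h x) + 1.
have n1 := nrm_ge0 (f (H x)); have n2 := nrm_ge0 (h x).
have K0 : 0 < K by rewrite /K; lra.
pose e' := Num.min (e / K) 1.
have e'0 : 0 < e' by rewrite lt_min divr_gt0 //=.
have e'1 : e' <= 1 by rewrite ge_min lexx orbT.
have e'K : e' * K <= e by rewrite -ler_pdivlMr // ge_min lexx.
have [d1 d10 H1] := D x xab _ e'0.
have [d2 d20 H2] := P x xab _ e'0.
have [d3 d30 H3] := prim_cont P xab d10.
exists (Num.min d2 d3); first by rewrite lt_min d20.
move=> y yab; rewrite lt_min => /andP[y2 y3].
have h1 := H1 _ (H3 y yab y3); have h2 := H2 y yab y2.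
set dy := toC (y - x) in h2 *; set r := `|y - x| in h2 *.
have r0 : 0 <= r by rewrite /r.
have h4 : nrm (H y - H x) <= (nrm (h x) + 1) * r.
  have -> : H y - H x = (H y - H x - h x * dy) + h x * dy by ring.
  apply: le_trans (le_nrmD _ _) _; rewrite nrmM /dy nrm_toC -/r.
  have : e' * r <= r by rewrite ler_piMl.
  lra.
have -> : F (H y) - F (H x) - f (H x) * h x * dy =
  (F (H y) - F (H x) - f (H x) * (H y - H x)) + f (H x) * (H y - H x - h x * dy) by ring.
apply: le_trans (le_nrmD _ _) _; rewrite nrmM.
have h5 : nrm (f (H x)) * nrm (H y - H x - h x * dy) <= nrm (f (H x)) * (e' * r).
  by rewrite ler_wpM2l.
have h6 : e' * nrm (H y - H x) <= e' * ((nrm (h x) + 1) * r) by rewrite ler_wpM2l // ltW.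
have : e' * K * r <= e * r by rewrite ler_wpM2r.
rewrite /K; lra.
Qed.

Lemma primM a b h H h' H' : prim a b h H -> prim a b h' H' ->
  prim a b (fun x => h x * H' x + H x * h' x) (fun x => H x * H' x).
Proof.
(* polarization: [4 H H' = (H + H')^2 - (H - H')^2] *)
have sq k K : prim a b k K -> prim a b (fun x => 2 * K x * k x) (fun x => K x ^+ 2).
  move=> P; apply: (@prim_comp a b k K (fun z => z ^+ 2) (fun z => 2 * z) P) => x _.
  apply: cder_eq (cderM (cder_id _) (cder_id _)); rewrite /=; ring.
move=> P P'.
have Q := primD (primZ (1 / 4) (sq _ _ (primD P P')))
                (primZ (- 1 / 4) (sq _ _ (primD P (primZ (-1) P')))).
have -> : (fun x => H x * H' x) = (fun x => 1 / 4 * (H x + H' x) ^+ 2 +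
   (- 1 / 4) * (H x + -1 * H' x) ^+ 2) by apply/funext => x; field.
by apply: eq_prim Q => x _ /=; field.
Qed.

Lemma prim_const a b H : a <= b -> prim a b (fun=> 0) H ->
  forall x, a <= x <= b -> H x = H a.
Proof.
move=> ab P x /andP[ax xb]; apply/eqP; rewrite -subr_eq0 -nrm_eq0 eq_le nrm_ge0 andbT.
have := @prim_bound R a x (fun=> 0) H 0 ax (prim_sub (lexx a) xb P).
by rewrite mul0r; apply => y _; rewrite nrm0.
Qed.

(** The product p exp(-H) has derivative 0. This exponentiates logarithmic integrals along an edge
    or a period without any choice of a branch of the logarithm. *)
Lemma prim_exp a b h H p : a <= b -> prim a b h H -> prim a b (fun s => h s * p s) p ->
  forall s, a <= s <= b -> p s = p a * cexp (H s - H a).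
Proof.
move=> ab P Q s sab.
have E := primM Q (@prim_comp a b _ _ cexp cexp (primZ (-1) P) (fun x _ => cder_cexp _)).
have E' : prim a b (fun=> 0) (fun x => p x * cexp (-1 * H x)).
  by apply: eq_prim E => x _ /=; ring.
have := prim_const ab E' sab => /= K.
have -> : H s - H a = H s + -1 * H a by rewrite mulN1r.
rewrite cexpD mulrCA -K mulrCA -cexpD.
by rewrite mulN1r subrr cexp0 mulr1.
Qed.

End Exponential.

(** * Integrals along parallelograms *)

Section Contour.
Local Open Scope classical_set_scope.
Local Open Scope ring_scope.
Variable R : realType.
Local Notation C := (complexes R).
Local Notation Re := (@complex.Re R).
Local Notation Im := (@complex.Im R).
Local Notation toC := (@toC R).
Variable tau : C.
Hypothesis tau_gt0 : 0 < Im tau.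
Implicit Types (a b x y d M : R) (h H : R -> C) (z w v c p : C) (f g F : C -> C).

Lemma tau_neq0 : tau != 0.
Proof. by apply/eqP => E; move: tau_gt0; rewrite E ltxx. Qed.

Lemma nrm_tau_gt0 : 0 < nrm tau.
Proof. by rewrite nrm_gt0 tau_neq0. Qed.

(** Real coordinates in the basis (1, tau) of C: rectangles in (x, y) are parallelograms with sides
    parallel to the periods. *)
Definition pt x y : C := toC x + toC y * tau.

Lemma ptB x y x' y' : pt x y - pt x' y' = pt (x - x') (y - y').
Proof. by rewrite /pt !toCB; ring. Qed.

Lemma nrm_pt x y : nrm (pt x y) <= `|x| + `|y| * nrm tau.
Proof. by apply: le_trans (le_nrmD _ _) _; rewrite nrmM !nrm_toC. Qed.

Lemma Im_pt x y : Im (pt x y) = y * Im tau.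
Proof. by rewrite /pt cImD cImM /= -[0]/(0:R); ring. Qed.

Lemma Re_pt x y : Re (pt x y) = x + y * Re tau.
Proof. by rewrite /pt cReD cReM /= -[0]/(0:R); ring. Qed.

Lemma pt_surj z : exists x y, z = pt x y.
Proof.
exists (Re z - Im z / Im tau * Re tau), (Im z / Im tau).
by apply: complex_ext; rewrite ?Re_pt ?Im_pt; [ring|rewrite divfK // gt_eqF].
Qed.

Lemma pt_inj x y x' y' : pt x y = pt x' y' -> x = x' /\ y = y'.
Proof.
move=> E; have := congr1 (@complex.Im R) E; rewrite !Im_pt.
move=> /mulIf -/(_ (lt0r_neq0 tau_gt0)) yy; split=> //.
by have := congr1 (@complex.Re R) E; rewrite !Re_pt yy => /addIr.
Qed.

Definition rect x0 x1 y0 y1 z := exists x y, [/\ x0 <= x <= x1, y0 <= y <= y1 & z = pt x y].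

Definition bdry x0 x1 y0 y1 z := exists x y,
  [/\ x0 <= x <= x1, y0 <= y <= y1, z = pt x y & [\/ x = x0, x = x1, y = y0 | y = y1]].

Lemma bdry_rect x0 x1 y0 y1 z : bdry x0 x1 y0 y1 z -> rect x0 x1 y0 y1 z.
Proof. by move=> [x [y [? ? ? _]]]; exists x, y. Qed.

Definition hor f y x0 x1 : C := cint x0 x1 (fun x => f (pt x y)).
Definition ver f x y0 y1 : C := tau * cint y0 y1 (fun y => f (pt x y)).

(* The integral along the boundary of the parallelogram [pt [x0, x1] [y0, y1]]. *)
Definition J f x0 x1 y0 y1 : C :=
  hor f y0 x0 x1 + ver f x1 y0 y1 - hor f y1 x0 x1 - ver f x0 y0 y1.

Lemma rcont_hor f y x0 x1 : (forall x, x0 <= x <= x1 -> ccont f (pt x y)) ->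
  rcont x0 x1 (fun x => f (pt x y)).
Proof.
move=> cf x xab e e0; have [d d0 Hd] := cf x xab e e0; exists d => // x' _ x'd.
by apply: Hd; rewrite ptB subrr /pt toC0 mul0r addr0 nrm_toC.
Qed.

Lemma rcont_ver f x y0 y1 : (forall y, y0 <= y <= y1 -> ccont f (pt x y)) ->
  rcont y0 y1 (fun y => f (pt x y)).
Proof.
move=> cf y yab e e0; have [d d0 Hd] := cf y yab e e0.
have N0 := nrm_tau_gt0.
exists (d / nrm tau); first by rewrite divr_gt0.
move=> y' _; rewrite ltr_pdivlMr // => y'd.
by apply: Hd; rewrite ptB subrr /pt toC0 add0r nrmM nrm_toC.
Qed.

Lemma prim_hor f F y x0 x1 : (forall x, x0 <= x <= x1 -> cder F (pt x y) (f (pt x y))) ->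
  prim x0 x1 (fun x => f (pt x y)) (fun x => F (pt x y)).
Proof.
move=> D; have E x : toC y * tau + toC x * 1 = pt x y by rewrite /pt mulr1 addrC.
have := @prim_affine R x0 x1 (toC y * tau) 1 f F.
have -> : (fun s => F (toC y * tau + toC s * 1)) = (fun x => F (pt x y)).
  by apply/funext => s; rewrite E.
have -> : (fun s => 1 * f (toC y * tau + toC s * 1)) = (fun x => f (pt x y)).
  by apply/funext => s; rewrite E mul1r.
by apply=> s sab; rewrite E; exact: D.
Qed.

Lemma prim_ver f F x y0 y1 : (forall y, y0 <= y <= y1 -> cder F (pt x y) (f (pt x y))) ->
  prim y0 y1 (fun y => tau * f (pt x y)) (fun y => F (pt x y)).
Proof. by move=> D; apply: prim_affine. Qed.

Lemma hor_prim f F y x0 x1 : x0 <= x1 ->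
  (forall x, x0 <= x <= x1 -> cder F (pt x y) (f (pt x y))) ->
  hor f y x0 x1 = F (pt x1 y) - F (pt x0 y).
Proof. by move=> xx D; rewrite /hor (cintE xx (prim_hor D)). Qed.

Lemma ver_prim f F x y0 y1 : y0 <= y1 ->
  (forall y, y0 <= y <= y1 -> cder F (pt x y) (f (pt x y))) ->
  ver f x y0 y1 = F (pt x y1) - F (pt x y0).
Proof.
move=> yy D; rewrite /ver.
have P : prim y0 y1 (fun y => f (pt x y)) (fun y => tau^-1 * F (pt x y)).
  apply: eq_prim (primZ tau^-1 (prim_ver D)) => y _ /=.
  by rewrite mulrA mulVf ?mul1r // tau_neq0.
by rewrite (cintE yy P); field; exact: tau_neq0.
Qed.

Section Linear.
Local Open Scope classical_set_scope.
Local Open Scope ring_scope.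
Variables x0 x1 y0 y1 : R.
Hypotheses (xx : x0 <= x1) (yy : y0 <= y1).
Let bc f := forall z, bdry x0 x1 y0 y1 z -> ccont f z.

Lemma bdry_h0 x : x0 <= x <= x1 -> bdry x0 x1 y0 y1 (pt x y0).
Proof. by move=> xab; exists x, y0; split; rewrite ?lexx //; constructor 3. Qed.
Lemma bdry_h1 x : x0 <= x <= x1 -> bdry x0 x1 y0 y1 (pt x y1).
Proof. by move=> xab; exists x, y1; split; rewrite ?lexx ?yy //; constructor 4. Qed.
Lemma bdry_v0 y : y0 <= y <= y1 -> bdry x0 x1 y0 y1 (pt x0 y).
Proof. by move=> xab; exists x0, y; split; rewrite ?lexx //; constructor 1. Qed.
Lemma bdry_v1 y : y0 <= y <= y1 -> bdry x0 x1 y0 y1 (pt x1 y).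
Proof. by move=> xab; exists x1, y; split; rewrite ?lexx ?xx //; constructor 2. Qed.

Lemma bc_h0 f : bc f -> rcont x0 x1 (fun x => f (pt x y0)).
Proof. by move=> B; apply: rcont_hor => x xab; apply/B/bdry_h0. Qed.
Lemma bc_h1 f : bc f -> rcont x0 x1 (fun x => f (pt x y1)).
Proof. by move=> B; apply: rcont_hor => x xab; apply/B/bdry_h1. Qed.
Lemma bc_v0 f : bc f -> rcont y0 y1 (fun y => f (pt x0 y)).
Proof. by move=> B; apply: rcont_ver => x xab; apply/B/bdry_v0. Qed.
Lemma bc_v1 f : bc f -> rcont y0 y1 (fun y => f (pt x1 y)).
Proof. by move=> B; apply: rcont_ver => x xab; apply/B/bdry_v1. Qed.

Lemma eq_J f g : bc f -> (forall z, bdry x0 x1 y0 y1 z -> f z = g z) ->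
  J f x0 x1 y0 y1 = J g x0 x1 y0 y1.
Proof.
move=> B E; rewrite /J /hor /ver.
rewrite (eq_cint xx (bc_h0 B) (fun x xab => E _ (bdry_h0 xab))).
rewrite (eq_cint xx (bc_h1 B) (fun x xab => E _ (bdry_h1 xab))).
rewrite (eq_cint yy (bc_v0 B) (fun x xab => E _ (bdry_v0 xab))).
by rewrite (eq_cint yy (bc_v1 B) (fun x xab => E _ (bdry_v1 xab))).
Qed.

Lemma JD f g : bc f -> bc g ->
  J (fun z => f z + g z) x0 x1 y0 y1 = J f x0 x1 y0 y1 + J g x0 x1 y0 y1.
Proof.
move=> B B'; rewrite /J /hor /ver.
rewrite (cintD xx (bc_h0 B) (bc_h0 B')) (cintD xx (bc_h1 B) (bc_h1 B')).
by rewrite (cintD yy (bc_v0 B) (bc_v0 B')) (cintD yy (bc_v1 B) (bc_v1 B')); ring.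
Qed.

Lemma JZ c f : bc f -> J (fun z => c * f z) x0 x1 y0 y1 = c * J f x0 x1 y0 y1.
Proof.
move=> B; rewrite /J /hor /ver.
rewrite (cintZ c xx (bc_h0 B)) (cintZ c xx (bc_h1 B)).
by rewrite (cintZ c yy (bc_v0 B)) (cintZ c yy (bc_v1 B)); ring.
Qed.

Lemma J_bound f M : bc f -> (forall z, bdry x0 x1 y0 y1 z -> nrm (f z) <= M) ->
  nrm (J f x0 x1 y0 y1) <= M * (2 * ((x1 - x0) + (y1 - y0) * nrm tau)).
Proof.
move=> B E; rewrite /J.
have h0 := cint_bound xx (bc_h0 B) (fun x xab => E _ (bdry_h0 xab)).
have h1 := cint_bound xx (bc_h1 B) (fun x xab => E _ (bdry_h1 xab)).
have v0 := cint_bound yy (bc_v0 B) (fun x xab => E _ (bdry_v0 xab)).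
have v1 := cint_bound yy (bc_v1 B) (fun x xab => E _ (bdry_v1 xab)).
apply: le_trans (le_nrmB _ _) _; apply: le_trans (lerD (le_nrmB _ _) (lexx _)) _.
apply: le_trans (lerD (lerD (le_nrmD _ _) (lexx _)) (lexx _)) _.
rewrite /hor /ver !nrmM.
have t0 := ltW nrm_tau_gt0.
have := ler_wpM2l t0 v0; have := ler_wpM2l t0 v1; lra.
Qed.

Lemma J_prim f F : (forall z, bdry x0 x1 y0 y1 z -> cder F z (f z)) ->
  J f x0 x1 y0 y1 = 0.
Proof.
move=> D; rewrite /J.
rewrite (hor_prim xx (fun x xab => D _ (bdry_h0 xab))).
rewrite (hor_prim xx (fun x xab => D _ (bdry_h1 xab))).
rewrite (ver_prim yy (fun x xab => D _ (bdry_v0 xab))).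
rewrite (ver_prim yy (fun x xab => D _ (bdry_v1 xab))); ring.
Qed.

End Linear.

Lemma J_splitx f x0 x1 x2 y0 y1 : x0 <= x1 -> x1 <= x2 -> y0 <= y1 ->
  (forall z, bdry x0 x2 y0 y1 z -> ccont f z) ->
  J f x0 x2 y0 y1 = J f x0 x1 y0 y1 + J f x1 x2 y0 y1.
Proof.
move=> h1 h2 h3 B; rewrite /J.
rewrite (_ : hor f y0 x0 x2 = hor f y0 x0 x1 + hor f y0 x1 x2); last first.
  exact: cint_chasles h1 h2 (bc_h0 h3 B).
rewrite (_ : hor f y1 x0 x2 = hor f y1 x0 x1 + hor f y1 x1 x2); first by ring.
exact: cint_chasles h1 h2 (bc_h1 h3 B).
Qed.

Lemma J_splity f x0 x1 y0 y1 y2 : x0 <= x1 -> y0 <= y1 -> y1 <= y2 ->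
  (forall z, bdry x0 x1 y0 y2 z -> ccont f z) ->
  J f x0 x1 y0 y2 = J f x0 x1 y0 y1 + J f x0 x1 y1 y2.
Proof.
move=> h1 h2 h3 B; rewrite /J.
rewrite (_ : ver f x0 y0 y2 = ver f x0 y0 y1 + ver f x0 y1 y2); last first.
  by rewrite /ver (cint_chasles h2 h3 (bc_v0 h1 B)) mulrDr.
rewrite (_ : ver f x1 y0 y2 = ver f x1 y0 y1 + ver f x1 y1 y2); first by ring.
by rewrite /ver (cint_chasles h2 h3 (bc_v1 h1 B)) mulrDr.
Qed.

Lemma exp2V_lt (e : R) : 0 < e -> exists k, (2^-1 : R) ^+ k < e.
Proof.
move=> e0; have := archi_boundP (ltW (_ : 0 < e^-1)); rewrite invr_gt0 => /(_ e0) B.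
exists (Num.bound e^-1); rewrite exprVn invf_plt ?posrE ?exprn_gt0 //.
by apply: lt_trans B _; rewrite -natrX ltr_nat ltn_expl.
Qed.

Lemma nested_point (u v : nat -> R) : (forall k, u k <= u k.+1) ->
  (forall k, v k.+1 <= v k) -> (forall k, u k <= v k) ->
  exists q, forall k, u k <= q <= v k.
Proof.
move=> hu hv huv.
have mu i j : (i <= j)%N -> u i <= u j.
  by move=> /subnK <-; elim: (j - i)%N => // k IH; rewrite addSn (le_trans IH).
have mv i j : (i <= j)%N -> v j <= v i.
  by move=> /subnK <-; elim: (j - i)%N => // k IH; rewrite addSn (le_trans _ IH).
have uv i j : u i <= v j.
  apply: le_trans (mu _ _ (leq_maxl i j)) _; apply: le_trans (huv _) _.
  by rewrite mv // leq_maxr.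
exists (sup (range u)) => k; apply/andP; split.
  by apply: ub_le_sup; [exists (v 0%N) => _ [i _ <-]|exists k].
by apply: ge_sup; [exists (u 0%N), 0%N|move=> _ [i _ <-]].
Qed.

(* Local-to-global induction on the dyadic subdivision of a rectangle. *)
Lemma rect_bisect (S : R -> R -> R -> Prop) (W L : R) x0 y0 : 0 <= W -> 0 <= L ->
  (forall x y d, 0 < d -> S x y (d / 2) -> S (x + d / 2 * W) y (d / 2) ->
     S x (y + d / 2 * L) (d / 2) -> S (x + d / 2 * W) (y + d / 2 * L) (d / 2) -> S x y d) ->
  (forall p q : R, x0 <= p <= x0 + W -> y0 <= q <= y0 + L -> exists2 e : R, 0 < e &
     forall x y d, 0 < d -> d < e -> x <= p <= x + d * W -> y <= q <= y + d * L -> S x y d) ->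
  S x0 y0 1.
Proof.
move=> W0 L0 Hsub Hloc; apply: contrapT => nS.
pose sub (s s' : R * R * R) := let: (x, y, d) := s in let: (x', y', d') := s' in
  [/\ d' = d / 2, x' = x \/ x' = x + d / 2 * W & y' = y \/ y' = y + d / 2 * L].
pose bad (s : R * R * R) := let: (x, y, d) := s in ~ S x y d.
(* A bad quarter of a bad rectangle. The conditions stand under the existential so that [choice]
   gives a function on all triples, unconstrained elsewhere. *)
have step (s : R * R * R) : exists s', 0 < s.2 -> bad s -> sub s s' /\ bad s'.
  case: s => [[x y] d] /=.
  have [[d0 b]|nb] := pselect (0 < d /\ ~ S x y d); last first.
    by exists (x, y, d) => d0 b; case: nb.
  apply: contrapT => N; apply: b; apply: Hsub => //; apply: contrapT => b; apply: N;
    [exists (x, y, d / 2)|exists (x + d / 2 * W, y, d / 2)|exists (x, y + d / 2 * L, d / 2)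
    |exists (x + d / 2 * W, y + d / 2 * L, d / 2)] => _ _; split=> //; split=> //;
    by [left|right].
have [nx Hnx] := choice step.
pose s k := iter k nx (x0, y0, 1).
have inv k : [/\ (s k).2 = (2^-1) ^+ k, bad (s k) & sub (s k) (s k.+1)].
  have base : (s k).2 = (2^-1) ^+ k /\ bad (s k).
    elim: k => [|k [IH1 IH2]]; first by split.
    have p0 : 0 < (s k).2 by rewrite IH1 exprn_gt0 // invr_gt0.
    have [] := Hnx (s k) p0 IH2; rewrite -[s k.+1]/(nx (s k)).
    case: (nx (s k)) => [[x' y'] d']; case: (s k) IH1 IH2 p0 => [[x y] d] /= -> _ _.
    by move=> [-> _ _]; split=> //; rewrite exprSr.
  have [b1 b2] := base; have p0 : 0 < (s k).2 by rewrite b1 exprn_gt0 // invr_gt0.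
  by have [] := Hnx (s k) p0 b2.
have D0 k : 0 < (s k).2 by have [-> _ _] := inv k; rewrite exprn_gt0 // invr_gt0.
have stepx k : (s k).1.1 <= (s k.+1).1.1 /\
   (s k.+1).1.1 + (s k.+1).2 * W <= (s k).1.1 + (s k).2 * W.
  have [_ _] := inv k; have := D0 k; case: (s k) (s k.+1) => [[x y] d] [[x' y'] d'] /= d0.
  move=> [-> hx _]; have : 0 <= d * W by rewrite mulr_ge0 // ltW.
  by case: hx => ->; lra.
have stepy k : (s k).1.2 <= (s k.+1).1.2 /\
   (s k.+1).1.2 + (s k.+1).2 * L <= (s k).1.2 + (s k).2 * L.
  have [_ _] := inv k; have := D0 k; case: (s k) (s k.+1) => [[x y] d] [[x' y'] d'] /= d0.
  move=> [-> _ hx]; have : 0 <= d * L by rewrite mulr_ge0 // ltW.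
  by case: hx => ->; lra.
have [p Hp] := @nested_point (fun k => (s k).1.1) (fun k => (s k).1.1 + (s k).2 * W)
  (fun k => (stepx k).1) (fun k => (stepx k).2)
  (fun k => ltac:(by rewrite lerDl mulr_ge0 // ltW)).
have [q Hq] := @nested_point (fun k => (s k).1.2) (fun k => (s k).1.2 + (s k).2 * L)
  (fun k => (stepy k).1) (fun k => (stepy k).2)
  (fun k => ltac:(by rewrite lerDl mulr_ge0 // ltW)).
have hp0 : x0 <= p <= x0 + W by have := Hp 0%N; rewrite /= mul1r.
have hq0 : y0 <= q <= y0 + L by have := Hq 0%N; rewrite /= mul1r.
have [e e0 He] := Hloc p q hp0 hq0.
have [k ke] := exp2V_lt e0.
have [dk bk _] := inv k; have := Hp k; have := Hq k; have := D0 k; rewrite -dk in ke.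
by case: (s k) bk ke => [[x y] d] /= b de d0 hq hp; apply: b; apply: He.
Qed.

(** The bound e (2 (d K)^2) is quadratic in the scale d, so the bounds of the four quarters add up
    to that of the whole and bisection reduces to small parallelograms. There f differs from an
    affine function, which has a primitive, by at most e times the distance to the centre of
    expansion. *)
Theorem goursat f x0 x1 y0 y1 : x0 <= x1 -> y0 <= y1 ->
  (forall z, rect x0 x1 y0 y1 z -> exists l, cder f z l) ->
  J f x0 x1 y0 y1 = 0.
Proof.
move=> hx hy D.
pose W := x1 - x0; pose L := y1 - y0.
have W0 : 0 <= W by rewrite subr_ge0.
have L0 : 0 <= L by rewrite subr_ge0.
pose K := W + L * nrm tau.
have t0 := ltW nrm_tau_gt0.
have K0 : 0 <= K by rewrite addr_ge0 ?mulr_ge0.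
suff small (e : R) : 0 < e -> nrm (J f x0 x1 y0 y1) <= e * (2 * K ^+ 2).
  apply/eqP; rewrite -nrm_eq0 eq_le nrm_ge0 andbT leNgt; apply/negP => J0.
  have K1 : 0 < 2 * K ^+ 2 + 1 by rewrite ltr_wpDl // mulr_ge0 // exprn_ge0.
  have := small _ (divr_gt0 J0 (mulr_gt0 (ltr0n _ 2) K1)); apply/negP; rewrite -ltNge.
  rewrite -mulrA -[X in _ < X]mulr1 ltr_pM2l // ltr_pdivrMl ?mulr_gt0 // mulr1.
  lra.
move=> e0.
pose S x y d := x0 <= x -> x + d * W <= x1 -> y0 <= y -> y + d * L <= y1 ->
  nrm (J f x (x + d * W) y (y + d * L)) <= e * (2 * (d * K) ^+ 2).
have main : S x0 y0 1.
  apply: (@rect_bisect S W L) => //.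
  - move=> x y d d0 s1 s2 s3 s4 hx0 hx1 hy0 hy1.
    have dW : 0 <= d * W by rewrite mulr_ge0 // ltW.
    have dL : 0 <= d * L by rewrite mulr_ge0 // ltW.
    have Ex : x + d / 2 * W + d / 2 * W = x + d * W by field.
    have Ey : y + d / 2 * L + d / 2 * L = y + d * L by field.
    have hc (u v u' v' : R) : x0 <= u -> v <= x1 -> y0 <= u' -> v' <= y1 ->
        forall z, bdry u v u' v' z -> ccont f z.
      move=> i1 i2 i3 i4 z [a [b [/andP[a1 a2] /andP[b1 b2] -> _]]].
      have [|l Dl] := D (pt a b); last exact: cder_ccont Dl.
      exists a, b; split=> //; lra.
    rewrite (@J_splitx f x (x + d / 2 * W)); try lra; last by apply: hc; lra.
    rewrite (@J_splity f x _ y (y + d / 2 * L)); try lra; last by apply: hc; lra.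
    rewrite (@J_splity f _ (x + d * W) y (y + d / 2 * L)); try lra; last by apply: hc; lra.
    have {}s1 : nrm (J f x (x + d / 2 * W) y (y + d / 2 * L)) <= e * (2 * (d / 2 * K) ^+ 2).
      by apply: s1; lra.
    have {}s2 := s2 (ltac:(lra)) (ltac:(lra)) (ltac:(lra)) (ltac:(lra)).
    have {}s3 := s3 (ltac:(lra)) (ltac:(lra)) (ltac:(lra)) (ltac:(lra)).
    have {}s4 := s4 (ltac:(lra)) (ltac:(lra)) (ltac:(lra)) (ltac:(lra)).
    rewrite Ex in s2 s4; rewrite Ey in s3 s4.
    apply: le_trans (le_nrmD _ _) _; apply: le_trans (lerD (le_nrmD _ _) (le_nrmD _ _)) _.
    have E : (d / 2 * K) ^+ 2 = (d * K) ^+ 2 / 4 by field.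
    rewrite E in s1 s2 s3 s4; lra.
  - move=> p q hp hq.
    have [|l Dl] := D (pt p q).
      by exists p, q; split=> //; move: hp hq; rewrite /W /L; lra.
    have [r r0 Hr] := Dl _ e0.
    exists (r / (K + 1)); first by rewrite divr_gt0 // ltr_wpDl.
    move=> x y d d0 dr hpx hqy hx0 hx1 hy0 hy1.
    have dW : 0 <= d * W by rewrite mulr_ge0 // ltW.
    have dL : 0 <= d * L by rewrite mulr_ge0 // ltW.
    have K1 : 0 < K + 1 by rewrite ltr_wpDl.
    have dK : d * K < r.
      move: dr; rewrite ltr_pdivlMr //; lra.
    have near z : bdry x (x + d * W) y (y + d * L) z -> nrm (z - pt p q) <= d * K.
      move=> [a [b [ha hb -> _]]]; rewrite ptB; apply: le_trans (nrm_pt _ _) _.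
      have -> : d * K = d * W + d * L * nrm tau by rewrite /K; ring.
      apply: lerD; first by rewrite ler_norml; move: ha hpx; lra.
      by rewrite ler_wpM2r // ler_norml; move: hb hqy; lra.
    have cc z : bdry x (x + d * W) y (y + d * L) z -> ccont f z.
      move=> [a [b [ha hb -> _]]].
      have [|l' Dl'] := D (pt a b); last exact: cder_ccont Dl'.
      by exists a, b; split=> //; move: ha hb; lra.
    have hxd : x <= x + d * W by rewrite lerDl.
    have hyd : y <= y + d * L by rewrite lerDl.
    pose aff z := f (pt p q) + l * (z - pt p q).
    have Daff z : cder aff z l.
      apply: cder_eq (cderD (cder_cst _ _) (cderM (cder_cst _ _) (cderB (cder_id _) (cder_cst _ _)))).
      ring.
    have Jaff : J aff x (x + d * W) y (y + d * L) = 0.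
      apply: (@J_prim _ _ _ _ _ _ _ (fun z => f (pt p q) * z + l / 2 * ((z - pt p q) * (z - pt p q)))) => //.
      move=> z _.
      have Dz := cderB (cder_id z) (cder_cst (pt p q) z).
      apply: cder_eq (cderD (cderM (cder_cst _ _) (cder_id _)) (cderM (cder_cst _ _) (cderM Dz Dz))).
      by rewrite /aff /=; field.
    have Drest z : bdry x (x + d * W) y (y + d * L) z -> ccont (fun z => f z + -1 * aff z) z.
      move=> bz; have [a [b [ha hb zE _]]] := bz.
      have [|l' Dl'] := D z; last exact: cder_ccont (cderD Dl' (cderM (cder_cst (-1) _) (Daff _))).
      by exists a, b; split=> //; move: ha hb; lra.
    have caff z : bdry x (x + d * W) y (y + d * L) z -> ccont aff z.
      by move=> _; exact: cder_ccont (Daff _).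
    have -> : J f x (x + d * W) y (y + d * L) = J (fun z => f z + -1 * aff z) x (x + d * W) y (y + d * L).
      have cm1 z : bdry x (x + d * W) y (y + d * L) z -> ccont (fun z => -1 * aff z) z.
        by move=> _; exact: cder_ccont (cderM (cder_cst (-1) _) (Daff _)).
      by rewrite (JD hxd hyd cc cm1) (JZ hxd hyd (-1) caff) Jaff mulr0 addr0.
    have B := J_bound hxd hyd (M := e * (d * K)) Drest.
    have -> : e * (2 * (d * K) ^+ 2) = e * (d * K) * (2 * (d * K)) by ring.
    have -> : d * K = x + d * W - x + (y + d * L - y) * nrm tau by rewrite /K; ring.
    rewrite [X in e * X](_ : _ = d * K); last by rewrite /K; ring.
    apply: B => z bz.
    have -> : f z + -1 * aff z = f z - f (pt p q) - l * (z - pt p q) by rewrite /aff; ring.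
    have hz := near z bz.
    apply: le_trans (Hr z (le_lt_trans hz dK)) _.
    by rewrite ler_wpM2l // ltW.
have := main (lexx _) _ (lexx _) _; rewrite /S !mul1r /W /L ![_ + (_ - _)]addrC !subrK.
by apply.
Qed.

End Contour.

(** * Cauchy's formula *)

Section Segments.
Variable R : realType.
Implicit Types a b c e p x s : R.

Lemma le_widen a b c e p : a <= b -> c <= e -> b <= p -> p <= c -> a <= p <= e.
Proof. by move=> ab ce bp pc; rewrite (le_trans ab bp) (le_trans pc ce). Qed.

Lemma inner_segment a x b s : 0 < s -> a <= x - s -> x + s <= b ->
  [/\ x - s < x, x < x + s, x - s <= x + s, a <= x + s & x - s <= b].
Proof. by move=> *; split; lra. Qed.

End Segments.

Section Winding.
Local Open Scope classical_set_scope.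
Local Open Scope ring_scope.
Variable R : realType.
Local Notation C := (complexes R).
Local Notation Re := (@complex.Re R).
Local Notation Im := (@complex.Im R).
Local Notation toC := (@toC R).
Implicit Types (a b : R) (h H : R -> C) (z w v c u : C) (f g F : C -> C).

Lemma cder_subr w z : cder (fun z => z - w) z 1.
Proof. by have := cderB (cder_id z) (cder_cst w z); rewrite subr0. Qed.

Lemma cder_inv_subr w z : z != w -> cder (fun z => (z - w)^-1) z (- 1 / (z - w) ^+ 2).
Proof.
move=> zw; apply: (@cderV R (fun z => z - w)); [by rewrite subr_eq0|exact: cder_subr].
Qed.

Lemma cint_opp a b h : a <= b -> rcont a b h -> cint a b h = cint (- b) (- a) (fun s => h (- s)).
Proof.
move=> ab /(prim_exists ab)[H P]; rewrite (cintE ab P).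
have := @cintE R (- b) (- a) _ _ _ (primZ (-1) (prim_opp P)).
rewrite lerN2 => /(_ ab); rewrite !opprK => E.
transitivity (-1 * H a - -1 * H b); first ring.
by rewrite -E; congr cint; apply/funext => s; rewrite mulN1r opprK.
Qed.

Definition twopii : C := (0 +i* (pi *+ 2))%C.

Lemma twopii_neq0 : twopii != 0.
Proof.
rewrite eq_complex /= negb_and; apply/orP; right.
by rewrite mulrn_eq0 /= gt_eqF ?pi_gt0.
Qed.

(* The logarithmic integral along an edge is a logarithm of the ratio of its end points
   with imaginary part in ]0, pi[; four edges around a point make up [2 pi i]. *)
Lemma edge_winding v u (s0 s1 : R) : s0 < s1 -> 0 < Im (v * (u^*)%C) ->
  let I := v * cint s0 s1 (fun s => (u + toC (s - s0) * v)^-1) in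
  cexp I = (u + toC (s1 - s0) * v) / u /\ 0 < Im I < pi.
Proof.
move=> s01 D I; have le01 := ltW s01.
pose U s := u + toC (s - s0) * v.
have ImU s : Im (v * ((U s)^*)%C) = Im (v * (u^*)%C).
  by rewrite /U; case: (v) => v1 v2; case: (u) => u1 u2 /=; ring.
have U0 s : U s != 0.
  by apply/eqP => E; have := ImU s; rewrite E conjc0 mulr0 /= => E'; rewrite -E' ltxx in D.
have uE : U s0 = u by rewrite /U subrr toC0 mul0r addr0.
have u0 : u != 0 by rewrite -uE.
have Uaff s : U s = (u - toC s0 * v) + toC s * v by rewrite /U toCB; ring.
have PU : prim s0 s1 (fun=> v) U.
  have := @prim_affine R s0 s1 (u - toC s0 * v) v (fun=> 1) id (fun s _ => cder_id _).
  have -> : (fun s => id (u - toC s0 * v + toC s * v)) = U by apply/funext => s; rewrite Uaff.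
  by apply: eq_prim => s _; rewrite mulr1.
have cV : rcont s0 s1 (fun s => (U s)^-1).
  have DV s : cder (fun z : C => z^-1) (U s) (- 1 / (U s) ^+ 2) 
    by have := @cderV R id (U s) 1 (U0 s) (cder_id _).
  exact: (prim_cont (@prim_comp R s0 s1 _ U (fun z => z^-1) (fun z => - 1 / z ^+ 2) PU (fun s _ => DV s))).
have [H0 PH0] := prim_exists le01 cV.
pose H s := v * H0 s; have PH := primZ v PH0; rewrite -/H in PH.
have IE : I = H s1 - H s0 by rewrite /I (cintE le01 PH0) /H; ring.
have EU s : s0 <= s <= s1 -> U s = u * cexp (H s - H s0).
  move=> sab; rewrite -uE; apply: (prim_exp le01 PH) => //.
  by apply: eq_prim PU => t _; rewrite mulfVK.
split.
  by rewrite -/(U s1) EU ?le01 ?lexx // IE; field.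
have MV s : s0 < s -> s <= s1 -> 0 < Im (H s - H s0).
  move=> ss ss1.
  have [t tab] := prim_MVT (0 -i* 1)%C (ltW ss) (prim_sub (lexx _) ss1 PH).
  have E0 z : Re ((0 -i* 1)%C * z) = Im z by rewrite cReM /=; ring.
  rewrite !E0 => ->; apply: mulr_gt0; last by rewrite subr_gt0.
  have -> : v * (U t)^-1 = toC ((nrm (U t) ^+ 2)^-1) * (v * ((U t)^*)%C).
    have -> : (U t)^-1 = toC ((nrm (U t) ^+ 2)^-1) * ((U t)^*)%C.
      apply: (mulfI (U0 t)); rewrite divff // mulrCA -sqr_normc nrmE.
      rewrite (_ : ((nrm (U t))%:C)%C ^+ 2 = toC (nrm (U t) ^+ 2)); last by rewrite !expr2 toCM.
      by rewrite -toCM mulVf ?toC1 // expf_neq0 // nrm_eq0.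
    by rewrite mulrCA.
  rewrite cImM /= ImU -[0]/(0:R) mul0r addr0 mulr_gt0 // invr_gt0 exprn_gt0 //.
  by rewrite nrm_gt0.
(* If the imaginary part reached pi, some point U s of the edge would be a negative multiple of u
   and Im (U s conj(u)) would vanish; but it equals (s - s0) Im (v conj(u)), which is positive. *)
rewrite IE MV //= ltNge; apply/negP => pile.
have [s sab Es] : exists2 s, s \in `[s0, s1] & Im (H s - H s0) = pi.
  apply: (@IVT R (fun s => Im (H s - H s0))) => //.
    apply/subspace_continuousP => x; rewrite /= in_itv /= => xab.
    apply/cvgrPdist_lt => e e0; rewrite near_withinE.
    have [d d0 Hd] := prim_cont PH xab e0.
    apply/nearR_P; exists d => // t td; rewrite /= in_itv /= => tab.
    apply: le_lt_trans (Hd t tab td); rewrite nrmB; apply: le_trans (le_Im_nrm _).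
    have -> : Im (H x - H t) = Im (H x - H s0) - Im (H t - H s0).
      by rewrite !(cImD, cImN); ring.
    by [].
  by rewrite subrr /= -[0]/(0:R) ge_min le_max pile pi_ge0 orbT.

rewrite in_itv /= in sab; have /andP[sl su] := sab.
have sgt : s0 < s.
  rewrite lt_neqAle sl andbT; apply/eqP => E; move: Es; rewrite -E subrr /= => E'.
  by have := pi_gt0 R; rewrite -E' ltxx.
have : Im (U s * (u^*)%C) = (s - s0) * Im (v * (u^*)%C).
  by rewrite /U; case: (v) => v1 v2; case: (u) => u1 u2 /=; ring.
rewrite EU // /cexp Es cospi sinpi.
have -> : Im (u * (expR (Re (H s - H s0)) * -1 +i* (expR (Re (H s - H s0)) * 0))%C * (u^*)%C) = 0.
  by case: (u) => u1 u2 /=; ring.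
by move=> /esym/eqP; rewrite mulf_eq0 subr_eq0 !gt_eqF.
Qed.

Variable tau : C.
Hypothesis tau_gt0 : 0 < Im tau.
Local Notation pt := (pt tau).
Local Notation J := (J tau).
Local Notation rect := (rect tau).
Local Notation bdry := (bdry tau).

(** The imaginary part controls b, and then a by subtraction. This bounds from below the distance of
    a point to the boundary of a parallelogram around it. *)
Lemma nrm_pt_ge : exists2 c : R, 0 < c & forall a b, c * `|a| <= nrm (pt a b) /\ c * `|b| <= nrm (pt a b).
Proof.
pose t := Im tau; pose n := nrm tau.
have n0 : 0 < n by exact: nrm_tau_gt0.
have tn0 : 0 < t + n by rewrite addr_gt0.
have tn : t <= n by apply: le_trans (le_Im_nrm _); rewrite ler_norm.
exists (t / (t + n) * Num.min 1 t); first by rewrite mulr_gt0 ?divr_gt0 // lt_min ltr01.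
move=> a b.
have hb : `|b| * t <= nrm (pt a b).
  by have := le_Im_nrm (pt a b); rewrite Im_pt normrM (gtr0_norm tau_gt0).
have ha : `|a| <= nrm (pt a b) + `|b| * n.
  rewrite -nrm_toC (_ : toC a = pt a b - toC b * tau); last by rewrite /pt addrK.
  by apply: le_trans (le_nrmB _ _) _; rewrite nrmM nrm_toC.
have c1 : t / (t + n) <= 1 by rewrite ler_pdivrMr // mul1r lerDl ltW.
have c0 : 0 <= t / (t + n) by rewrite divr_ge0 // ltW.
have [m1 mt] : Num.min 1 t <= 1 /\ Num.min 1 t <= t by rewrite !ge_min !lexx orbT.
have m0 : 0 <= Num.min 1 t by rewrite le_min ler01 ltW.
have N0 := nrm_ge0 (pt a b).
split.
  apply: (@le_trans _ _ (t / (t + n) * `|a|)).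
    by rewrite ler_wpM2r // ler_piMr.
  rewrite mulrAC ler_pdivrMr //.
  have : t * `|a| <= t * (nrm (pt a b) + `|b| * n) by rewrite ler_wpM2l // ltW.
  have : n * (`|b| * t) <= n * nrm (pt a b) by rewrite ler_wpM2l // ltW.
  lra.
apply: le_trans hb; rewrite mulrC ler_wpM2l //.
by apply: le_trans mt; rewrite ler_piMl.
Qed.

(** The ratios of end points telescope to 1 around the boundary, so the exponential of the sum of
    the four logarithms is 1; its imaginary part lies strictly between 0 and 4 pi, which leaves only
    2 pi i. *)
Lemma J_winding (x0 x x1 y0 y y1 : R) : x0 < x < x1 -> y0 < y < y1 ->
  J (fun z => (z - pt x y)^-1) x0 x1 y0 y1 = twopii.
Proof.
move=> /andP[hx0 hx1] /andP[hy0 hy1].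
have xx : x0 < x1 by exact: lt_trans hx1. have yy : y0 < y1 by exact: lt_trans hy1.
have bc z : bdry x0 x1 y0 y1 z -> ccont (fun z => (z - pt x y)^-1) z.
  move=> [a [b [_ _ -> k]]].
  suff n0 : pt a b != pt x y by exact: cder_ccont (cder_inv_subr n0).
  apply/eqP => /(pt_inj tau_gt0)[ea eb].
  by rewrite ea eb in k; case: k => E; move: hx0 hx1 hy0 hy1; rewrite E ltxx.
rewrite /J /hor /ver.
(* The top and left edges are run backwards, so that [edge_winding] applies to all four edges with
   the same orientation. *)
have -> : cint x0 x1 (fun x2 => (pt x2 y1 - pt x y)^-1) =
  cint (- x1) (- x0) (fun s => (pt (- s) y1 - pt x y)^-1).
  exact: cint_opp (ltW xx) (bc_h1 (ltW yy) bc).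
have -> : cint y0 y1 (fun y2 => (pt x0 y2 - pt x y)^-1) =
  cint (- y1) (- y0) (fun s => (pt x0 (- s) - pt x y)^-1).
  exact: cint_opp (ltW yy) (bc_v0 tau_gt0 (ltW xx) bc).
pose u00 := pt x0 y0 - pt x y; pose u10 := pt x1 y0 - pt x y.
pose u11 := pt x1 y1 - pt x y; pose u01 := pt x0 y1 - pt x y.
have ptC a b : (pt a b - pt x y)^*%C = (pt (a - x) (b - y))^*%C by rewrite ptB.
have F1 : 0 < Im (1 * (u00^*)%C).
  rewrite mul1r /u00 ptC; have -> : Im ((pt (x0 - x) (y0 - y))^*)%C = - Im (pt (x0 - x) (y0 - y)).
    by case: (pt _ _).
  by rewrite Im_pt -mulNr opprB mulr_gt0 // subr_gt0.
have F3 : 0 < Im (-1 * (u11^*)%C).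
  rewrite mulN1r /u11 ptC; have -> : Im (- (pt (x1 - x) (y1 - y))^*)%C = Im (pt (x1 - x) (y1 - y)).
    by case: (pt _ _) => ? ? /=; rewrite opprK.
  by rewrite Im_pt mulr_gt0 // subr_gt0.
have TC a b : Im (tau * (pt a b)^*%C) = a * Im tau.
  by rewrite /pt; case: (tau) => t1 t2 /=; ring.
have F2 : 0 < Im (tau * (u10^*)%C) by rewrite /u10 ptC TC mulr_gt0 // subr_gt0.
have F4 : 0 < Im (- tau * (u01^*)%C).
  by rewrite /u01 ptC mulNr cImN TC -mulNr opprB mulr_gt0 // subr_gt0.
have [E1 /andP[A1 B1]] := edge_winding xx F1.
have [E2 /andP[A2 B2]] := edge_winding yy F2.
have xx' : - x1 < - x0 by rewrite ltrN2.
have yy' : - y1 < - y0 by rewrite ltrN2.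
have [E3 /andP[A3 B3]] := edge_winding xx' F3.
have [E4 /andP[A4 B4]] := edge_winding yy' F4.
set I1 := _ * cint _ _ _ in E1 A1 B1; set I2 := _ * cint _ _ _ in E2 A2 B2.
set I3 := _ * cint _ _ _ in E3 A3 B3; set I4 := _ * cint _ _ _ in E4 A4 B4.
have -> : cint x0 x1 (fun x2 => (pt x2 y0 - pt x y)^-1) = I1.
  rewrite /I1 mul1r; congr cint; apply/funext => s; congr (_^-1).
  by rewrite /u00 /pt toCB; ring.
have -> : tau * cint y0 y1 (fun y2 => (pt x1 y2 - pt x y)^-1) = I2.
  rewrite /I2; congr (_ * cint _ _ _); apply/funext => s; congr (_^-1).
  by rewrite /u10 /pt toCB; ring.
have -> : cint (- x1) (- x0) (fun s => (pt (- s) y1 - pt x y)^-1) = - I3.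
  rewrite /I3 mulN1r opprK; congr cint; apply/funext => s; congr (_^-1).
  by rewrite /u11 /pt toCB !toCN; ring.
have -> : tau * cint (- y1) (- y0) (fun s => (pt x0 (- s) - pt x y)^-1) = - I4.
  rewrite /I4 mulNr opprK; congr (_ * cint _ _ _); apply/funext => s; congr (_^-1).
  by rewrite /u01 /pt toCB !toCN; ring.
rewrite !opprK; apply: cexp_2pi; last first.
  by rewrite !cImD; move: A1 A2 A3 A4 B1 B2 B3 B4; rewrite -[pi *+ 4]mulr_natl; lra.
have nz (u v : C) : 0 < Im (v * (u^*)%C) -> u != 0.
  by move=> D; apply/eqP => E; move: D; rewrite E conjc0 mulr0 /= -[0]/(0:R) ltxx.
rewrite !cexpD E1 E2 E3 E4.
have -> : u00 + toC (x1 - x0) * 1 = u10 by rewrite /u00 /u10 /pt toCB; ring.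
have -> : u10 + toC (y1 - y0) * tau = u11 by rewrite /u10 /u11 /pt toCB; ring.
have -> : u11 + toC (- x0 - - x1) * -1 = u01 by rewrite /u11 /u01 /pt toCB !toCN; ring.
have -> : u01 + toC (- y0 - - y1) * - tau = u00 by rewrite /u00 /u01 /pt toCB !toCN; ring.
by field; rewrite (nz _ _ F1) (nz _ _ F2) (nz _ _ F3) (nz _ _ F4).
Qed.

(** Subtracting f(w) times the winding integral leaves the difference quotient g, holomorphic off w
    and bounded near w by differentiability. Goursat's theorem shrinks the contour to a
    parallelogram around w of arbitrarily small perimeter. *)
Theorem cauchy_formula f (x0 x x1 y0 y y1 : R) : x0 < x < x1 -> y0 < y < y1 ->
  (forall z, rect x0 x1 y0 y1 z -> exists l, cder f z l) ->
  J (fun z => f z / (z - pt x y)) x0 x1 y0 y1 = twopii * f (pt x y).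
Proof.
move=> hx hy D; have /andP[hx0 hx1] := hx; have /andP[hy0 hy1] := hy.
have xx : x0 <= x1 by apply: ltW; exact: lt_trans hx1.
have yy : y0 <= y1 by apply: ltW; exact: lt_trans hy1.
set w := pt x y; pose g z := (f z - f w) / (z - w).
have Dg z : rect x0 x1 y0 y1 z -> z != w -> exists l, cder g z l.
  move=> rz zw; have [l Dl] := D z rz; eexists.
  exact: cderM (cderB Dl (cder_cst _ _)) (cder_inv_subr zw).
have bdw z : bdry x0 x1 y0 y1 z -> z != w.
  move=> [a [b [_ _ -> k]]]; apply/eqP => /(pt_inj tau_gt0)[ea eb].
  by rewrite ea eb in k; case: k => E; move: hx0 hx1 hy0 hy1; rewrite E ltxx.
have cg z : bdry x0 x1 y0 y1 z -> ccont g z.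
  by move=> bz; have [l /cder_ccont] := Dg z (bdry_rect bz) (bdw z bz).
have cV z : bdry x0 x1 y0 y1 z -> ccont (fun z => f w * (z - w)^-1) z.
  by move=> bz; exact: cder_ccont (cderM (cder_cst _ _) (cder_inv_subr (bdw z bz))).
have cV1 z : bdry x0 x1 y0 y1 z -> ccont (fun z => (z - w)^-1) z.
  by move=> bz; exact: cder_ccont (cder_inv_subr (bdw z bz)).
suff Jg : J g x0 x1 y0 y1 = 0.
  have -> : (fun z => f z / (z - w)) = (fun z => g z + f w * (z - w)^-1).
    by apply/funext => z; rewrite /g; ring.
  by rewrite (JD tau_gt0 xx yy cg cV) Jg add0r (JZ tau_gt0 xx yy (f w) cV1) J_winding // mulrC.
have rw : rect x0 x1 y0 y1 w by exists x, y; split=> //; rewrite !ltW.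
have [l Dl] := D w rw; have [d d0 Hd] := Dl 1 ltr01.
pose M := nrm l + 1; have M0 : 0 < M by rewrite /M ltr_wpDl // nrm_ge0.
have gM z : z != w -> nrm (z - w) < d -> nrm (g z) <= M.
  move=> zw /Hd; rewrite mul1r => h; rewrite /g nrmM nrmV ler_pdivrMr ?nrm_gt0 ?subr_eq0 //.
  have -> : f z - f w = (f z - f w - l * (z - w)) + l * (z - w) by ring.
  apply: le_trans (le_nrmD _ _) _; rewrite nrmM /M; lra.
pose N := 1 + nrm tau; have N0 : 0 < N by rewrite /N ltr_wpDr // nrm_ge0.
have small (s : R) : 0 < s -> x0 <= x - s -> x + s <= x1 -> y0 <= y - s -> y + s <= y1 -> s * N < d ->
    nrm (J g x0 x1 y0 y1) <= M * (4 * (s * N)).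
  move=> s0 ix0 ix1 iy0 iy1 sd.
  have away (a b a' b' : R) : x0 <= a -> b <= x1 -> y0 <= a' -> b' <= y1 -> a <= b -> a' <= b' ->
      (b < x \/ x < a \/ b' < y \/ y < a') -> J g a b a' b' = 0.
    move=> i1 i2 i3 i4 ab ab' k; apply: goursat => // z [p [q [/andP[p1 p2] /andP[q1 q2] -> ]]].
    apply: Dg; first by exists p, q; split; [exact: le_widen i1 i2 _ _|exact: le_widen i3 i4 _ _|].
    apply/eqP => /(pt_inj tau_gt0)[ea eb]; subst p q.
    by move: p1 p2 q1 q2; case: k => [|[|[]]] h; rewrite !(leNgt _ x, leNgt x, leNgt _ y, leNgt y) h.
  have bd (a b a' b' : R) : x0 <= a -> b <= x1 -> y0 <= a' -> b' <= y1 -> a < x < b -> a' < y < b' ->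
      forall z, bdry a b a' b' z -> z != w /\ ccont g z.
    move=> i1 i2 i3 i4 /andP[j1 j2] /andP[j3 j4] z [p [q [/andP[p1 p2] /andP[q1 q2] -> k]]].
    have zw : pt p q != w.
      apply/eqP => /(pt_inj tau_gt0)[ea eb]; subst p q.
      by case: k => E; move: j1 j2 j3 j4; rewrite -E ltxx.
    split=> //; have [|l' /cder_ccont//] := Dg (pt p q) _ zw.
    by exists p, q; split; [exact: le_widen i1 i2 _ _|exact: le_widen i3 i4 _ _|].
  have [b3 b4 b1 a3 a2] := inner_segment s0 ix0 ix1.
  have [b5 b6 b2 a7 a6] := inner_segment s0 iy0 iy1.
  have sx : x - s < x < x + s by rewrite b3.
  have sy : y - s < y < y + s by rewrite b5.
  have [a1 a4] := (ix0, ix1); have [a5 a8] := (iy0, iy1).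
  have [lx ly] : x0 <= x0 /\ y0 <= y0 by rewrite !lexx.
  have [ux uy] : x1 <= x1 /\ y1 <= y1 by rewrite !lexx.
  have hx' : x - s < x < x1 by rewrite b3.
  have hy' : y - s < y < y1 by rewrite b5.
  have cg1 z : bdry (x - s) x1 y0 y1 z -> ccont g z by move=> /bd [].
  have cg2 z : bdry (x - s) (x + s) y0 y1 z -> ccont g z by move=> /bd [].
  have cg3 z : bdry (x - s) (x + s) (y - s) y1 z -> ccont g z by move=> /bd [].
  rewrite (J_splitx a1 a2 yy cg) (away x0 (x - s)) ?add0r; [|by []..|by left].
  rewrite (J_splitx b1 a4 yy cg1) (away (x + s) x1) ?addr0; [|by []..|by right; left].
  rewrite (J_splity tau_gt0 b1 a5 a6 cg2) (away _ _ y0 (y - s)) ?add0r; [|by []..|by do 2 right; left].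
  rewrite (J_splity tau_gt0 b1 b2 a8 cg3) (away _ _ (y + s) y1) ?addr0; [|by []..|by do 3 right].
  apply: le_trans (J_bound tau_gt0 b1 b2 (M := M) _ _) _.
  - by move=> z /bd [].
  - move=> z bz; have [||||||zw _] := bd _ _ _ _ _ _ _ _ _ _ z bz => //.
    apply: gM => //; move: bz => [p [q [hp hq -> _]]]; rewrite /w ptB.
    apply: le_lt_trans (nrm_pt _ _ _) _; apply: le_lt_trans sd.
    rewrite /N mulrDr mulr1 lerD //; first by rewrite ler_norml; lra.
    by rewrite ler_wpM2r ?nrm_ge0 // ler_norml; lra.
  by rewrite /N ler_wpM2l //; [exact: ltW|lra].
apply/eqP; rewrite -nrm_eq0 eq_le nrm_ge0 andbT leNgt; apply/negP => J0.
(* With s at most 1 / K times the norm of the integral, the estimate of [small] is at most half of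
   that norm, a contradiction. *)
pose K := 8 * M * N; have K0 : 0 < K by rewrite !mulr_gt0.
pose s := Num.min (Num.min (Num.min (x - x0) (x1 - x)) (Num.min (y - y0) (y1 - y)))
   (Num.min (d / (2 * N)) (nrm (J g x0 x1 y0 y1) / K)).
have s0 : 0 < s by rewrite !lt_min !subr_gt0 hx0 hx1 hy0 hy1 /= !divr_gt0 // mulr_gt0.
have : s <= s by []; rewrite {2}/s !le_min => /andP[/andP[/andP[i1 i2] /andP[i3 i4]] /andP[i5 i6]].
rewrite ler_pdivlMr ?mulr_gt0 // in i5; rewrite ler_pdivlMr // in i6.
have sN : 0 < s * N by rewrite mulr_gt0.
have := small s s0; rewrite !(lerBrDr, lerBrDl) => B.
have {B} : nrm (J g x0 x1 y0 y1) <= M * (4 * (s * N)) by apply: B; move: i1 i2 i3 i4 i5 sN; lra.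
move: i6 J0; rewrite /K; lra.
Qed.

End Winding.

(** * Holomorphic functions near a point *)

Section LocalTheory.
Local Open Scope classical_set_scope.
Local Open Scope ring_scope.
Variable R : realType.
Local Notation C := (complexes R).
Local Notation Re := (@complex.Re R).
Local Notation Im := (@complex.Im R).
Local Notation toC := (@toC R).
Implicit Types (a b r : R) (h H : R -> C) (z w v c u t : C) (f g F : C -> C).
Variable tau : C.
Hypothesis tau_gt0 : 0 < Im tau.
Local Notation pt := (pt tau).
Local Notation J := (J tau).
Local Notation rect := (rect tau).
Local Notation bdry := (bdry tau).

Lemma nrmX z k : nrm (z ^+ k) = nrm z ^+ k.
Proof. by elim: k => [|k IH]; rewrite ?expr0 ?nrm1 // !exprS nrmM IH. Qed.

Lemma rect_bounded f (x0 x1 y0 y1 : R) : x0 <= x1 -> y0 <= y1 ->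
  (forall z, rect x0 x1 y0 y1 z -> ccont f z) ->
  exists2 B : R, 0 <= B & forall z, rect x0 x1 y0 y1 z -> nrm (f z) <= B.
Proof.
move=> hx hy cf.
pose W := x1 - x0; pose L := y1 - y0.
have W0 : 0 <= W by rewrite subr_ge0.
have L0 : 0 <= L by rewrite subr_ge0.
have N0 := nrm_ge0 tau.
pose S (x y d : R) := exists2 B : R, 0 <= B & forall p q : R,
  x <= p <= x + d * W -> y <= q <= y + d * L -> nrm (f (pt p q)) <= B.
have [B B0 HB] : S x0 y0 1.
  apply: (@rect_bisect R S W L) => //.
    move=> x y d d0 [B1 P1 H1] [B2 P2 H2] [B3 P3 H3] [B4 P4 H4].
    exists (B1 + B2 + (B3 + B4)); first by rewrite !addr_ge0.
    have Ex : x + d / 2 * W + d / 2 * W = x + d * W by field.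
    have Ey : y + d / 2 * L + d / 2 * L = y + d * L by field.
    rewrite Ex in H2 H4; rewrite Ey in H3 H4.
    move=> p q /andP[p1 p2] /andP[q1 q2].
    case: (leP p (x + d / 2 * W)) => hp; case: (leP q (y + d / 2 * L)) => hq.
    - have := H1 p q; rewrite p1 hp q1 hq => /(_ isT isT); lra.
    - have := H3 p q; rewrite p1 hp (ltW hq) q2 => /(_ isT isT); lra.
    - have := H2 p q; rewrite (ltW hp) p2 q1 hq => /(_ isT isT); lra.
    - have := H4 p q; rewrite (ltW hp) p2 (ltW hq) q2 => /(_ isT isT); lra.
  move=> p q hp hq.
  have [|e e0 He] := cf (pt p q) _ 1 ltr01.
    by exists p, q; split=> //; move: hp hq; rewrite /W /L ![_ + (_ - _)]addrC !subrK.
  have K0 : 0 < W + L * nrm tau + 1 by rewrite ltr_wpDl // addr_ge0 // mulr_ge0.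
  exists (e / (W + L * nrm tau + 1)); first by rewrite divr_gt0.
  move=> x y d d0; rewrite ltr_pdivlMr // => dr hpx hqy.
  exists (nrm (f (pt p q)) + 1); first by rewrite addr_ge0 // nrm_ge0.
  move=> p' q' hp' hq'.
  have : nrm (pt p' q' - pt p q) < e.
    rewrite ptB; apply: le_lt_trans (nrm_pt _ _ _) _; apply: le_lt_trans dr.
    have k1 : `|p' - p| <= d * W by rewrite ler_norml; lra.
    have k2 : `|q' - q| <= d * L by rewrite ler_norml; lra.
    have k3 : `|q' - q| * nrm tau <= d * L * nrm tau by rewrite ler_wpM2r.
    lra.
  move=> /He h1; rewrite (_ : f (pt p' q') = (f (pt p' q') - f (pt p q)) + f (pt p q)); last by ring.
  apply: le_trans (le_nrmD _ _) _; rewrite addrC lerD2l; exact: ltW.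
exists B => // z [p [q [hp hq ->]]]; apply: HB; rewrite mul1r /W /L ![_ + (_ - _)]addrC !subrK //.
Qed.

Section Kernel.
Local Open Scope classical_set_scope.
Local Open Scope ring_scope.
Variables x0 x1 y0 y1 : R.
Hypotheses (hx : x0 <= x1) (hy : y0 <= y1).
Local Notation bd := (bdry x0 x1 y0 y1).
Local Notation JQ f := (J f x0 x1 y0 y1).

Lemma ccontM f g z : ccont f z -> ccont g z -> ccont (fun z => f z * g z) z.
Proof.
move=> cf cg e e0.
pose K := nrm (f z) + nrm (g z) + 1.
have n1 := nrm_ge0 (f z); have n2 := nrm_ge0 (g z).
have K0 : 0 < K by rewrite /K; lra.
pose e' := Num.min (e / K) 1.
have e'0 : 0 < e' by rewrite lt_min divr_gt0 //=.
have e'1 : e' <= 1 by rewrite ge_min lexx orbT.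
have e'K : e' * K <= e by rewrite -ler_pdivlMr // ge_min lexx.
have [d d0 Hd] := cf _ e'0; have [d' d0' Hd'] := cg _ e'0.
exists (Num.min d d'); first by rewrite lt_min d0.
move=> t; rewrite lt_min => /andP[/Hd h1 /Hd' h2].
have -> : f t * g t - f z * g z =
  (f t - f z) * (g t - g z) + (f t - f z) * g z + f z * (g t - g z) by ring.
apply: le_lt_trans (le_nrmD _ _) _; apply: le_lt_trans (lerD (le_nrmD _ _) (lexx _)) _.
rewrite !nrmM.
have k1 : nrm (f t - f z) * nrm (g t - g z) < e' * 1.
  by apply: ltr_pM => //; rewrite ?nrm_ge0 //; exact: lt_le_trans h2 e'1.
have k2 : nrm (f t - f z) * nrm (g z) <= e' * nrm (g z) by rewrite ler_wpM2r // ltW.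
have k3 : nrm (f z) * nrm (g t - g z) <= nrm (f z) * e' by rewrite ler_wpM2l // ltW.
by move: e'K k1 k2 k3; rewrite /K; lra.
Qed.

(** Differentiation under the integral sign, from a remainder quadratic in t - z uniformly on the
    boundary. *)
Lemma J_param (K : C -> C -> C) (K' : C -> C) z (M r : R) : 0 < r -> 0 <= M ->
  (forall t, nrm (t - z) < r -> forall s, bd s -> ccont (K t) s) ->
  (forall s, bd s -> ccont K' s) ->
  (forall t, nrm (t - z) < r -> forall s, bd s ->
     nrm (K t s - K z s - (t - z) * K' s) <= M * nrm (t - z) ^+ 2) ->
  cder (fun t => JQ (K t)) z (JQ K').
Proof.
move=> r0 M0 cK cK' HM e e0.
pose P := 2 * ((x1 - x0) + (y1 - y0) * nrm tau).
have P0 : 0 <= P by rewrite /P mulr_ge0 // addr_ge0 ?mulr_ge0 ?subr_ge0 ?nrm_ge0.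
have MP : 0 < M * P + 1 by rewrite ltr_wpDl // mulr_ge0.
exists (Num.min r (e / (M * P + 1))); first by rewrite lt_min r0 divr_gt0.
move=> t; rewrite lt_min => /andP[tr te].
have zr : nrm (z - z) < r by rewrite subrr nrm0.
have cz := cK z zr; have ct := cK t tr.
have c1 s : bd s -> ccont (fun s => -1 * K z s) s.
  by move=> bs; apply: ccontM (cder_ccont (cder_cst _ _)) (cz s bs).
have c2 s : bd s -> ccont (fun s => - (t - z) * K' s) s.
  by move=> bs; apply: ccontM (cder_ccont (cder_cst _ _)) (cK' s bs).
have ccD f g s : ccont f s -> ccont g s -> ccont (fun s => f s + g s) s.
  move=> cf cg e' e'0; have e2 : 0 < e' / 2 by rewrite divr_gt0.
  have [d d0 Hd] := cf _ e2; have [d' d0' Hd'] := cg _ e2.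
  exists (Num.min d d'); first by rewrite lt_min d0.
  move=> q; rewrite lt_min => /andP[/Hd h1 /Hd' h2].
  rewrite opprD addrACA; apply: le_lt_trans (le_nrmD _ _) _; lra.
have c3 s : bd s -> ccont (fun s => K t s + -1 * K z s) s.
  by move=> bs; apply: ccD; [exact: ct|exact: c1].
have c4 s : bd s -> ccont (fun s => K t s + -1 * K z s + - (t - z) * K' s) s.
  by move=> bs; apply: ccD; [exact: c3|exact: c2].
have -> : JQ (K t) - JQ (K z) - JQ K' * (t - z) =
   JQ (fun s => K t s + -1 * K z s + - (t - z) * K' s).
  rewrite (JD tau_gt0 hx hy c3 c2) (JD tau_gt0 hx hy ct c1).
  by rewrite (JZ tau_gt0 hx hy (-1) cz) (JZ tau_gt0 hx hy (- (t - z)) cK'); ring.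
apply: le_trans (J_bound tau_gt0 hx hy (M := M * nrm (t - z) ^+ 2) c4 _) _.
  move=> s bs; have := HM t tr s bs.
  by have -> : K t s - K z s - (t - z) * K' s = K t s + -1 * K z s + - (t - z) * K' s by ring.
rewrite -/P; have n0 := nrm_ge0 (t - z).
move: te; rewrite ltr_pdivlMr // => te.
rewrite (_ : M * nrm (t - z) ^+ 2 * P = (M * P * nrm (t - z)) * nrm (t - z)); last by ring.
apply: ler_wpM2r => //; lra.
Qed.

(** The factor 2 keeps the boundary at distance at least r from every t within r of z. *)
Let far z r := forall s, bd s -> 2 * r <= nrm (s - z).

Lemma far_near z r t : 0 < r -> far z r -> nrm (t - z) < r ->
  forall s, bd s -> r <= nrm (s - t) /\ s != t.
Proof.
move=> r0 fz tz s bs.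
have h : r <= nrm (s - t).
  have := fz s bs; have -> : s - z = (s - t) + (t - z) by ring.
  move=> h; have := le_nrmD (s - t) (t - z); lra.
by split=> //; apply/eqP => E; move: h; rewrite E subrr nrm0 leNgt r0.
Qed.

(** The remainder of 1 / (s - t) beyond first order is exactly (t - z)^2 / ((s - t) (s - z)^2), of
    size at most |t - z|^2 / r^3. *)
Lemma cder_kernel1 phi z r (B : R) : 0 < r -> far z r -> 0 <= B ->
  (forall s, bd s -> ccont phi s) -> (forall s, bd s -> nrm (phi s) <= B) ->
  cder (fun t => JQ (fun s => phi s * (s - t)^-1)) z (JQ (fun s => phi s * (s - z)^-1 ^+ 2)).
Proof.
move=> r0 fz B0 cphi bphi.
have zz : nrm (z - z) < r by rewrite subrr nrm0.
apply: (@J_param (fun t s => phi s * (s - t)^-1) _ z (B / r ^+ 3) r) => //.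
- by rewrite divr_ge0 // exprn_ge0 // ltW.
- move=> t tr s bs; have [_ st] := far_near r0 fz tr bs.
  by apply: ccontM (cphi s bs) (cder_ccont (cder_inv_subr st)).
- move=> s bs; have [_ st] := far_near r0 fz zz bs.
  apply: ccontM (cphi s bs) _.
  by apply: ccontM (cder_ccont (cder_inv_subr st)) (cder_ccont (cder_inv_subr st)).
move=> t tr s bs; have [h1 st] := far_near r0 fz tr bs; have [h2 sz] := far_near r0 fz zz bs.
have st0 : s - t != 0 by rewrite subr_eq0. have sz0 : s - z != 0 by rewrite subr_eq0.
have -> : phi s * (s - t)^-1 - phi s * (s - z)^-1 - (t - z) * (phi s * (s - z)^-1 ^+ 2) =
  phi s * (t - z) ^+ 2 * ((s - t) * (s - z) ^+ 2)^-1 by field; rewrite st0 sz0.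
rewrite !(nrmM, nrmV, nrmX).
have b := bphi s bs.
have : (nrm (s - t) * nrm (s - z) ^+ 2)^-1 <= (r ^+ 3)^-1.
  rewrite lef_pV2 ?posrE ?exprn_gt0 // ?mulr_gt0 ?exprn_gt0 ?(lt_le_trans r0) //.
  rewrite exprS; apply: ler_pM => //; [exact: ltW|by rewrite exprn_ge0 // ltW|].
  by rewrite lerXn2r // nnegrE ?nrm_ge0 // ltW.
move=> h; rewrite mulrAC ler_wpM2r ?exprn_ge0 ?nrm_ge0 //.
by apply: ler_pM; rewrite ?invr_ge0 ?mulr_ge0 ?exprn_ge0 ?nrm_ge0.
Qed.

Lemma cder_kernel2 phi z r (B : R) : 0 < r -> far z r -> 0 <= B ->
  (forall s, bd s -> ccont phi s) -> (forall s, bd s -> nrm (phi s) <= B) ->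
  exists l, cder (fun t => JQ (fun s => phi s * (s - t)^-1 ^+ 2)) z l.
Proof.
move=> r0 fz B0 cphi bphi.
have zz : nrm (z - z) < r by rewrite subrr nrm0.
exists (JQ (fun s => phi s * (2 * ((s - z)^-1 * ((s - z)^-1 * (s - z)^-1))))).
apply: (@J_param (fun t s => phi s * (s - t)^-1 ^+ 2) _ z (B * (4 / r ^+ 4)) r) => //.
- by rewrite mulr_ge0 // divr_ge0 // exprn_ge0 // ltW.
- move=> t tr s bs; have [_ st] := far_near r0 fz tr bs.
  apply: ccontM (cphi s bs) _.
  by apply: ccontM (cder_ccont (cder_inv_subr st)) (cder_ccont (cder_inv_subr st)).
- move=> s bs; have [_ st] := far_near r0 fz zz bs.
  have c1 := cder_ccont (cder_inv_subr st).
  apply: ccontM (cphi s bs) (ccontM (cder_ccont (cder_cst _ _)) _).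
  exact: ccontM c1 (ccontM c1 c1).
move=> t tr s bs; have [h1 st] := far_near r0 fz tr bs; have h2 := fz s bs.
have [_ sz] := far_near r0 fz zz bs.
have st0 : s - t != 0 by rewrite subr_eq0. have sz0 : s - z != 0 by rewrite subr_eq0.
have -> : phi s * (s - t)^-1 ^+ 2 - phi s * (s - z)^-1 ^+ 2 -
    (t - z) * (phi s * (2 * ((s - z)^-1 * ((s - z)^-1 * (s - z)^-1)))) =
  (t - z) ^+ 2 * (phi s * ((3 * (s - z) - 2 * (t - z)) * ((s - t) ^+ 2 * (s - z) ^+ 3)^-1)).
  by field; rewrite st0 sz0.
rewrite nrmM nrmX mulrC ler_wpM2r ?exprn_ge0 ?nrm_ge0 //.
rewrite nrmM; apply: ler_pM; rewrite ?nrm_ge0 ?bphi //.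
rewrite nrmM nrmV.
rewrite nrmM !nrmX.
set a := nrm (s - z) in h2 *; set b := nrm (s - t) in h1 *.
have a0 : 0 < a by lra.
have b0 : 0 < b by lra.
have num : nrm (3 * (s - z) - 2 * (t - z)) <= 4 * a.
  apply: le_trans (le_nrmB _ _) _; rewrite !nrmM.
  have -> : nrm (3 : C) = 3 by rewrite -[3]/(3%:R) -(rmorph_nat (real_complex R)) nrm_real normr_nat.
  have -> : nrm (2 : C) = 2 by rewrite -[2]/(2%:R) -(rmorph_nat (real_complex R)) nrm_real normr_nat.
  rewrite -/a; lra.
apply: le_trans (ler_wpM2r _ num) _; first by rewrite invr_ge0 mulr_ge0 ?exprn_ge0 ?ltW.
rewrite (_ : 4 * a / (b ^+ 2 * a ^+ 3) = 4 / (b ^+ 2 * a ^+ 2)); last first.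
  by field; rewrite !gt_eqF.
rewrite ler_pM2l // lef_pV2 ?posrE ?exprn_gt0 ?mulr_gt0 ?exprn_gt0 //.
rewrite (_ : r ^+ 4 = r ^+ 2 * r ^+ 2); last by ring.
have ra : r <= a by lra.
have [r0' [b0' a0']] := (ltW r0, (ltW b0, ltW a0)).
by apply: ler_pM; rewrite ?exprn_ge0 // lerXn2r // nnegrE.
Qed.

End Kernel.

Definition hol f z r := forall t, nrm (t - z) < r -> exists l, cder f t l.

Lemma hol_near f z r t : hol f z r -> nrm (t - z) < r -> exists2 r', 0 < r' & hol f t r'.
Proof.
move=> hf tr; exists (r - nrm (t - z)); first by rewrite subr_gt0.
move=> s sr; apply: hf; have -> : s - z = (s - t) + (t - z) by ring.
by apply: le_lt_trans (le_nrmD _ _) _; rewrite -ltrBrDr.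
Qed.

Lemma holomorphic_atP f z : holomorphic_at f z <-> exists2 r : R, 0 < r & hol f z r.
Proof.
split=> [/nearC_P[r r0 H]|[r r0 H]].
  by exists r => // t tr; apply/derivable_cder; exact: H.
by apply/nearC_P; exists r => // t tr; apply/derivable_cder; exact: H.
Qed.

(** One contour serves every g holomorphic on the disc: [hol_order] needs it for all the successive
    quotients of f at once. *)
Lemma cauchy_near f z r : 0 < r -> hol f z r -> exists x0 x1 y0 y1 rho B : R,
  [/\ x0 <= x1, y0 <= y1, 0 < rho, 0 <= B &
   [/\ forall s, bdry x0 x1 y0 y1 s -> 2 * rho <= nrm (s - z),
      forall s, bdry x0 x1 y0 y1 s -> nrm (s - z) < r,
      forall s, bdry x0 x1 y0 y1 s -> nrm (f s) <= B &
      forall g t, hol g z r -> nrm (t - z) < rho ->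
        J (fun s => g s * (s - t)^-1) x0 x1 y0 y1 = twopii R * g t]].
Proof.
move=> r0 hf; have [x [y zE]] := pt_surj tau_gt0 z.
pose N := 1 + nrm tau; have N0 : 0 < N by rewrite /N ltr_wpDr // nrm_ge0.
pose s := r / (2 * N); have s0 : 0 < s by rewrite divr_gt0 // mulr_gt0.
have sN : s * N < r.
  rewrite /s invfM mulrA mulfVK ?gt_eqF //; lra.
have inr t : rect (x - s) (x + s) (y - s) (y + s) t -> nrm (t - z) < r.
  move=> [p [q [hp hq ->]]]; rewrite zE ptB.
  apply: le_lt_trans (nrm_pt _ _ _) _; apply: le_lt_trans sN.
  rewrite /N mulrDr mulr1 lerD //; first by rewrite ler_norml; lra.
  by rewrite ler_wpM2r ?nrm_ge0 // ler_norml; lra.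
have [xx yy] : x - s <= x + s /\ y - s <= y + s by split; lra.
have cf t : rect (x - s) (x + s) (y - s) (y + s) t -> ccont f t.
  by move=> /inr /hf[l]; exact: cder_ccont.
have [B B0 HB] := rect_bounded xx yy cf.
have [c c0 Hc] := nrm_pt_ge tau_gt0.
have cs : 0 < c * s by rewrite mulr_gt0.
exists (x - s), (x + s), (y - s), (y + s), (c * s / 2), B; split=> //.
  by rewrite divr_gt0.
split.
- move=> t [p [q [hp hq -> k]]]; rewrite zE ptB.
  have [k1 k2] := Hc (p - x) (q - y).
  rewrite mulrC divfK ?pnatr_eq0 //.
  have [E|E] : `|p - x| = s \/ `|q - y| = s.
    case: k => ->; [left|left|right|right].
    + by rewrite [_ - s - _]addrAC subrr add0r normrN gtr0_norm.
    + by rewrite [_ + s - _]addrAC subrr add0r gtr0_norm.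
    + by rewrite [_ - s - _]addrAC subrr add0r normrN gtr0_norm.
    + by rewrite [_ + s - _]addrAC subrr add0r gtr0_norm.
  + by rewrite -E.
  + by rewrite -E.
- by move=> t /bdry_rect; exact: inr.
- by move=> t /bdry_rect; exact: HB.
move=> g t hg; have [p [q ->]] := pt_surj tau_gt0 t; rewrite zE ptB => tz.
have [k1 k2] := Hc (p - x) (q - y).
have {}k1 : `|p - x| < s by rewrite -(ltr_pM2l c0); lra.
have {}k2 : `|q - y| < s by rewrite -(ltr_pM2l c0); lra.
rewrite ltr_norml in k1; rewrite ltr_norml in k2.
apply: (cauchy_formula tau_gt0); first by lra.
- by lra.
- by move=> w /inr; exact: hg.
Qed.

(** Cauchy's formula turns the derivative into an integral of f(s) / (s - t)^2 over a fixed contour,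
    which can be differentiated once more. *)
Lemma hol_deriv f z r : 0 < r -> hol f z r -> exists (g : C -> C) (rho : R),
  [/\ 0 < rho, forall t, nrm (t - z) < rho -> cder f t (g t) & hol g z rho].
Proof.
move=> r0 hf; have [x0 [x1 [y0 [y1 [rho [B [xx yy rho0 B0 [far inr bf CF]]]]]]]] := cauchy_near r0 hf.
have cf s : bdry x0 x1 y0 y1 s -> ccont f s by move=> /inr /hf[l]; exact: cder_ccont.
pose g t := (twopii R)^-1 * J (fun s => f s * (s - t)^-1 ^+ 2) x0 x1 y0 y1.
have r20 : 0 < rho / 2 by rewrite divr_gt0.
have far' t : nrm (t - z) < rho / 2 -> forall s, bdry x0 x1 y0 y1 s -> 2 * (rho / 2) <= nrm (s - t).
  move=> tz s bs; rewrite mulrC divfK ?pnatr_eq0 //.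
  have := far s bs; have -> : s - z = (s - t) + (t - z) by ring.
  have := le_nrmD (s - t) (t - z); lra.
exists g, (rho / 2); split=> // t tz.
  have D := cderM (cder_cst (twopii R)^-1 t) (@cder_kernel1 _ _ _ _ xx yy f t _ B r20 (far' t tz) B0 cf bf).
  rewrite mul0r add0r in D; apply: cder_near D; apply/nearC_P.
  exists (rho / 2) => // q qt; rewrite CF ?mulKf ?twopii_neq0 //.
  have -> : q - z = (q - t) + (t - z) by ring.
  by apply: le_lt_trans (le_nrmD _ _) _; lra.
have [l D] := @cder_kernel2 _ _ _ _ xx yy f t _ B r20 (far' t tz) B0 cf bf.
have := cderM (cder_cst (twopii R)^-1 t) D; by exists (0 * J (fun s => f s * (s - t)^-1 ^+ 2) x0 x1 y0 y1 + (twopii R)^-1 * l).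
Qed.

(** Off z the quotient is forced. At z its value is taken from the Cauchy integral G of f(s) / (s -
    z), which is differentiable there and, by partial fractions, agrees with the difference quotient
    near z. *)
Lemma hol_divide f z r : 0 < r -> hol f z r -> exists g : C -> C,
  (forall t, nrm (t - z) < r -> f t = f z + (t - z) * g t) /\ hol g z r.
Proof.
move=> r0 hf; have [x0 [x1 [y0 [y1 [rho [B [xx yy rho0 B0 [far inr bf CF]]]]]]]] := cauchy_near r0 hf.
have zz : nrm (z - z) < rho by rewrite subrr nrm0.
have [b0 bne] : (forall s, bdry x0 x1 y0 y1 s -> rho <= nrm (s - z)) /\
    forall s, bdry x0 x1 y0 y1 s -> s != z.
  by split=> s bs; have [] := far_near rho0 far zz bs.
pose G t := (twopii R)^-1 * J (fun s => (f s * (s - z)^-1) * (s - t)^-1) x0 x1 y0 y1.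
pose g t := if t == z then G z else (f t - f z) / (t - z).
have cphi s : bdry x0 x1 y0 y1 s -> ccont (fun s => f s * (s - z)^-1) s.
  move=> bs; have [l D] := hf s (inr s bs).
  exact: cder_ccont (cderM D (cder_inv_subr (bne s bs))).
have GE t : nrm (t - z) < rho -> t != z -> G t = (f t - f z) / (t - z).
  move=> tz tnz; have [_ bnt] : (forall s, bdry x0 x1 y0 y1 s -> rho <= nrm (s - t)) /\
    forall s, bdry x0 x1 y0 y1 s -> s != t.
    by split=> s bs; have [] := far_near rho0 far tz bs.
  have tz0 : t - z != 0 by rewrite subr_eq0.
  have ct s : bdry x0 x1 y0 y1 s -> ccont (fun s => f s * (s - t)^-1) s.
    move=> bs; have [l D] := hf s (inr s bs).
    exact: cder_ccont (cderM D (cder_inv_subr (bnt s bs))).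
  have cz' s : bdry x0 x1 y0 y1 s -> ccont (fun s => -1 * (f s * (s - z)^-1)) s.
    by move=> bs; exact: ccontM (cder_ccont (cder_cst _ _)) (cphi s bs).
  have cs s : bdry x0 x1 y0 y1 s -> ccont (fun s => (f s * (s - z)^-1) * (s - t)^-1) s.
    by move=> bs; exact: ccontM (cphi s bs) (cder_ccont (cder_inv_subr (bnt s bs))).
  have E : (t - z) * J (fun s => (f s * (s - z)^-1) * (s - t)^-1) x0 x1 y0 y1 =
      twopii R * f t - twopii R * f z.
    rewrite -(JZ tau_gt0 xx yy (t - z) cs).
    transitivity (J (fun s => f s * (s - t)^-1 + -1 * (f s * (s - z)^-1)) x0 x1 y0 y1).
      apply: (eq_J tau_gt0 xx yy).
        by move=> s bs; exact: ccontM (cder_ccont (cder_cst _ _)) (cs s bs).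
      move=> s bs; have h1 : s - t != 0 by rewrite subr_eq0 bnt.
      have h2 : s - z != 0 by rewrite subr_eq0 bne.
      by field; rewrite h1 h2.
    by rewrite (JD tau_gt0 xx yy ct cz') (JZ tau_gt0 xx yy (-1) cphi) !CF // mulN1r.
  by apply: (mulfI tz0); rewrite /G mulrCA E -mulrBr mulKf ?twopii_neq0 // mulrC divfK.
exists g; split.
  move=> t tr; rewrite /g; case: eqP => [->|/eqP tz]; first by rewrite subrr mul0r addr0.
  by rewrite mulrC divfK ?subr_eq0 // addrC subrK.
move=> t tr; have [->|tz] := eqVneq t z.
  have [l D] : exists l, cder G z l.
    have bphi s : bdry x0 x1 y0 y1 s -> nrm (f s * (s - z)^-1) <= B / rho.
      move=> bs; rewrite nrmM nrmV; apply: ler_pM; rewrite ?invr_ge0 ?nrm_ge0 ?bf //.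
      by rewrite lef_pV2 ?posrE ?b0 // (lt_le_trans rho0) ?b0.
    have Brho : 0 <= B / rho by rewrite divr_ge0 // ltW.
    have D := @cder_kernel1 _ _ _ _ xx yy _ z _ _ rho0 far Brho cphi bphi.
    by eexists; exact: cderM (cder_cst (twopii R)^-1 z) D.
  exists l; apply: cder_near D; apply/nearC_P; exists rho => // q qr.
  by rewrite /g; case: eqP => [->//|/eqP qz]; rewrite GE.
have [l D] := hf t tr; eexists.
apply: cder_near (cderM (cderB D (cder_cst (f z) t)) (cder_inv_subr tz)).
apply/nearC_P; exists (nrm (t - z)); first by rewrite nrm_gt0 subr_eq0.
move=> q qt; rewrite /g; case: eqP => // E; move: qt.
by rewrite E -opprB nrmN ltxx.
Qed.

(* Cauchy estimates bound the successive quotients [f / (t - z)^k], so that a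
   zero of infinite order is not isolated. *)
Lemma hol_order f z r : 0 < r -> hol f z r ->
  (\forall t \near z, f t = 0) \/
  exists (k : nat) (g : C -> C),
    [/\ hol g z r, g z != 0 & forall t, nrm (t - z) < r -> f t = (t - z) ^+ k * g t].
Proof.
move=> r0 hf.
have [[k [g [h1 h2 h3]]]|N] := pselect (exists (k : nat) (g : C -> C),
    [/\ hol g z r, g z != 0 & forall t, nrm (t - z) < r -> f t = (t - z) ^+ k * g t]).
  by right; exists k, g.
left.
have quot k : exists g : C -> C, hol g z r /\ forall t, nrm (t - z) < r -> f t = (t - z) ^+ k * g t.
  elim: k => [|k [g [hg Hg]]]; first by exists f; split=> // t _; rewrite mul1r.
  have [g' [Hg' hg']] := hol_divide r0 hg; exists g'; split=> // t tr.
  have gz : g z = 0 by apply: contrapT => /eqP gz; apply: N; exists k, g.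
  by rewrite Hg // Hg' // gz add0r mulrA -exprSr.
have [x0 [x1 [y0 [y1 [rho [B [xx yy rho0 B0 [far inr bf CF]]]]]]]] := cauchy_near r0 hf.
pose P := 2 * ((x1 - x0) + (y1 - y0) * nrm tau).
have P0 : 0 <= P by rewrite /P mulr_ge0 // addr_ge0 ?mulr_ge0 ?subr_ge0 ?nrm_ge0.
have T0 : 0 < nrm (twopii R) by rewrite nrm_gt0 twopii_neq0.
apply/nearC_P; exists (Num.min rho r); first by rewrite lt_min rho0.
move=> t; rewrite lt_min => /andP[tr trr].
(* Cauchy's formula for the k-th quotient: on the contour |s - z| >= 2 rho whereas |t - z| < rho,
   which gains a factor 1/2 for each power of t - z. *)
have bnd k : nrm (twopii R) * nrm (f t) <= (B / rho * P) * (2^-1) ^+ k.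
  have [g [hg Hg]] := quot k.
  have ct s : bdry x0 x1 y0 y1 s -> ccont (fun s => g s * (s - t)^-1) s.
    move=> bs; have [l D] := hg s (inr s bs).
    have [_ st] := far_near rho0 far tr bs.
    exact: cder_ccont (cderM D (cder_inv_subr st)).
  have := @J_bound R tau tau_gt0 x0 x1 y0 y1 xx yy _ (B / (2 * rho) ^+ k / rho) ct.
  rewrite (CF g t hg tr) -/P nrmM => K.
  have {K} : nrm (twopii R) * nrm (g t) <= B / (2 * rho) ^+ k / rho * P.
    apply: K => s bs; have [h1 _] := far_near rho0 far tr bs.
    have h2 := far s bs.
    rewrite nrmM nrmV; apply: ler_pM; rewrite ?invr_ge0 ?nrm_ge0 //; last first.
      by rewrite lef_pV2 ?posrE // (lt_le_trans rho0).
    have rk : 0 < (2 * rho) ^+ k by rewrite exprn_gt0 // mulr_gt0.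
    rewrite ler_pdivlMr //; apply: le_trans (bf s bs).
    rewrite (Hg s (inr s bs)) nrmM nrmX mulrC ler_wpM2r ?nrm_ge0 //.
    by rewrite lerXn2r // nnegrE ?nrm_ge0 // ltW // mulr_gt0.
  move=> K; rewrite (Hg t trr) nrmM nrmX mulrCA.
  apply: le_trans (ler_pM _ _ (lexx (nrm (t - z) ^+ k)) K) _.
  - by rewrite exprn_ge0 // nrm_ge0.
  - by rewrite mulr_ge0 // nrm_ge0.
  have E (p b i j q : R) : p * (b * i * j * q) = b * j * q * (p * i) by ring.
  rewrite E.
  apply: ler_wpM2l; first by rewrite mulr_ge0 // divr_ge0 // ltW.
  rewrite -expr_div_n lerXn2r ?nnegrE ?divr_ge0 ?nrm_ge0 ?mulr_ge0 ?invr_ge0 ?(ltW rho0) //.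
  by rewrite ler_pdivrMr ?mulr_gt0 // mulrA mulVf ?pnatr_eq0 // mul1r ltW.
apply/eqP; rewrite -nrm_eq0 eq_le nrm_ge0 andbT leNgt; apply/negP => ft.
have K0 : 0 < nrm (twopii R) * nrm (f t) by rewrite mulr_gt0.
have D0 : 0 <= B / rho * P by rewrite mulr_ge0 // divr_ge0 // ltW.
have D1 : 0 < B / rho * P + 1 by rewrite ltr_wpDl.
have [k hk] := exp2V_lt (divr_gt0 K0 D1).
rewrite ltr_pdivlMr // in hk.
have := bnd k; have e0 : 0 <= (2^-1 : R) ^+ k by rewrite exprn_ge0 // invr_ge0.
lra.
Qed.

End LocalTheory.

(** * Orders and divisors on the torus *)

Section Orders.
Local Open Scope classical_set_scope.
Local Open Scope ring_scope.
Variable R : realType.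
Local Notation C := (complexes R).
Local Notation Im := (@complex.Im R).
Implicit Types (z w v c u t : C) (f g F : C -> C) (k : int).

#[local] Opaque holomorphic_at.

Lemma cder_uniq f z l l' : cder f z l -> cder f z l' -> l = l'.
Proof. by move=> /cder_is_derive[_ <-] /cder_is_derive[_ <-]. Qed.

Lemma ccont_eq f g z : ccont f z -> ccont g z ->
  (\forall t \near (z : C)^', f t = g t) -> f z = g z.
Proof.
move=> cf cg /dnearC_P[d d0 H].
apply/eqP; rewrite -subr_eq0 -nrm_eq0 eq_le nrm_ge0 andbT leNgt; apply/negP => N0.
have N2 : 0 < nrm (f z - g z) / 2 by rewrite divr_gt0.
have [d1 d10 H1] := cf _ N2; have [d2 d20 H2] := cg _ N2.
pose r := Num.min d (Num.min d1 d2) / 2.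
have m0 : 0 < Num.min d (Num.min d1 d2) by rewrite !lt_min d0 d10 d20.
have r0 : 0 < r by rewrite divr_gt0.
have : r < Num.min d (Num.min d1 d2) by rewrite /r; lra.
rewrite !lt_min => /and3P[rd rd1 rd2].
pose t := z + toC r; have tz : nrm (t - z) = r.
  by rewrite /t [z + _]addrC addrK nrm_toC gtr0_norm.
have tnz : t != z by rewrite -subr_eq0 -nrm_eq0 tz gt_eqF.
have := H t tnz; rewrite tz => /(_ rd) E.
have := H1 t; rewrite tz => /(_ rd1) h1; have := H2 t; rewrite tz => /(_ rd2) h2.
have := le_nrmD (f z - f t) (g t - g z); rewrite E in h1 *.
rewrite (_ : f z - g t + (g t - g z) = f z - g z); last by ring.
rewrite (nrmB (f z) (g t)); move: h1 h2; lra.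
Qed.

Lemma hol_at_cder f z : holomorphic_at f z -> exists l, cder f z l.
Proof. by move=> /holomorphic_atP[r r0 H]; apply: H; rewrite subrr nrm0. Qed.

Lemma hol_at_ccont f z : holomorphic_at f z -> ccont f z.
Proof. by move=> /hol_at_cder[l]; exact: cder_ccont. Qed.

Lemma hol_at_near f z : holomorphic_at f z -> \forall t \near z, holomorphic_at f t.
Proof.
move=> /holomorphic_atP[r r0 H]; apply/nearC_P; exists r => // t tr.
by apply/holomorphic_atP; have [r' r'0 H'] := hol_near H tr; exists r'.
Qed.

Lemma hol_at_eq f g z : (\forall t \near z, f t = g t) -> holomorphic_at f z -> holomorphic_at g z.
Proof.
move=> /nearC_P[d d0 E] /holomorphic_atP[r r0 H]; apply/holomorphic_atP.
exists (Num.min d r); first by rewrite lt_min d0.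
move=> t; rewrite lt_min => /andP[td tr]; have [l D] := H t tr; exists l.
apply: cder_near D; apply/nearC_P; exists (d - nrm (t - z)); first by rewrite subr_gt0.
move=> s st; apply: E; have -> : s - z = (s - t) + (t - z) by ring.
by apply: le_lt_trans (le_nrmD _ _) _; rewrite -ltrBrDr.
Qed.

Lemma hol_at_op2 (op : C -> C -> C) f g z :
  (forall t l (k : C), cder f t l -> cder g t k -> exists m, cder (fun s => op (f s) (g s)) t m) ->
  holomorphic_at f z -> holomorphic_at g z -> holomorphic_at (fun s => op (f s) (g s)) z.
Proof.
move=> H /holomorphic_atP[r r0 Hf] /holomorphic_atP[r' r0' Hg]; apply/holomorphic_atP.
exists (Num.min r r'); first by rewrite lt_min r0.
move=> t; rewrite lt_min => /andP[tr tr'].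
by have [l D] := Hf t tr; have [k D'] := Hg t tr'; exact: H D D'.
Qed.

Lemma hol_atM f g z : holomorphic_at f z -> holomorphic_at g z ->
  holomorphic_at (fun s => f s * g s) z.
Proof. by apply: hol_at_op2 => t l k D D'; eexists; exact: cderM D D'. Qed.

Lemma hol_atD f g z : holomorphic_at f z -> holomorphic_at g z ->
  holomorphic_at (fun s => f s + g s) z.
Proof. by apply: hol_at_op2 => t l k D D'; eexists; exact: cderD D D'. Qed.

Lemma hol_at_cst c z : holomorphic_at (fun=> c) z.
Proof. by apply/holomorphic_atP; exists 1 => // t _; exists 0; exact: cder_cst. Qed.

Lemma hol_at_subr w z : holomorphic_at (fun t => t - w) z.
Proof. by apply/holomorphic_atP; exists 1 => // t _; exists 1; exact: cder_subr. Qed.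

Lemma hol_atX f z n : holomorphic_at f z -> holomorphic_at (fun s => f s ^+ n) z.
Proof.
move=> H; elim: n => [|n IH].
  by apply: hol_at_eq (hol_at_cst 1 z); apply/nearC_P; exists 1 => // t _; rewrite expr0.
by apply: hol_at_eq (hol_atM H IH); apply/nearC_P; exists 1 => // t _; rewrite exprS.
Qed.

Lemma hol_at_sum (I : Type) (r : seq I) (P : pred I) (f : I -> C -> C) z :
  (forall i, holomorphic_at (f i) z) -> holomorphic_at (fun s => \sum_(i <- r | P i) f i s) z.
Proof.
move=> H; elim: r => [|i r IH].
  by apply: hol_at_eq (hol_at_cst 0 z); apply/nearC_P; exists 1 => // t _; rewrite big_nil.
case Pi : (P i).
  apply: hol_at_eq (hol_atD (H i) IH); apply/nearC_P; exists 1 => // t _.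
  by rewrite big_cons Pi.
by apply: hol_at_eq IH; apply/nearC_P; exists 1 => // t _; rewrite big_cons Pi.
Qed.

Lemma hol_at_prod (I : Type) (r : seq I) (P : pred I) (f : I -> C -> C) z :
  (forall i, holomorphic_at (f i) z) -> holomorphic_at (fun s => \prod_(i <- r | P i) f i s) z.
Proof.
move=> H; elim: r => [|i r IH].
  by apply: hol_at_eq (hol_at_cst 1 z); apply/nearC_P; exists 1 => // t _; rewrite big_nil.
case Pi : (P i).
  apply: hol_at_eq (hol_atM (H i) IH); apply/nearC_P; exists 1 => // t _.
  by rewrite big_cons Pi.
by apply: hol_at_eq IH; apply/nearC_P; exists 1 => // t _; rewrite big_cons Pi.
Qed.

Lemma ccont_neq0 f z : ccont f z -> f z != 0 -> \forall t \near z, f t != 0.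
Proof.
move=> cf fz; have N0 : 0 < nrm (f z) by rewrite nrm_gt0.
have [d d0 H] := cf _ N0; apply/nearC_P; exists d => // t /H.
by apply: contraTneq => ->; rewrite sub0r nrmN ltxx.
Qed.

Lemma hol_atV f z : holomorphic_at f z -> f z != 0 -> holomorphic_at (fun s => (f s)^-1) z.
Proof.
move=> hf fz; have /nearC_P[d d0 H] := ccont_neq0 (hol_at_ccont hf) fz.
have /holomorphic_atP[r r0 Hf] := hf; apply/holomorphic_atP.
exists (Num.min d r); first by rewrite lt_min d0.
move=> t; rewrite lt_min => /andP[td tr]; have [l D] := Hf t tr.
by eexists; apply: cderV D; exact: H.
Qed.

Lemma subr_expz_neq0 z t k : t != z -> (t - z) ^ k != 0.
Proof. by move=> tz; rewrite expfz_neq0 // subr_eq0. Qed.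

Lemma has_order_eq f g z k : (\forall t \near (z : C)^', f t = g t) ->
  has_order f z k -> has_order g z k.
Proof.
move=> E [h [hh h0 H]]; exists h; split=> //.
by near=> t; rewrite -(near E t) //; near: t.
Unshelve. all: by end_near. Qed.

Lemma has_orderM f g z k l : has_order f z k -> has_order g z l ->
  has_order (fun t => f t * g t) z (k + l).
Proof.
move=> [F [hF F0 /dnearC_P[d d0 EF]]] [G [hG G0 /dnearC_P[d' d0' EG]]].
exists (fun t => F t * G t); split; [exact: hol_atM|by rewrite mulf_neq0|].
apply/dnearC_P; exists (Num.min d d'); first by rewrite lt_min d0.
move=> t tz; rewrite lt_min => /andP[td td']; rewrite EF // EG //.
by rewrite expfzDr ?subr_eq0 // mulrACA.
Qed.

Lemma has_orderV f z k : has_order f z k -> has_order (fun t => (f t)^-1) z (- k).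
Proof.
move=> [F [hF F0 /dnearC_P[d d0 EF]]].
exists (fun t => (F t)^-1); split; [exact: hol_atV|by rewrite invr_neq0|].
apply/dnearC_P; exists d => // t tz td; rewrite EF // invfM.
by rewrite invr_expz.
Qed.

Lemma has_order0 f z : holomorphic_at f z -> f z != 0 -> has_order f z 0.
Proof.
move=> hf fz; exists f; split=> //; apply/dnearC_P; exists 1 => // t _ _.
by rewrite expr0z mul1r.
Qed.

Lemma has_order_cst c z : c != 0 -> has_order (fun=> c) z 0.
Proof. by move=> c0; apply: has_order0 => //; exact: hol_at_cst. Qed.

Lemma has_order_subr z : has_order (fun t => t - z) z 1.
Proof.
exists (fun=> 1); split; [exact: hol_at_cst|exact: oner_neq0|].
by apply/dnearC_P; exists 1 => // t _ _; rewrite expr1z mulr1.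
Qed.

Lemma has_order_expz f z k (m : int) : has_order f z k -> has_order (fun t => f t ^ m) z (k * m).
Proof.
move=> H.
have pos (n : nat) : has_order (fun t => f t ^+ n) z (k * n%:Z).
  elim: n => [|n IH].
    rewrite mulr0; apply: has_order_eq (has_order_cst z (oner_neq0 _)).
    by apply/dnearC_P; exists 1 => // t _ _; rewrite expr0.
  rewrite -addn1 PoszD mulrDr mulr1; apply: has_order_eq (has_orderM IH H).
  by apply/dnearC_P; exists 1 => // t _ _; rewrite addn1 exprSr.
case: m => n; first exact: pos.
by rewrite NegzE mulrN; exact: has_orderV (pos n.+1).
Qed.

Lemma has_order_uniq f z k l : has_order f z k -> has_order f z l -> k = l.
Proof.
suff lt k' l' : has_order f z k' -> has_order f z l' -> ~ (k' < l').
  by move=> hk hl; case: (ltgtP k l) => // /lt; [move/(_ hk hl)|move/(_ hl hk)].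
move=> [F [hF F0 /dnearC_P[d d0 EF]]] [G [hG G0 /dnearC_P[d' d0' EG]]] kl.
have [n nE] : exists n : nat, l' = k' + n.+1%:Z.
  exists (`|l' - k'|%N).-1; have p0 : 0 < l' - k' by rewrite subr_gt0.
  by rewrite prednK ?absz_gt0 ?gt_eqF // gez0_abs ?ltW // addrCA subrr addr0.
have E : F z = (z - z) ^+ n.+1 * G z.
  apply: (@ccont_eq F (fun t => (t - z) ^+ n.+1 * G t)).
  - exact: hol_at_ccont.
  - exact: hol_at_ccont (hol_atM (hol_atX n.+1 (hol_at_subr z z)) hG).
  apply/dnearC_P; exists (Num.min d d'); first by rewrite lt_min d0.
  move=> t tz; rewrite lt_min => /andP[td td'].
  apply: (mulfI (subr_expz_neq0 k' tz)); rewrite -EF // EG //.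
  by rewrite nE expfzDr ?subr_eq0 // mulrA.
by move/eqP: F0; apply; rewrite E subrr expr0n mul0r.
Qed.

Lemma has_order_near f z k : has_order f z k -> \forall t \near (z : C)^', has_order f t 0.
Proof.
move=> [F [hF F0 /dnearC_P[d d0 EF]]].
have /nearC_P[d1 d10 H1] := ccont_neq0 (hol_at_ccont hF) F0.
have /nearC_P[d2 d20 H2] := hol_at_near hF.
apply/dnearC_P; exists (Num.min d (Num.min d1 d2)); first by rewrite !lt_min d0 d10.
move=> t tz; rewrite !lt_min => /and3P[td td1 td2].
have tz0 : t - z != 0 by rewrite subr_eq0.
apply: (@has_order_eq (fun s => (s - z) ^ k * F s)).
  apply/dnearC_P; exists (Num.min (d - nrm (t - z)) (nrm (t - z))).
    by rewrite lt_min subr_gt0 td nrm_gt0.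
  move=> s st; rewrite lt_min => /andP[s1 s2]; rewrite EF //.
    by apply: contraTneq s2 => ->; rewrite -opprB nrmN ltxx.
  have -> : s - z = (s - t) + (t - z) by ring.
  by apply: le_lt_trans (le_nrmD _ _) _; rewrite -ltrBrDr.
have h1 := has_order0 (hol_at_subr z t) tz0.
have h2 := has_order0 (H2 t td2) (H1 t td1).
by have := has_orderM (has_order_expz k h1) h2; rewrite mul0r addr0.
Qed.

(* The value at removable singularities is restored by taking limits. *)
Definition regular f z : C := xget 0 [set l | forall e : R, 0 < e -> exists2 d : R, 0 < d &
  forall t, t != z -> nrm (t - z) < d -> nrm (f t - l) < e].

Lemma regularE f g z : ccont g z -> (\forall t \near (z : C)^', f t = g t) -> regular f z = g z.
Proof.
move=> cg E; rewrite /regular; case: xgetP => [l _ Hl|/(_ (g z)) []] /=.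
  have cl : ccont (fun t => if t == z then l else f t) z.
    move=> e e0; have [d d0 H] := Hl e e0; exists d => // t td; rewrite eqxx.
    by case: eqVneq => [_|tz]; [rewrite subrr nrm0|exact: H].
  have := ccont_eq cl cg; rewrite eqxx; apply.
  move/dnearC_P: E => [d d0 E]; apply/dnearC_P; exists d => // t tz td.
  by rewrite (negPf tz) E.
move=> e e0; have [d d0 H] := cg e e0; move/dnearC_P: E => [d' d0' E].
exists (Num.min d d'); first by rewrite lt_min d0.
by move=> t tz; rewrite lt_min => /andP[td td']; rewrite E //; exact: H.
Qed.

Lemma regular_near f g z : holomorphic_at g z -> (\forall t \near (z : C)^', f t = g t) ->
  \forall t \near z, regular f t = g t.
Proof.
move=> hg E; have [d d0 Ed] := (dnearC_P _ _).1 E.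
have /nearC_P[r r0 H] := hol_at_near hg.
apply/nearC_P; exists (Num.min d r); first by rewrite lt_min d0.
move=> t; rewrite lt_min => /andP[td tr]; apply: regularE; first by apply/hol_at_ccont/H.
have [->//|tz] := eqVneq t z.
apply/dnearC_P; exists (Num.min (d - nrm (t - z)) (nrm (t - z))).
  by rewrite lt_min subr_gt0 td nrm_gt0 subr_eq0.
move=> s st; rewrite lt_min => /andP[s1 s2]; apply: Ed.
  by apply: contraTneq s2 => ->; rewrite -opprB nrmN ltxx.
have -> : s - z = (s - t) + (t - z) by ring.
by apply: le_lt_trans (le_nrmD _ _) _; rewrite -ltrBrDr.
Qed.

Lemma regular_hol f z : has_order f z 0 -> holomorphic_at (regular f) z /\ regular f z != 0.
Proof.
move=> [g [hg g0 E]].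
have E' : \forall t \near (z : C)^', f t = g t.
  move/dnearC_P: E => [d d0 E]; apply/dnearC_P; exists d => // t tz td.
  by rewrite E // expr0z mul1r.
split; last by rewrite (regularE (hol_at_ccont hg) E').
move/nearC_P: (regular_near hg E') => [d d0 H].
by apply: hol_at_eq hg; apply/nearC_P; exists d => // t td; rewrite H.
Qed.

End Orders.

Section Torus.
Local Open Scope classical_set_scope.
Local Open Scope ring_scope.
Variable R : realType.
Local Notation C := (complexes R).
Variable tau : C.
Local Notation T := (torus tau).
Local Notation prj := (to_torus tau).

Lemma to_torusD z w : prj (z + w) = prj z + prj w.
Proof. exact: (Quotient.pi_add (lattice_group tau) z w). Qed.

Lemma to_torusB : zmod_morphism prj.
Proof.
move=> z w; rewrite to_torusD; congr (_ + _).
exact: (Quotient.pi_opp (lattice_group tau) w).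
Qed.

HB.instance Definition _ := GRing.isZmodMorphism.Build C T prj to_torusB.

Lemma to_torus_eq0 z : prj z = 0 <-> exists a b : int, z = a%:~R + b%:~R * tau.
Proof.
have -> : 0 = prj 0 :> T by rewrite raddf0.
split=> [/eqP|[a [b E]]].
  by rewrite /to_torus -Quotient.idealrBE subr0 => /asboolP.
apply/eqP; rewrite /to_torus -Quotient.idealrBE subr0; apply/asboolP; by exists a, b.
Qed.

Lemma to_torus_eq z w : prj z = prj w <-> exists a b : int, z = w + (a%:~R + b%:~R * tau).
Proof.

have E : prj z = prj w <-> prj (z - w) = 0.
  by rewrite to_torusB; split=> [->|/eqP]; [rewrite subrr|rewrite subr_eq0 => /eqP].
rewrite E to_torus_eq0; split=> -[a [b e]]; exists a, b; first by rewrite -e addrC subrK.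
by rewrite e addrC addKr.
Qed.

Lemma to_torus_surj (x : T) : exists z, prj z = x.
Proof. by exists (repr x); rewrite /to_torus reprK. Qed.

(** Degree and sum are kept in one predicate since Abel's theorem gives both. The list may exceed
    the support, which eases additions; [sums_uniq] removes the dependence on it. *)
Definition sums (D : T -> int) (d : int) (s : T) : Prop := exists l : seq T,
  [/\ uniq l, forall x, x \notin l -> D x = 0, \sum_(x <- l) D x = d
    & \sum_(x <- l) x *~ D x = s].

Lemma sums_on (D : T -> int) (l l' : seq T) (V : zmodType) (F : T -> int -> V) :
  (forall x, F x 0 = 0) -> uniq l -> uniq l' -> {subset l <= l'} ->
  (forall x, x \notin l -> D x = 0) -> \sum_(x <- l) F x (D x) = \sum_(x <- l') F x (D x).
Proof.
move=> F0 ul ul' sub D0.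
rewrite [RHS](bigID (mem l)) /= [X in _ = _ + X]big1 ?addr0; last first.
  by move=> x /D0 ->.
have P : perm_eq [seq x <- l' | x \in l] l.
  apply: uniq_perm => //; first exact: filter_uniq.
  by move=> x; rewrite mem_filter; case xl : (x \in l) => //=; exact: sub.
by rewrite -[RHS]big_filter (perm_big _ P).
Qed.

Lemma sums_ext (D : T -> int) d s (l : seq T) : sums D d s -> uniq l ->
  (forall x, x \notin l -> D x = 0) -> \sum_(x <- l) D x = d /\ \sum_(x <- l) x *~ D x = s.
Proof.
move=> [l' [ul' D0' <- <-]] ul D0.
pose L := undup (l ++ l').
have s1 : {subset l <= L} by move=> x; rewrite mem_undup mem_cat => ->.
have s2 : {subset l' <= L} by move=> x; rewrite mem_undup mem_cat orbC => ->.
have uL : uniq L by exact: undup_uniq.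
split.
  rewrite (sums_on (F := fun _ k => k) _ ul uL s1 D0) //.
  by rewrite (sums_on (F := fun _ k => k) _ ul' uL s2 D0').
rewrite (sums_on (F := fun x k => x *~ k) _ ul uL s1 D0) //.
by rewrite (sums_on (F := fun x k => x *~ k) _ ul' uL s2 D0').
Qed.

Lemma sums_uniq (D : T -> int) d s d' s' : sums D d s -> sums D d' s' -> d = d' /\ s = s'.
Proof.
move=> [l [ul D0 <- <-]] H; have [-> ->] := sums_ext H ul D0; by [].
Qed.

Lemma sumsD (D D' : T -> int) d s d' s' : sums D d s -> sums D' d' s' ->
  sums (fun x => D x + D' x) (d + d') (s + s').
Proof.
move=> H H'; have [l [_ D0 _ _]] := H; have [l' [_ D0' _ _]] := H'.
pose L := undup (l ++ l').
have uL : uniq L by exact: undup_uniq.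
have o1 x : x \notin L -> D x = 0.
  by rewrite mem_undup mem_cat negb_or => /andP[/D0].
have o2 x : x \notin L -> D' x = 0.
  by rewrite mem_undup mem_cat negb_or => /andP[_ /D0'].
have [<- <-] := sums_ext H uL o1; have [<- <-] := sums_ext H' uL o2.
exists L; split=> //; rewrite ?big_split //.
  by move=> x xL; rewrite o1 // o2.
by rewrite -big_split /=; apply: eq_bigr => x _; rewrite mulrzDr.
Qed.

Lemma sumsZ (D : T -> int) d s (k : int) : sums D d s ->
  sums (fun x => D x * k) (d * k) (s *~ k).
Proof.
move=> [l [ul D0 <- <-]]; exists l; split=> //.
- by move=> x /D0 ->; rewrite mul0r.
- by rewrite mulr_suml.
- by rewrite mulrz_suml; apply: eq_bigr => x _; rewrite mulrzA.
Qed.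

Lemma sums0 : sums (fun=> 0) 0 0.
Proof. by exists [::]; split; rewrite ?big_nil. Qed.

Lemma eq_sums (D D' : T -> int) d s : (forall x, D x = D' x) -> sums D d s -> sums D' d s.
Proof. by move=> /funext ->. Qed.

Lemma sums_point (u : T) : sums (fun x => (x == u)%:Z) 1 u.
Proof.
exists [:: u]; split; rewrite ?big_seq1 ?eqxx ?mulr1z // => x.
by rewrite inE => /negPf ->.
Qed.

Lemma sums_sum (I : Type) (r : seq I) (P : pred I) (D : I -> T -> int) (d : I -> int) (s : I -> T) :
  (forall i, sums (D i) (d i) (s i)) ->
  sums (fun x => \sum_(i <- r | P i) D i x) (\sum_(i <- r | P i) d i) (\sum_(i <- r | P i) s i).
Proof.
move=> H; elim: r => [|i r IH].
  by rewrite !big_nil; apply: eq_sums sums0 => x; rewrite big_nil.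
rewrite !big_cons; case Pi : (P i).
  by apply: eq_sums (sumsD (H i) IH) => x; rewrite big_cons Pi.
by apply: eq_sums IH => x; rewrite big_cons Pi.
Qed.

End Torus.

(** * Abel's theorem *)

Section Abel.
Local Open Scope classical_set_scope.
Local Open Scope ring_scope.
Variable R : realType.
Local Notation C := (complexes R).
Local Notation Im := (@complex.Im R).
Local Notation toC := (@toC R).
Variable tau : C.
Hypothesis tau_gt0 : 0 < Im tau.
Local Notation T := (torus tau).
Local Notation prj := (to_torus tau).
Local Notation pt := (pt tau).
Local Notation J := (J tau).
Local Notation rect := (rect tau).
Local Notation bdry := (bdry tau).
#[local] Opaque holomorphic_at.

Lemma toC_int (k : int) : toC k%:~R = k%:~R.
Proof. exact: (rmorph_int (real_complex R)). Qed.

Lemma int_small (k : int) : -1 < k%:~R :> R -> k%:~R < 1 :> R -> k = 0.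
Proof.
move=> k1 k2; have {}k1 : -1 < k by rewrite -(ltr_int R) rmorphN.
have {}k2 : k < 1 by rewrite -(ltr_int R).
lia.
Qed.

Lemma ptD_int (x y : R) (a b : int) : pt (x + a%:~R) (y + b%:~R) = pt x y + (a%:~R + b%:~R * tau).
Proof. by rewrite /pt !toCD !toC_int; ring. Qed.

Lemma prj_pt_eq (x y x' y' : R) : prj (pt x y) = prj (pt x' y') ->
  exists a b : int, x = x' + a%:~R /\ y = y' + b%:~R.
Proof.
move=> /to_torus_eq[a [b]]; rewrite -ptD_int => /(pt_inj tau_gt0)[-> ->].
by exists a, b.
Qed.

Lemma prj_surj_rect (p q : R) (u : T) : exists x y : R,
  [/\ p <= x < p + 1, q <= y < q + 1 & prj (pt x y) = u].
Proof.
have [z <-] := to_torus_surj u; have [x [y ->]] := pt_surj tau_gt0 z.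
have frac (r s : R) : r <= s - (Num.floor (s - r))%:~R < r + 1.
  have /andP[f1 f2] := floor_itv (s - r); rewrite intrD in f2; apply/andP; split; lra.
exists (x - (Num.floor (x - p))%:~R), (y - (Num.floor (y - q))%:~R); split=> //.
apply/to_torus_eq; exists (- Num.floor (x - p)), (- Num.floor (y - q)).
by rewrite -ptD_int !rmorphN.
Qed.

Section Divisor.
Local Open Scope classical_set_scope.
Local Open Scope ring_scope.
Variables (f : T -> C) (D : T -> int).
Hypothesis fD : forall z, has_order (fun t => f (prj t)) z (D (prj z)).

(** Around each point the order is 0 except possibly at the point itself; bisection of a fundamental
    parallelogram replaces a compactness argument. *)
Lemma divisor_finite : exists l : seq T, uniq l /\ forall u, u \notin l -> D u = 0.
Proof.
pose S (x y d : R) := exists l : seq T, forall p q : R,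
  x <= p <= x + d * 1 -> y <= q <= y + d * 1 -> D (prj (pt p q)) != 0 -> prj (pt p q) \in l.
have [l Hl] : S 0 0 1.
  apply: (@rect_bisect R S 1 1) => //.
    move=> x y d d0 [l1 H1] [l2 H2] [l3 H3] [l4 H4].
    exists (l1 ++ l2 ++ l3 ++ l4) => p q /andP[p1 p2] /andP[q1 q2] Dn.
    rewrite !mem_cat.
    have Ex : x + d / 2 * 1 + d / 2 * 1 = x + d * 1 by field.
    have Ey : y + d / 2 * 1 + d / 2 * 1 = y + d * 1 by field.
    rewrite Ex in H2 H4; rewrite Ey in H3 H4.
    case: (leP p (x + d / 2 * 1)) => hp; case: (leP q (y + d / 2 * 1)) => hq.
    - by rewrite H1 // ?p1 ?q1.
    - by rewrite H3 ?orbT // ?p1 ?q2 ?(ltW hq).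
    - by rewrite H2 ?orbT // ?q1 ?p2 ?(ltW hp).
    - by rewrite H4 ?orbT // ?p2 ?q2 ?(ltW hp) ?(ltW hq).
  move=> p q _ _.
  have /dnearC_P[r r0 Hr] := has_order_near (fD (pt p q)).
  have N0 : 0 < 1 + nrm tau by rewrite ltr_wpDr // nrm_ge0.
  exists (r / (1 + nrm tau)); first by rewrite divr_gt0.
  move=> x y d d0; rewrite ltr_pdivlMr // => dr hp hq; exists [:: prj (pt p q)].
  move=> p' q' hp' hq' Dn; rewrite inE.
  have [->//|ne] := eqVneq (pt p' q') (pt p q).
  case/eqP: Dn; apply: has_order_uniq (fD _) (Hr _ ne _).
  rewrite ptB; apply: le_lt_trans (nrm_pt _ _ _) _; apply: le_lt_trans dr.
  rewrite mulrDr mulr1 lerD //; first by rewrite ler_norml; lra.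
  by rewrite ler_wpM2r ?nrm_ge0 // ler_norml; lra.
exists (undup l); split; first exact: undup_uniq.
move=> u; rewrite mem_undup => ul; apply/eqP; apply: contraNT ul => Du.
have [x [y [hx hy E]]] := prj_surj_rect 0 0 u.
by rewrite -E; apply: Hl; rewrite ?E //; lra.
Qed.

(** Pigeonhole among the numbers 1 / (j + 2). *)
Lemma avoid_finite (l : seq R) : exists2 x : R, 0 < x < 1 & x \notin l.
Proof.
pose c j : R := j.+2%:R^-1.
have ci : injective c.
  by move=> i j /invr_inj/eqP; rewrite eqr_nat => /eqP[].
have [/allP s|] := boolP (all (mem l) [seq c j | j <- iota 0 (size l).+1]).
  have u : uniq [seq c j | j <- iota 0 (size l).+1] by rewrite map_inj_uniq // iota_uniq.
  by have := uniq_leq_size u s; rewrite size_map size_iota ltnn.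
rewrite -has_predC => /hasP[x /mapP[j _ ->] xl]; exists (c j) => //.
by rewrite invr_gt0 ltr0n /= invf_lt1 ?ltr0n // ltr1n.
Qed.

Lemma has_order_prod (I : eqType) (r : seq I) (g : I -> C -> C) (k : I -> int) z :
  (forall i, i \in r -> has_order (g i) z (k i)) ->
  has_order (fun t => \prod_(i <- r) g i t) z (\sum_(i <- r) k i).
Proof.
elim: r => [|i r IH] H.
  rewrite big_nil; apply: has_order_eq (has_order_cst z (oner_neq0 _)).
  by apply/dnearC_P; exists 1 => // t _ _; rewrite big_nil.
rewrite big_cons; apply: has_order_eq (has_orderM (H i (mem_head _ _)) (IH _)).
  by apply/dnearC_P; exists 1 => // t _ _; rewrite big_cons.
by move=> j jr; apply: H; rewrite inE jr orbT.
Qed.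

Lemma cder_expz (a z : C) (k : int) : z != a ->
  cder (fun t => (t - a) ^ k) z (k%:~R * (z - a)^-1 * (z - a) ^ k).
Proof.
move=> za; have za0 : z - a != 0 by rewrite subr_eq0.
have pos (n : nat) : cder (fun t => (t - a) ^+ n) z (n%:R * (z - a)^-1 * (z - a) ^+ n).
  elim: n => [|n IH].
    have := cder_cst 1 z; rewrite !mul0r; apply: cder_near.
    by apply/nearC_P; exists 1 => // t _; rewrite expr0.
  have := cderM (cder_subr a z) IH => DD.
  have E : (1 * (z - a) ^+ n + (z - a) * (n%:R * (z - a)^-1 * (z - a) ^+ n)) =
     n.+1%:R * (z - a)^-1 * (z - a) ^+ n.+1.
    by rewrite exprS -[n.+1]addn1 natrD; field.
  rewrite -E; apply: cder_near DD.
  by apply/nearC_P; exists 1 => // t _; rewrite exprS.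
case: k => n; first exact: pos.
have n0 : (z - a) ^+ n.+1 != 0 by rewrite expf_neq0.
have DV := @cderV R (fun t => (t - a) ^+ n.+1) z _ n0 (pos n.+1).
rewrite (_ : _ * _ = - (n.+1%:R * (z - a)^-1 * (z - a) ^+ n.+1) / (z - a) ^+ n.+1 ^+ 2).
  exact: DV.
rewrite NegzE rmorphN /= -[(z - a) ^ (- n.+1%:Z)]/((z - a) ^- n.+1) -pmulrn.
move: n0; set X := (z - a) ^+ n.+1; set c := n.+1%:R => X0.
by rewrite -/c; field; rewrite za0 X0.
Qed.

Lemma cder_prod_log (I : eqType) (r : seq I) (a : I -> C) (k : I -> int) z :
  (forall i, i \in r -> z != a i) ->
  cder (fun t => \prod_(i <- r) (t - a i) ^ k i) z
    ((\sum_(i <- r) (k i)%:~R * (z - a i)^-1) * \prod_(i <- r) (z - a i) ^ k i).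
Proof.
elim: r => [|i r IH] H.
  rewrite !big_nil mul0r; apply: cder_near (cder_cst 1 z).
  by apply/nearC_P; exists 1 => // t _; rewrite big_nil.
have Hr j : j \in r -> z != a j by move=> jr; apply: H; rewrite inE jr orbT.
have DD := cderM (cder_expz (k i) (H i (mem_head _ _))) (IH Hr).
apply: cder_near (cder_eq _ DD).
  by apply/nearC_P; exists 1 => // t _; rewrite big_cons.
by rewrite !big_cons; ring.
Qed.

Lemma J_sum (I : eqType) (r : seq I) (g : I -> C -> C) (x0 x1 y0 y1 : R) : x0 <= x1 -> y0 <= y1 ->
  (forall i, i \in r -> forall z, bdry x0 x1 y0 y1 z -> ccont (g i) z) ->
  (forall z, bdry x0 x1 y0 y1 z -> ccont (fun t => \sum_(i <- r) g i t) z) /\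
  J (fun z => \sum_(i <- r) g i z) x0 x1 y0 y1 = \sum_(i <- r) J (g i) x0 x1 y0 y1.
Proof.
move=> hx hy; have ext0 (h : C -> C) : (forall z, h z = 0) ->
    (forall z, bdry x0 x1 y0 y1 z -> ccont h z) /\ J h x0 x1 y0 y1 = 0.
  move=> h0; have -> : h = (fun=> 0) by apply/funext.
  split; first by move=> z _; exact: cder_ccont (cder_cst _ _).
  exact: (@J_prim R tau tau_gt0 x0 x1 y0 y1 hx hy (fun=> 0) (fun=> 0) (fun z _ => cder_cst 0 z)).
elim: r => [|i r IH] H.
  by rewrite big_nil; apply: ext0 => z; rewrite big_nil.
have [|cs Js] := IH; first by move=> j jr; apply: H; rewrite inE jr orbT.
have ci := H i (mem_head _ _).
have -> : (fun t => \sum_(j <- i :: r) g j t) = (fun t => g i t + \sum_(j <- r) g j t).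
  by apply/funext => t; rewrite big_cons.
split; last by rewrite (JD tau_gt0 hx hy ci cs) big_cons Js.
move=> z bz e e0; have e2 : 0 < e / 2 by rewrite divr_gt0.
have [d d0 Hd] := ci z bz _ e2; have [d' d0' Hd'] := cs z bz _ e2.
exists (Num.min d d'); first by rewrite lt_min d0.
move=> t; rewrite lt_min => /andP[/Hd h1 /Hd' h2].
by rewrite opprD addrACA; apply: le_lt_trans (le_nrmD _ _) _; lra.
Qed.

(* Integrate [f'/f] and [z f'/f] along a period parallelogram. *)
Theorem abel : sums D 0 0.
Proof.
have [l [ul D0]] := divisor_finite.
(* These representatives in the unit square serve to choose a corner (p0, q0) such that no zero or
   pole lies on the boundary of the period parallelogram based there; [sx] and [sy] are the
   representatives inside the latter. *)
have [rx Hrx] := choice (fun u => prj_surj_rect 0 0 u).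
have [ry Hry] := choice Hrx.
have [p0 hp0 pl] := avoid_finite [seq rx u | u <- l].
have [q0 hq0 ql] := avoid_finite [seq ry u | u <- l].
set p1 := p0 + 1; set q1 := q0 + 1.
have pp : p0 <= p1 by rewrite lerDl. have qq : q0 <= q1 by rewrite lerDl.
have [sx Hsx] := choice (fun u => prj_surj_rect p0 q0 u).
have [sy Hsy] := choice Hsx.
pose a u := pt (sx u) (sy u).
have prja u : prj (a u) = u by have [] := Hsy u.
have nolat (r s : R) (k : int) : 0 < r < 1 -> 0 <= s < 1 -> s = r + k%:~R -> s = r.
  move=> hr hs E.
  have k1 : -1 < k%:~R :> R by lra.
  have k2 : k%:~R < 1 :> R by lra.
  by rewrite E (int_small k1 k2) addr0.
have offx u (k : int) y : u \in l -> prj (pt (p0 + k%:~R) y) = u -> False.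
  move=> ul' E; have [h1 h2 E'] := Hry u; rewrite add0r in h1.
  have [c [d [e _]]] : exists c d : int, rx u = p0 + k%:~R + c%:~R /\ ry u = y + d%:~R.
    by apply: prj_pt_eq; rewrite E'.
  case/negP: pl; apply/mapP; exists u => //; apply/esym; apply: (@nolat p0 (rx u) (k + c)) => //.
  by rewrite e rmorphD addrA.
have offy u (k : int) x : u \in l -> prj (pt x (q0 + k%:~R)) = u -> False.
  move=> ul' E; have [h1 h2 E'] := Hry u; rewrite add0r in h2.
  have [c [d [_ e]]] : exists c d : int, rx u = x + c%:~R /\ ry u = q0 + k%:~R + d%:~R.
    by apply: prj_pt_eq; rewrite E'.
  case/negP: ql; apply/mapP; exists u => //; apply/esym; apply: (@nolat q0 (ry u) (k + d)) => //.
  by rewrite e rmorphD addrA.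
have inta u : u \in l -> p0 < sx u < p1 /\ q0 < sy u < q1.
  move=> ul'; have [/andP[h1 h2] /andP[h3 h4] E] := Hsy u.
  split; apply/andP; split=> //; rewrite lt_neqAle ?h1 ?h3 andbT; apply/eqP => e.
    by apply: (offx u 0 (sy u) ul'); rewrite addr0 e.
  by apply: (offy u 0 (sx u) ul'); rewrite addr0 e.
have repr u z : u \in l -> rect p0 p1 q0 q1 z -> prj z = u -> z = a u.
  move=> ul' [x [y [hx hy ->]]] E.
  have [hsx hsy] := inta u ul'.
  have [c [d [e e']]] := @prj_pt_eq x y (sx u) (sy u) (etrans E (esym (prja u))).
  have z0 (k : int) (r s w : R) : w < r < w + 1 -> w <= s <= w + 1 -> s = r + k%:~R -> k = 0.
    move=> hr hs E'.
    have k1 : -1 < k%:~R :> R by lra.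
    have k2 : k%:~R < 1 :> R by lra.
    exact: int_small k1 k2.
  rewrite /a e e' (z0 c (sx u) x p0) // (z0 d (sy u) y q0) //.
  by rewrite !addr0.
(* On the closed parallelogram the rational function P has the orders of f, so f / P extends to a
   holomorphic h without zeros. Then phi = L + h' / h, the logarithmic derivative of f on the
   boundary, has explicit simple poles of residue D u at a u. *)
pose P z := \prod_(u <- l) (z - a u) ^ D u.
pose F := regular (fun t => f (prj t)).
pose h0 z := f (prj z) * (P z)^-1.
have ordP z : rect p0 p1 q0 q1 z -> has_order P z (D (prj z)).
  move=> rz.
  have -> : D (prj z) = \sum_(u <- l) (z == a u)%:Z * D u.
    have [zl|zl] := boolP (prj z \in l).
      have za := repr _ _ zl rz erefl.
      rewrite (bigD1_seq (prj z)) //= -za eqxx mul1r big1 ?addr0 // => u uz.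
      case: eqP => [E|]; last by rewrite mul0r.
      by case/eqP: uz; rewrite E prja.
    rewrite D0 // big_seq big1 // => u ul'; case: eqP => [E|]; last by rewrite mul0r.
    by case/negP: zl; rewrite E prja.
  apply: has_order_prod => u _; apply: has_order_expz.
  case: eqVneq => [->|za]; first exact: has_order_subr.
  have za0 : z - a u != 0 by rewrite subr_eq0.
  exact: (has_order0 (hol_at_subr (a u) z) za0).
have ordh z : rect p0 p1 q0 q1 z -> has_order h0 z 0.
  by move=> rz; have := has_orderM (fD z) (has_orderV (ordP z rz)); rewrite subrr.
pose h := regular h0.
have hh z : rect p0 p1 q0 q1 z -> holomorphic_at h z /\ h z != 0.
  by move=> /ordh; exact: regular_hol.
pose h' (z : C) : C := 'D_1 (h : C -> C) z.
have Dh z : rect p0 p1 q0 q1 z -> cder h z (h' z) /\ exists k, cder h' z k.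
  move=> /hh[/holomorphic_atP[r r0 Hr] _].
  have hz w : (exists k, cder h w k) -> cder h w (h' w).
    by move=> [k K]; have [_ E] := (cder_is_derive h w k).2 K; rewrite /h' E.
  have [g [rho [rho0 Hg hg]]] := hol_deriv tau_gt0 r0 Hr.
  have zz : nrm (z - z) < rho by rewrite subrr nrm0.
  split; first by apply: hz; exists (g z); exact: Hg.
  have [k K] := hg z zz; exists k; apply: cder_near K.
  apply/nearC_P; exists rho => // t tr.
  by apply: cder_uniq (Hg t tr) _; apply: hz; exists (g t); exact: Hg.
pose L z := \sum_(u <- l) (D u)%:~R * (z - a u)^-1.
pose phi z := L z + h' z * (h z)^-1.
have bda z u : bdry p0 p1 q0 q1 z -> u \in l -> z != a u.
  move=> [x [y [_ _ -> k]]] ul'; apply/eqP => /(pt_inj tau_gt0)[e1 e2].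
  have [hsx hsy] := inta u ul'; rewrite -e1 -e2 in hsx hsy.
  by case: k => E; move: hsx hsy; rewrite E ltxx ?andbF ?andFb.
have bdD z : bdry p0 p1 q0 q1 z -> D (prj z) = 0.
  move=> bz; apply: D0; apply/negP => zl.
  by have := repr _ _ zl (bdry_rect bz) erefl; apply/eqP; exact: bda.
have F_period z k1 k2 : F (z + (k1%:~R + k2%:~R * tau)) = F z.
  have Ef t : f (prj (t + (k1%:~R + k2%:~R * tau))) = f (prj t).
    by congr f; apply/to_torus_eq; exists k1, k2.
  rewrite /F /regular; congr (xget 0 _); apply/funext => m; apply/propext; split=> H e e0.
    have [d d0 Hd] := H e e0; exists d => // t tz td.
    rewrite -Ef; apply: Hd; rewrite ?(inj_eq (addIr _)) //.
    by rewrite opprD addrACA subrr addr0.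
  have [d d0 Hd] := H e e0; exists d => // t tz td.
  rewrite -[t](subrK (k1%:~R + k2%:~R * tau)) Ef; apply: Hd.
    by rewrite -(inj_eq (addIr (k1%:~R + k2%:~R * tau))) subrK.
  by rewrite addrAC -addrA -opprD.
have DF z : bdry p0 p1 q0 q1 z -> cder F z (phi z * F z) /\ F z != 0.
  move=> bz; have rz := bdry_rect bz.
  have [hF F0] : holomorphic_at F z /\ F z != 0.
    by apply: regular_hol; have := fD z; rewrite bdD.
  split=> //.
  have Pn t : (forall u, u \in l -> t != a u) -> P t != 0.
    move=> H; rewrite /P prodf_seq_neq0; apply/allP => u ul' /=.
    by rewrite subr_expz_neq0 // H.
  have DP := cder_prod_log D (fun u ul' => bda z u bz ul').
  rewrite -/(P) -/(L z) -/(P z) in DP.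
  have [D1 _] := Dh z rz; have DPh := cderM DP D1.
  have EF : \forall t \near z, F t = P t * h t.
    have [g [hg g0 Eg]] := fD z; rewrite bdD // in Eg.
    have Eg' : \forall t \near (z : C)^', f (prj t) = g t.
      by move/dnearC_P: Eg => [d d0 E]; apply/dnearC_P; exists d => // t tz td; rewrite E // expr0z mul1r.
    have /nearC_P[r1 r10 E1] := regular_near hg Eg'.
    have [g2 [hg2 g20 Eg2]] := ordh z rz.
    have Eg2' : \forall t \near (z : C)^', h0 t = g2 t.
      by move/dnearC_P: Eg2 => [d d0 E]; apply/dnearC_P; exists d => // t tz td; rewrite E // expr0z mul1r.
    have /nearC_P[r2 r20 E2] := regular_near hg2 Eg2'.
    have [r3 r30 E3] := (dnearC_P _ _).1 Eg'.
    have [r4 r40 E4] := (dnearC_P _ _).1 Eg2'.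
    have cP : ccont P z := cder_ccont DP.
    have /nearC_P[r5 r50 E5] := ccont_neq0 cP (Pn z (fun u ul' => bda z u bz ul')).
    have punct : \forall t \near (z : C)^', g t = P t * g2 t.
      apply/dnearC_P; exists (Num.min r3 (Num.min r4 r5)); first by rewrite !lt_min r30 r40.
      move=> t tz; rewrite !lt_min => /and3P[t3 t4 t5].
      by rewrite -E3 // -E4 // /h0 mulrC mulfVK // E5.
    have cPg : ccont (fun t => P t * g2 t) z := ccontM cP (hol_at_ccont hg2).
    have gz : g z = P z * g2 z := ccont_eq (hol_at_ccont hg) cPg punct.
    move/dnearC_P: punct => [r6 r60 E6].
    apply/nearC_P; exists (Num.min r1 (Num.min r2 r6)); first by rewrite !lt_min r10 r20.
    move=> t; rewrite !lt_min => /and3P[t1 t2 t6].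
    rewrite /F E1 // /h E2 //; have [->//|tz] := eqVneq t z.
    exact: E6.
  have Fz : F z = P z * h z by move/nearC_P: EF => [r r0 E]; apply: E; rewrite subrr nrm0.
  have hz0 : h z != 0 by case: (hh z rz).
  apply: cder_near (cder_eq _ DPh).
    by move/nearC_P: EF => [r r0 E]; apply/nearC_P; exists r => // t tr; rewrite E.
  by rewrite Fz /phi; field.
have F_per z k1 k2 : cder F (z + (k1%:~R + k2%:~R * tau)) (phi (z + (k1%:~R + k2%:~R * tau)) * F z) ->
    cder F z (phi z * F z) -> F z != 0 -> phi (z + (k1%:~R + k2%:~R * tau)) = phi z.
  move=> D1 D2 Fz; apply: (mulIf Fz); apply: cder_uniq D2.
  move=> e e0; have [d d0 Hd] := D1 e e0; exists d => // t td.
  have := Hd (t + (k1%:~R + k2%:~R * tau)); rewrite !F_period.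
  by rewrite (_ : _ - _ = t - z); [apply|ring].
have phix x : p0 <= x <= p1 -> phi (pt x q1) = phi (pt x q0).
  move=> hx; have E : pt x q1 = pt x q0 + (0%:~R + 1%:~R * tau).
    by rewrite -ptD_int addr0.
  have [D1 F1] := DF _ (bdry_h0 tau qq hx); have [D2 _] := DF _ (bdry_h1 tau qq hx).
  by rewrite E; apply: F_per => //; rewrite -E -(F_period (pt x q0) 0 1) -E.
have phiy y : q0 <= y <= q1 -> phi (pt p1 y) = phi (pt p0 y).
  move=> hy; have E : pt p1 y = pt p0 y + (1%:~R + 0%:~R * tau).
    by rewrite -ptD_int addr0.
  have [D1 F1] := DF _ (bdry_v0 tau pp hy); have [D2 _] := DF _ (bdry_v1 tau pp hy).
  by rewrite E; apply: F_per => //; rewrite -E -(F_period (pt p0 y) 1 0) -E.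
have Dq z : rect p0 p1 q0 q1 z -> exists k, cder (fun t => h' t * (h t)^-1) z k.
  move=> rz; have [D1 [k D2]] := Dh z rz; have [_ hz0] := hh z rz.
  by eexists; exact: cderM D2 (cderV hz0 D1).
have cinv u z : u \in l -> bdry p0 p1 q0 q1 z -> ccont (fun t => (t - a u)^-1) z.
  by move=> ul' bz; exact: cder_ccont (cder_inv_subr (bda z u bz ul')).
have cinvD u z : u \in l -> bdry p0 p1 q0 q1 z -> ccont (fun t => (D u)%:~R * (t - a u)^-1) z.
  by move=> ul' bz; exact: ccontM (cder_ccont (cder_cst _ _)) (cinv u z ul' bz).
have Jinv u : u \in l -> J (fun t => (t - a u)^-1) p0 p1 q0 q1 = twopii R.
  by move=> ul'; have [h1 h2] := inta u ul'; exact: J_winding.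
have [cL JL] := @J_sum _ l (fun u t => (D u)%:~R * (t - a u)^-1) _ _ _ _ pp qq (fun u ul' z => cinvD u z ul').
have cq z : bdry p0 p1 q0 q1 z -> ccont (fun t => h' t * (h t)^-1) z.
  by move=> /bdry_rect/Dq[k]; exact: cder_ccont.
have cphi z : bdry p0 p1 q0 q1 z -> ccont phi z.
  move=> bz e e0; have e2 : 0 < e / 2 by rewrite divr_gt0.
  have [d d0 Hd] := cL z bz _ e2; have [d' d0' Hd'] := cq z bz _ e2.
  exists (Num.min d d'); first by rewrite lt_min d0.
  move=> t; rewrite lt_min => /andP[/Hd h1 /Hd' h2].
  by rewrite /phi opprD addrACA; apply: le_lt_trans (le_nrmD _ _) _; lra.
have Jphi : J phi p0 p1 q0 q1 = (\sum_(u <- l) D u)%:~R * twopii R.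
  rewrite (JD tau_gt0 pp qq cL cq) (goursat tau_gt0 pp qq Dq) addr0 JL.
  rewrite rmorph_sum mulr_suml big_seq [RHS]big_seq; apply: eq_bigr => u ul'.
  by rewrite (JZ tau_gt0 pp qq _ (fun z bz => cinv u z ul' bz)) Jinv.
have Jzphi : J (fun z => z * phi z) p0 p1 q0 q1 = (\sum_(u <- l) (D u)%:~R * a u) * twopii R.
  have cau u z : u \in l -> bdry p0 p1 q0 q1 z ->
      ccont (fun t => (D u)%:~R * a u * (t - a u)^-1) z.
    by move=> ul' bz; exact: ccontM (cder_ccont (cder_cst _ _)) (cinv u z ul' bz).
  have [cM JM] := @J_sum _ l (fun u t => (D u)%:~R * a u * (t - a u)^-1) _ _ _ _ pp qq (fun u ul' z => cau u z ul').
  (* Since z / (z - a u) = 1 + a u / (z - a u), this is the part of z phi without poles. *)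
  pose G z := (\sum_(u <- l) D u)%:~R + z * (h' z * (h z)^-1).
  have DG z : rect p0 p1 q0 q1 z -> exists k, cder G z k.
    move=> /Dq[k K]; eexists; exact: cderD (cder_cst _ _) (cderM (cder_id _) K).
  have cG z : bdry p0 p1 q0 q1 z -> ccont G z.
    by move=> /bdry_rect/DG[k]; exact: cder_ccont.
  transitivity (J (fun z => (\sum_(u <- l) (D u)%:~R * a u * (z - a u)^-1) + G z) p0 p1 q0 q1).
    apply: (eq_J tau_gt0 pp qq).
      by move=> z bz; exact: ccontM (cder_ccont (cder_id _)) (cphi z bz).
    move=> z bz; rewrite /phi /G mulrDr addrA; congr (_ + _).
    rewrite rmorph_sum /L mulr_sumr -big_split /= big_seq [RHS]big_seq; apply: eq_bigr => u ul'.
    have za : z - a u != 0 by rewrite subr_eq0 bda.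
    by field.
  rewrite (JD tau_gt0 pp qq cM cG) (goursat tau_gt0 pp qq DG) addr0 JM.
  rewrite mulr_suml big_seq [RHS]big_seq; apply: eq_bigr => u ul'.
  by rewrite (JZ tau_gt0 pp qq _ (fun z bz => cinv u z ul' bz)) Jinv.
set Hh := hor tau phi q0 p0 p1; set Vv := ver tau phi p0 q0 q1.
have rc_h0 := bc_h0 qq cphi; have rc_h1 := bc_h1 qq cphi.
have rc_v0 := bc_v0 tau_gt0 pp cphi; have rc_v1 := bc_v1 tau_gt0 pp cphi.
have hor1 : hor tau phi q1 p0 p1 = Hh by exact: eq_cint pp rc_h1 phix.
have ver1 : ver tau phi p1 q0 q1 = Vv.
  by rewrite /Vv /ver (eq_cint qq rc_v1 phiy).
have degree0 : \sum_(u <- l) D u = 0.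
  have : J phi p0 p1 q0 q1 = 0 by rewrite /J hor1 ver1 -/Hh -/Vv; ring.
  by rewrite Jphi => /eqP; rewrite mulf_eq0 (negPf (twopii_neq0 R)) orbF intr_eq0 => /eqP.
have czphi z : bdry p0 p1 q0 q1 z -> ccont (fun z => z * phi z) z.
  by move=> bz; exact: ccontM (cder_ccont (cder_id _)) (cphi z bz).
(* Opposite edges differ by a period and phi is periodic, so only the periods 1 and tau times edge
   integrals of phi survive. *)
have Jz : J (fun z => z * phi z) p0 p1 q0 q1 = Vv - tau * Hh.
  have e1 : hor tau (fun z => z * phi z) q1 p0 p1 = hor tau (fun z => z * phi z) q0 p0 p1 + tau * Hh.
    rewrite /Hh /hor -(cintZ tau pp rc_h0).
    rewrite -(cintD pp (bc_h0 qq czphi) (bc_h0 qq (fun z bz => ccontM (cder_ccont (cder_cst tau z)) (cphi z bz)))).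
    apply: eq_cint pp (bc_h1 qq czphi) _ => x hx.
    by rewrite (phix x hx) {1}/pt /q1 toCD toC1 /pt; ring.
  have e2 : ver tau (fun z => z * phi z) p1 q0 q1 = ver tau (fun z => z * phi z) p0 q0 q1 + Vv.
    rewrite /Vv /ver -mulrDr; congr (_ * _).
    rewrite -(cintD qq (bc_v0 tau_gt0 pp czphi) rc_v0).
    apply: eq_cint qq (bc_v1 tau_gt0 pp czphi) _ => y hy.
    by rewrite (phiy y hy) {1}/pt /p1 toCD toC1 /pt; ring.
  by rewrite /J e1 e2; ring.
have hp00 : p0 <= p0 <= p1 by rewrite lexx pp.
have hq00 : q0 <= q0 <= q1 by rewrite lexx qq.
(* F takes the same value at both ends of a period edge, so the exponential of the integral of F' /
   F along it is 1. *)
have [k1 K1] : exists k : int, Hh = k%:~R * twopii R.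
  have [H PH] := prim_exists pp rc_h0.
  have HE : Hh = H p1 - H p0 by exact: cintE.
  have PF : prim p0 p1 (fun s => phi (pt s q0) * F (pt s q0)) (fun s => F (pt s q0)).
    apply: (prim_hor (f := fun z => phi z * F z)) => x hx.
    by case: (DF _ (bdry_h0 tau qq hx)).
  have := prim_exp pp PH PF (s := p1); rewrite lexx pp => /(_ isT).
  have -> : pt p1 q0 = pt p0 q0 + (1%:~R + 0%:~R * tau) by rewrite -ptD_int addr0.
  rewrite F_period -HE -[LHS]mulr1 => /mulfI.
  have F0 : F (pt p0 q0) != 0 by case: (DF _ (bdry_h0 tau qq hp00)).
  move=> /(_ F0)/esym/cexp_ker[k Hk]; exists k; rewrite Hk.
  by apply: complex_ext; rewrite !(cReM, cImM) /= -?toC_int /= -?[0]/(0:R); ring.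
have [k2 K2] : exists k : int, Vv = k%:~R * twopii R.
  have [H PH0] := prim_exists qq rc_v0; have PH := primZ tau PH0.
  have HE : Vv = tau * H q1 - tau * H q0 by rewrite /Vv /ver (cintE qq PH0) mulrBr.
  have PF : prim q0 q1 (fun s => tau * phi (pt p0 s) * F (pt p0 s)) (fun s => F (pt p0 s)).
    have : prim q0 q1 (fun s => tau * (phi (pt p0 s) * F (pt p0 s))) (fun s => F (pt p0 s)).
      apply: (@prim_ver R tau (fun z => phi z * F z) F) => x hx.
      by case: (DF _ (bdry_v0 tau pp hx)).
    by apply: eq_prim => s _; rewrite mulrA.
  have := prim_exp qq PH PF (s := q1); rewrite lexx qq => /(_ isT).
  have -> : pt p0 q1 = pt p0 q0 + (0%:~R + 1%:~R * tau) by rewrite -ptD_int addr0.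
  rewrite F_period -HE -[LHS]mulr1 => /mulfI.
  have F0 : F (pt p0 q0) != 0 by case: (DF _ (bdry_v0 tau pp hq00)).
  move=> /(_ F0)/esym/cexp_ker[k Hk]; exists k; rewrite Hk.
  by apply: complex_ext; rewrite !(cReM, cImM) /= -?toC_int /= -?[0]/(0:R); ring.
have asum : \sum_(u <- l) a u *~ D u = k2%:~R + (- k1)%:~R * tau.
  apply: (mulIf (twopii_neq0 R)).
  rewrite (eq_bigr (fun u => (D u)%:~R * a u)); last by move=> u _; rewrite mulrzl.
  by rewrite -Jzphi Jz K1 K2 rmorphN /=; ring.
exists l; split; [exact: ul|exact: D0|exact: degree0|].
rewrite (eq_bigr (fun u => prj (a u *~ D u))); last by move=> u _; rewrite raddfMz /= prja.
by rewrite -raddf_sum; apply/to_torus_eq0; exists k2, (- k1).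
Qed.

End Divisor.
End Abel.

(** * Multiplicities of polynomials *)

(** In a domain the lowest coefficients multiply: the coefficient of degree k + i of the product is
    P_k Q_i plus terms that vanish by induction. *)
Lemma poly_low_div (A : idomainType) (P Q : {poly A}) (k c : nat) :
  (forall i, (i < k)%N -> P`_i = 0) -> P`_k != 0 ->
  (forall i, (i < c)%N -> (P * Q)`_i = 0) ->
  forall i, (i < c - k)%N -> Q`_i = 0.
Proof.
move=> hP Pk hPQ i; elim: i {-2}i (leqnn i) => [|j IH] i ij ick; last first.
  have [ij'|ji] := leqP i j; first exact: IH.
  have {ij ji} Ei : i = j.+1 by lia.
  have ki : (k < (k + i).+1)%N by lia.
  have H : (P * Q)`_(k + i) = 0 by apply: hPQ; lia.
  move: H; rewrite coefM (bigD1 (Ordinal ki)) //= addKn big1 ?addr0 => [|l].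
    by move/eqP; rewrite mulf_eq0 (negPf Pk) => /eqP.
  rewrite -val_eqE /= => lk.
  have [lt|ge] := ltnP l k; first by rewrite (hP _ lt) mul0r.
  have l1 : (k + i - l <= j)%N by lia.
  have l2 : (k + i - l < c - k)%N by lia.
  by rewrite (IH _ l1 l2) mulr0.
move: ij; rewrite leqn0 => /eqP i0; subst i.
have kc : (k < c)%N by lia.
have := hPQ k kc; rewrite coefM (bigD1 ord_max) //= subnn big1 ?addr0 => [|l].
  by move/eqP; rewrite mulf_eq0 (negPf Pk) => /eqP.
rewrite -val_eqE /= => lm.
have lk : (l < k)%N by have := ltn_ord l; lia.
by rewrite (hP _ lk) mul0r.
Qed.

(** Over a domain the lowest and the highest degrees both add under multiplication, so they coincide
    for each factor of a monomial. Through [grade], this makes every factor of a form a form. *)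
Lemma poly_monomial_factor (A : idomainType) (P Q : {poly A}) (d : nat) :
  P * Q != 0 -> (forall i, i != d -> (P * Q)`_i = 0) ->
  exists e, forall i, i != e -> P`_i = 0.
Proof.
move=> PQ0 H; have [P0 Q0] : P != 0 /\ Q != 0.
  by apply/andP; move: PQ0; rewrite mulf_eq0 negb_or.
have ex : exists i, P`_i != 0 by exists (size P).-1; rewrite -lead_coefE lead_coef_eq0.
case: (ex_minnP ex) => e Pe mine; exists e.
have Plow i : (i < e)%N -> P`_i = 0.
  by move=> ie; apply/eqP/negPn/negP => /mine; rewrite leqNgt ie.
have Qlow : forall i, (i < d - e)%N -> Q`_i = 0.
  by apply: (poly_low_div Plow Pe) => i id; apply: H; rewrite neq_ltn id.
have sPQ : (size P + size Q = d.+2)%N.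
  have := size_mul P0 Q0; have sP := size_poly_gt0 P; have sQ := size_poly_gt0 Q.
  rewrite P0 in sP; rewrite Q0 in sQ.
  have -> : size (P * Q) = d.+1; last by lia.
  apply: anti_leq; rewrite [X in _ && X]ltnNge; apply/andP; split.
    apply/leq_sizeP => i id; apply: H; lia.
  apply/negP => le; move/eqP: PQ0; apply; apply/polyP => i; rewrite coef0.
  by have [->|/H //] := eqVneq i d; exact: nth_default.
move=> i ie; have [lt|ge] := ltnP i e; first exact: Plow.
apply: nth_default; have sQ : (d - e <= (size Q).-1)%N.
  rewrite leqNgt; apply/negP => /Qlow /eqP; rewrite -lead_coefE lead_coef_eq0.
  by rewrite (negPf Q0).
have eP : (e < size P)%N by rewrite ltnNge; apply: contraNN Pe => /(nth_default 0) ->.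
have := size_poly_gt0 Q; rewrite Q0; move: ie; rewrite neq_ltn ltnNge ge /=.
move: (size P) (size Q) sPQ sQ eP => p q; lia.
Qed.

Section Multiplicity.
Variables (K : fieldType) (n : nat).
Local Notation poly := (mpoly n.+1 K).
Local Notation mon := (multinom n.+1).
Local Notation X i := (@var K n i).
Implicit Types (F G H : poly) (Psi Phi : 'I_n.+1 -> poly) (p : 'cV[K]_n.+1) (m : mon) (c : K).

Definition mono m : poly := mpolyX K m.
Definition cst c : poly := mpolyC n.+1 c.

Lemma mpoly_sum F : F = \sum_(m <- msupp F) mcoeff m F *: mono m.
Proof. exact: mpolyE. Qed.

Lemma mono_prod m : mono m = \prod_(i < n.+1) X i ^+ m i.
Proof. exact: mpolyXE_id. Qed.

Lemma mcoeff_mono m m' : mcoeff m' (mono m) = (m == m')%:R.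
Proof. exact: mcoeffX. Qed.

Definition subst Psi F : poly := comp_mpoly [tuple Psi i | i < n.+1] F.

HB.instance Definition _ Psi := GRing.isAdditive.Build poly poly (subst Psi)
  (comp_mpoly_is_additive [tuple Psi i | i < n.+1]).
HB.instance Definition _ Psi := GRing.isScalable.Build K poly poly _ (subst Psi)
  (comp_mpoly_is_linear [tuple Psi i | i < n.+1]).
HB.instance Definition _ Psi := GRing.isMultiplicative.Build poly poly (subst Psi)
  (comp_mpoly_is_multiplicative [tuple Psi i | i < n.+1]).

Lemma subst_mono Psi m : subst Psi (mono m) = \prod_(i < n.+1) Psi i ^+ m i.
Proof.
rewrite /subst comp_mpolyX; apply: eq_bigr => i _; by rewrite tnth_mktuple.
Qed.

Lemma substE Psi F : subst Psi F = \sum_(m <- msupp F) mcoeff m F *: \prod_(i < n.+1) Psi i ^+ m i.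
Proof.
rewrite [in LHS](mpoly_sum F) linear_sum; apply: eq_bigr => m _.
by rewrite linearZ /= subst_mono.
Qed.

Lemma subst_var Psi i : subst Psi (X i) = Psi i.
Proof. by rewrite /subst comp_mpolyXU -tnth_nth tnth_mktuple. Qed.

Lemma subst_cst Psi c : subst Psi (cst c) = cst c.
Proof. exact: comp_mpolyC. Qed.

Lemma subst_id F : subst (@var K n) F = F.
Proof. exact: comp_mpoly_id. Qed.

Lemma eq_subst Psi Phi F : Psi =1 Phi -> subst Psi F = subst Phi F.
Proof. by move=> E; have -> : Psi = Phi by apply/funext. Qed.

Lemma subst_comp Psi Phi F : subst Psi (subst Phi F) = subst (fun i => subst Psi (Phi i)) F.
Proof.
rewrite [subst Phi F]substE linear_sum [RHS]substE; apply: eq_bigr => m _.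
rewrite linearZ /=; rewrite rmorph_prod; congr (_ *: _); apply: eq_bigr => i _; exact: rmorphXn.
Qed.

Lemma subst_prodX Psi (e : 'I_n.+1 -> nat) :
  subst Psi (\prod_k X k ^+ e k) = \prod_k Psi k ^+ e k.
Proof. by rewrite rmorph_prod; apply: eq_bigr => k _; rewrite rmorphXn /= subst_var. Qed.

Lemma subst_prod_var Psi (P : pred 'I_n.+1) :
  subst Psi (\prod_(k < n.+1 | P k) X k) = \prod_(k < n.+1 | P k) Psi k.
Proof. by rewrite rmorph_prod; apply: eq_bigr => k _; rewrite /= subst_var. Qed.

Lemma substM Psi F G : subst Psi (F * G) = subst Psi F * subst Psi G.
Proof. exact: rmorphM. Qed.

Lemma subst_relation Psi Phi F G (e1 e2 : 'I_n.+1 -> nat) :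
  G * \prod_k X k ^+ e1 k = subst Phi F * \prod_k X k ^+ e2 k ->
  subst Psi G * \prod_k Psi k ^+ e1 k
  = subst (fun k => subst Psi (Phi k)) F * \prod_k Psi k ^+ e2 k.
Proof. by move/(congr1 (subst Psi)); rewrite !substM subst_comp !subst_prodX. Qed.

Lemma meval_subst v Psi F : meval v (subst Psi F) = meval (fun i => meval v (Psi i)) F.
Proof.
rewrite /subst comp_mpoly_meval; apply: meval_eq => i; by rewrite tnth_mktuple.
Qed.

Lemma meval_var v i : meval v (X i) = v i.
Proof. exact: mevalXU. Qed.

Lemma meval_sum v F : meval v F = \sum_(m <- msupp F) mcoeff m F * \prod_i v i ^+ m i.
Proof. exact: mevalE. Qed.

Definition lo (k : nat) G : Prop := forall m, (mdeg m < k)%N -> mcoeff m G = 0.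

Lemma lo0 G : lo 0 G. Proof. by []. Qed.

Lemma lo_zero k : lo k 0.
Proof. by move=> m _; rewrite mcoeff0. Qed.

Lemma lo_le k l G : (k <= l)%N -> lo l G -> lo k G.
Proof. by move=> kl H m mk; apply: H; exact: leq_trans mk kl. Qed.

Lemma loD k F G : lo k F -> lo k G -> lo k (F + G).
Proof. by move=> hF hG m mk; rewrite mcoeffD hF // hG // addr0. Qed.

Lemma loZ k c F : lo k F -> lo k (c *: F).
Proof. by move=> hF m mk; rewrite mcoeffZ hF // mulr0. Qed.

Lemma loM k l F G : lo k F -> lo l G -> lo (k + l) (F * G).
Proof.
move=> hF hG m mkl; rewrite mcoeffM big1 // => -[a b] /= /eqP E.
have [ak|ak] := ltnP (mdeg a) k; first by rewrite hF // mul0r.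
rewrite hG ?mulr0 //; have := congr1 (@mdeg _) E; rewrite mdegD; lia.
Qed.

Lemma lo_prod (I : Type) (r : seq I) (P : pred I) (d : I -> nat) (F : I -> poly) :
  (forall i, P i -> lo (d i) (F i)) -> lo (\sum_(i <- r | P i) d i) (\prod_(i <- r | P i) F i).
Proof.
move=> H; elim: r => [|i r IH]; first by rewrite !big_nil; exact: lo0.
by rewrite !big_cons; case: ifP => Pi //; apply: loM => //; exact: H.
Qed.

Lemma loX e F : lo 1 F -> lo e (F ^+ e).
Proof.
move=> H; elim: e => [|e IH]; first exact: lo0.
by rewrite -add1n exprS; exact: loM.
Qed.

Lemma lo_subst k Psi G : (forall i, lo 1 (Psi i)) -> lo k G -> lo k (subst Psi G).
Proof.
move=> H hG; rewrite substE; elim: (msupp G) => [|m r IH].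
  by rewrite big_nil; exact: lo_zero.
rewrite big_cons; apply: loD => //.
have [mk|mk] := ltnP (mdeg m) k; first by rewrite hG // scale0r; exact: lo_zero.
apply/loZ/(lo_le mk); rewrite mdegE; apply: lo_prod => i _.
exact: loX.
Qed.

(* The grading by total degree as powers of an auxiliary variable. *)
Definition grade (G : poly) : {poly poly} :=
  mmap (fun c => (cst c)%:P) (fun i => (X i)%:P * 'X) G.

Lemma grade_mono m : mmap1 (fun i => (X i)%:P * 'X) m = (mono m)%:P * 'X^(mdeg m).
Proof.
rewrite /mmap1 mono_prod rmorph_prod mdegE /=.
under eq_bigr do rewrite exprMn.
rewrite big_split /=; congr (_ * _).
  by apply: eq_bigr => i _; rewrite rmorphXn.
by rewrite (big_morph _ (exprD 'X) (expr0 'X)).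
Qed.

Lemma gradeE G k m : mcoeff m (grade G)`_k = mcoeff m G *+ (mdeg m == k).
Proof.
rewrite /grade /mmap coef_sum [in RHS](mpoly_sum G) !raddf_sum /= -sumrMnl.
apply: eq_bigr => m' _; rewrite grade_mono mulrA -polyCM coefCM coefXn /=.
rewrite mulr_natr mcoeffMn mcoeffCM mcoeffZ mcoeff_mono [k == _]eq_sym.
by have [->|_] := eqVneq m' m; rewrite ?mulr0 ?mul0rn.
Qed.

Lemma grade_mul F G : grade (F * G) = grade F * grade G.
Proof.
exact: (rmorphM (mmap ((@polyC poly) \o (@mpolyC n.+1 K)) (fun i => (X i)%:P * 'X))).
Qed.

Lemma lo_gradeP k G : lo k G <-> forall i, (i < k)%N -> (grade G)`_i = 0.
Proof.
split=> H.
  move=> i ik; apply/mpolyP => m; rewrite gradeE mcoeff0; case: eqP => [E|_]; last by rewrite mulr0n.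
  by rewrite H ?E // mulr0n mul0rn.
by move=> m mk; have := gradeE G (mdeg m) m; rewrite H // mcoeff0 eqxx mulr1n.
Qed.

Lemma lo_div k (c : nat) F G : lo k F -> ~ lo k.+1 F -> lo c (F * G) -> lo (c - k) G.
Proof.
move=> /lo_gradeP hF nF /lo_gradeP hFG; apply/lo_gradeP.
apply: (poly_low_div hF); last by move=> i ic; rewrite -grade_mul; exact: hFG.
apply/eqP => E; apply: nF; apply/lo_gradeP => i; rewrite ltnS leq_eqVlt.
by case/orP => [/eqP->//|]; exact: hF.
Qed.

Lemma lo_exists F : F != 0 -> exists k, lo k F /\ ~ lo k.+1 F.
Proof.
move=> F0; have [m mF] : exists m, mcoeff m F != 0.
  apply: contrapT => H; move/eqP: F0; apply; apply/mpolyP => m.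
  by rewrite mcoeff0; apply/eqP; apply/negPn/negP => h; apply: H; exists m.
have ex : exists k, ~~ `[< lo k F >].
  by exists (mdeg m).+1; apply/asboolPn => /(_ m (ltnSn _))/eqP; rewrite (negPf mF).
case: (ex_minnP ex) => [[|k]] /asboolPn nk mink; first by case: nk; exact: lo0.
exists k; split=> //; apply: contrapT => h.
by have := mink k (introN (asboolP _) h); rewrite ltnn.
Qed.

Definition shift p F : poly := subst (fun i => cst (p i 0) + X i) F.

HB.instance Definition _ p := GRing.LRMorphism.copy (shift p)
  (subst (fun i => cst (p i 0) + X i)).

Lemma mult_geE F p k : mult_ge F p k <-> lo k (shift p F).
Proof. by []. Qed.

Lemma mult_ge0 F p : mult_ge F p 0. Proof. by []. Qed.

Lemma mult_ge_le F p k l : (k <= l)%N -> mult_ge F p l -> mult_ge F p k.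
Proof. exact: lo_le. Qed.

Lemma mult_geM F G p k l : mult_ge F p k -> mult_ge G p l -> mult_ge (F * G) p (k + l).
Proof. by move=> /mult_geE hF /mult_geE hG; apply/mult_geE; rewrite rmorphM; exact: loM. Qed.

Lemma mult_ge_div F G p k (c : nat) : has_mult F p k -> mult_ge (F * G) p c -> mult_ge G p (c - k).
Proof.
move=> [/mult_geE h1 h2] /mult_geE; rewrite rmorphM => h3.
by apply/mult_geE; apply: lo_div h3.
Qed.

Lemma shiftK p F : shift (- p) (shift p F) = F.
Proof.
rewrite /shift subst_comp -[RHS]subst_id; apply: eq_subst => i.
rewrite rmorphD /= subst_cst subst_var addrA /cst -mpolyCD mxE subrr.
by rewrite mpolyC0 add0r.
Qed.

Lemma has_mult_exists F p : F != 0 -> exists k, has_mult F p k.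
Proof.
move=> F0; have : shift p F != 0.
  by apply: contra_neq F0 => E; rewrite -(shiftK p F) E rmorph0.
by move=> /lo_exists.
Qed.

Lemma mcoeff0_meval G : mcoeff (mnm0 : mon) G = meval (fun=> 0) G.
Proof.
rewrite [in LHS](mpoly_sum G) meval_sum raddf_sum; apply: eq_bigr => m _ /=.
rewrite mcoeffZ mcoeff_mono; congr (_ * _).
have [->|m0] := eqVneq m mnm0.
  by rewrite big1 // => i _; rewrite mnm0E expr0.
apply/esym/eqP; rewrite prodf_seq_eq0; apply/hasP.
have /existsP[i mi] : [exists i, m i != 0%N].
  apply: contraNT m0; rewrite negb_exists => /forallP H; apply/eqP/mnmP => i.
  by rewrite mnm0E; apply/eqP; rewrite -[_ == _]negbK H.
by exists i; rewrite ?mem_index_enum //= expr0n (negPf mi).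
Qed.

Lemma meval_shift v p F : meval v (shift p F) = meval (fun i => p i 0 + v i) F.
Proof.
rewrite /shift meval_subst; apply: meval_eq => i.
by rewrite mevalD meval_var /cst mevalC.
Qed.

Lemma mult_ge1 F p : mult_ge F p 1 <-> meval (fun i => p i 0) F = 0.
Proof.
have E : mcoeff (mnm0 : mon) (shift p F) = meval (fun i => p i 0) F.
  by rewrite mcoeff0_meval meval_shift; apply: meval_eq => i; rewrite addr0.
split=> [/mult_geE H|H]; first by rewrite -E H // mdeg0.
apply/mult_geE => m; rewrite ltnS leqn0 mdeg_eq0 => /eqP ->; by rewrite E.
Qed.

(** Once p and its image are moved to the origin, the substituted polynomials have no constant term
    and cannot lower the order. *)
Lemma mult_ge_subst F Psi p k : mult_ge F (\col_i meval (fun j => p j 0) (Psi i)) k ->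
  mult_ge (subst Psi F) p k.
Proof.
set q := \col_i _; move=> /mult_geE hF; apply/mult_geE.
pose Y i := shift p (Psi i) - cst (q i 0).
have E : shift p (subst Psi F) = subst Y (shift q F).
  rewrite /shift !subst_comp; apply: eq_subst => i.
  by rewrite [in RHS]rmorphD /= subst_cst subst_var /Y addrC subrK.
rewrite E; apply: lo_subst => // i m; rewrite ltnS leqn0 mdeg_eq0 => /eqP ->.
rewrite mcoeff0_meval /Y mevalB meval_shift /cst mevalC mxE.
by apply/eqP; rewrite subr_eq0; apply/eqP/meval_eq => j; rewrite addr0.
Qed.

Lemma homogP d F : homogeneous d F <-> forall m, mcoeff m F != 0 -> mdeg m = d.
Proof.
split=> [/dhomogP H m mF|H]; first by apply: H; rewrite mcoeff_msupp.
by apply/dhomogP => m; rewrite mcoeff_msupp; exact: H.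
Qed.

Lemma homogM d e F G : homogeneous d F -> homogeneous e G -> homogeneous (d + e) (F * G).
Proof. exact: dhomogM. Qed.

Lemma homogZ d c F : homogeneous d F -> homogeneous d (c *: F).
Proof. exact: dhomogZ. Qed.

Lemma homog0 d : homogeneous d (0 : poly).
Proof. exact: dhomog0. Qed.

Lemma homogD d F G : homogeneous d F -> homogeneous d G -> homogeneous d (F + G).
Proof. exact: dhomogD. Qed.

Lemma homog_sum d (I : Type) (r : seq I) (P : pred I) (F : I -> poly) :
  (forall i, P i -> homogeneous d (F i)) -> homogeneous d (\sum_(i <- r | P i) F i).
Proof. by move=> H; elim/big_rec: _ => [|i G Pi]; [exact: homog0|apply: homogD; exact: H]. Qed.

Lemma homog_var i : homogeneous 1 (X i).
Proof. by rewrite /homogeneous dhomogX; apply/eqP; exact: mdeg1. Qed.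

Lemma homogX d e F : homogeneous d F -> homogeneous (d * e) (F ^+ e).
Proof. exact: dhomogMn. Qed.

Lemma homog1 : homogeneous 0 (1 : poly).
Proof. exact: dhomog1. Qed.

Lemma homog_bigprod (I : Type) (r : seq I) (P : pred I) (d : I -> nat) (F : I -> poly) :
  (forall i, P i -> homogeneous (d i) (F i)) ->
  homogeneous (\sum_(i <- r | P i) d i) (\prod_(i <- r | P i) F i).
Proof.
move=> H; elim: r => [|i r IH]; first by rewrite !big_nil; exact: homog1.
by rewrite !big_cons; case: ifP => Pi //; apply: homogM => //; exact: H.
Qed.

Lemma homog_factor d F G : F * G != 0 -> homogeneous d (F * G) -> exists e, homogeneous e F.
Proof.
move=> FG0 /homogP hFG; have H i : i != d -> (grade F * grade G)`_i = 0.
  move=> id; rewrite -grade_mul; apply/mpolyP => m; rewrite gradeE mcoeff0.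
  case: eqP => [mi|_]; last by rewrite mulr0n.
  rewrite mulr1n; apply/eqP/negPn/negP => /hFG md.
  by move: id; rewrite -mi md eqxx.
have g0 : grade F * grade G != 0.
  apply/eqP => E; move/eqP: FG0; apply; apply/mpolyP => m.
  by have := gradeE (F * G) (mdeg m) m; rewrite grade_mul E coef0 !mcoeff0 eqxx mulr1n.
have [e He] := poly_monomial_factor g0 H; exists e; apply/homogP => m mF.
apply/eqP/negPn/negP => /He E; move/eqP: mF; apply.
by have := gradeE F (mdeg m) m; rewrite E mcoeff0 eqxx mulr1n.
Qed.

Lemma homog_subst d e F Psi : homogeneous e F -> (forall i, homogeneous d (Psi i)) ->
  homogeneous (d * e) (subst Psi F).
Proof.
move=> /homogP hF hP; rewrite substE big_seq; apply: homog_sum => m.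
rewrite mcoeff_msupp => /hF <-; apply: homogZ; rewrite mdegE big_distrr /=.
by apply: homog_bigprod => i _; exact: homogX.
Qed.

Lemma meval_scale d F c v : homogeneous d F -> meval (fun i => c * v i) F = c ^+ d * meval v F.
Proof.
move=> /homogP hF; rewrite !meval_sum big_distrr /= big_seq [RHS]big_seq.
apply: eq_bigr => m; rewrite mcoeff_msupp => /hF <-.
under eq_bigr do rewrite exprMn.
rewrite big_split /= mdegE (big_morph _ (exprD c) (expr0 c)); exact: mulrCA.
Qed.

Lemma subst_scale d F c : homogeneous d F -> subst (fun i => c *: X i) F = c ^+ d *: F.
Proof.
move=> /homogP hF; rewrite substE [in RHS](mpoly_sum F) scaler_sumr big_seq [RHS]big_seq.
apply: eq_bigr => m; rewrite mcoeff_msupp => /hF <-.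
under eq_bigr do rewrite exprZn.
rewrite scaler_prod -mono_prod mdegE (big_morph _ (exprD c) (expr0 c)).
by rewrite !scalerA mulrC.
Qed.

(** Substituting X / c moves p to c p and multiplies a form of degree d by a nonzero constant. *)
Lemma mult_ge_scale d F p c k : homogeneous d F -> c != 0 -> mult_ge F p k -> mult_ge F (c *: p) k.
Proof.
move=> hF c0 H; have : mult_ge (subst (fun i => c^-1 *: X i) F) (c *: p) k.
  apply: mult_ge_subst; rewrite (_ : \col_i _ = p) //; apply/matrixP => i j.
  by rewrite !mxE mevalZ meval_var mxE mulKf // ord1.
rewrite (subst_scale _ hF) => /mult_geE; rewrite linearZ /= => L.
apply/mult_geE; have -> : shift (c *: p) F = (c ^+ d) *: ((c^-1) ^+ d *: shift (c *: p) F).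
  by rewrite scalerA -exprMn mulfV // expr1n scale1r.
exact: loZ.
Qed.

(** Putting X_k = 1 turns each term of the form into one of degree d - m_k in the other variables,
    and no two monomials are merged because the total degree d restores the exponent of X_k. *)
Lemma mult_ge_vertex F d (k : 'I_n.+1) mu : homogeneous d F ->
  mult_ge F (delta_mx k 0) mu <-> forall m, mcoeff m F != 0 -> (m k + mu <= d)%N.
Proof.
move=> hF; have hF' := (homogP d F).1 hF.
have degk m : mdeg m = (m k + \sum_(i < n.+1 | i != k) m i)%N by rewrite mdegE (bigD1 k).
split=> [/mult_geE H m0 m0F|H].
  (* After the translation X_k stands for X_k - 1; setting it to 0 dehomogenises F without lowering
     its order at the origin. *)
  pose kill i := if i == k then 0 else X i.
  have E : subst kill (shift (delta_mx k 0) F) = subst (fun i => if i == k then 1 else X i) F.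
    rewrite /shift subst_comp; apply: eq_subst => i.
    rewrite rmorphD /= subst_cst subst_var /kill mxE andbT.
    case: eqP => _; first by rewrite /cst mpolyC1 addr0.
    by rewrite /cst mpolyC0 add0r.
  have L : lo mu (subst kill (shift (delta_mx k 0) F)).
    apply: lo_subst => // i; rewrite /kill; case: eqP => _; first exact: lo_zero.
    move=> m; rewrite ltnS leqn0 mdeg_eq0 => /eqP ->.
    by rewrite mcoeff0_meval meval_var.
  pose rm (m : mon) : mon := Multinom [tuple if i == k then 0%N else m i | i < n.+1].
  have rmE m : \prod_(i < n.+1) (if i == k then 1 else X i) ^+ m i = mono (rm m).
    rewrite mono_prod; apply: eq_bigr => i _; rewrite mnmE.
    by case: eqP => _ //; rewrite expr1n expr0.
  have drm m : mdeg (rm m) = (\sum_(i < n.+1 | i != k) m i)%N.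
    rewrite mdegE (bigD1 k) //= mnmE eqxx add0n; apply: eq_bigr => i ik.
    by rewrite mnmE (negPf ik).
  have C : mcoeff (rm m0) (subst (fun i => if i == k then 1 else X i) F) = mcoeff m0 F.
    rewrite substE raddf_sum /= (bigD1_seq m0) ?msupp_uniq ?mcoeff_msupp //=.
    rewrite rmE mcoeffZ mcoeff_mono eqxx mulr1 big_seq_cond big1 ?addr0 // => m.
    rewrite mcoeff_msupp => /andP[mF mm0]; rewrite rmE mcoeffZ mcoeff_mono.
    case: eqP => [e|]; last by rewrite mulr0.
    case/eqP: mm0; apply/mnmP => i.
    have [->|ik] := eqVneq i k; last first.
      by have := congr1 (fun x : mon => x i) e; rewrite !mnmE (negPf ik).
    by have := hF' m mF; have := hF' m0 m0F; rewrite !degk -!drm e; lia.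
  have : (mu <= mdeg (rm m0))%N.
    by rewrite leqNgt; apply/negP => lt; move/eqP: m0F; apply; rewrite -C -E; exact: L.
  by have := hF' m0 m0F; rewrite degk drm; lia.
apply/mult_geE; rewrite /shift substE; rewrite big_seq.
elim/big_rec: _ => [|m G mF]; first exact: lo_zero.
apply: loD; apply: loZ; move: mF; rewrite mcoeff_msupp => mF.
have le : (mu <= \sum_(i < n.+1 | i != k) m i)%N.
  by have := H m mF; have := hF' m mF; rewrite degk; lia.
apply: (lo_le le); rewrite [\prod_(i < n.+1) _](bigD1 k) //=; apply: (@loM 0%N (\sum_(i < n.+1 | i != k) m i)%N); first exact: lo0.
apply: lo_prod => i ik; apply: loX.
move=> m'; rewrite ltnS leqn0 mdeg_eq0 => /eqP ->.
by rewrite mcoeff0_meval mevalD meval_var /cst mevalC mxE (negPf ik) addr0.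
Qed.

End Multiplicity.

(** * Forms with prescribed multiplicities *)

(** Positive part. It lets a factor X^mu with mu of either sign be written with cleared
    denominators, as X^(posz mu) on one side and X^(posz (- mu)) on the other. *)
Definition posz (a : int) : nat := if a is Posz k then k else 0%N.

Lemma posz_sub a : (posz a)%:Z - (posz (- a))%:Z = a.
Proof. case: a => [[|k]|k] /=; lia. Qed.

(** * The reflections in coordinates *)

Section Classes.
Variables n m : nat.
Implicit Types (D : H2 m) (g : generator m).

Lemma cE_0 : cE m 0 ord0 = 1. Proof. by rewrite mxE eqxx. Qed.
Lemma cE_j j : cE m 0 (lift ord0 j) = 0. Proof. by rewrite mxE. Qed.
Lemma cEi_0 (j : 'I_m) : cEi j 0 ord0 = 0. Proof. by rewrite mxE. Qed.
Lemma cEi_j (i j : 'I_m) : cEi i 0 (lift ord0 j) = (j == i)%:R.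
Proof. by rewrite mxE eqxx /= (inj_eq lift_inj). Qed.

Lemma mulrz_mxE (D : H2 m) (k : int) i j : (D *~ k) i j = D i j * k.
Proof. by rewrite -scaler_int mxE intz mulrC. Qed.

Lemma mxB_E (D D' : H2 m) i j : (D - D') i j = D i j - D' i j.
Proof. by rewrite mxE [X in _ + X]mxE. Qed.

Lemma H2_eq D D' : D 0 ord0 = D' 0 ord0 ->
  (forall j, D 0 (lift ord0 j) = D' 0 (lift ord0 j)) -> D = D'.
Proof.
move=> e0 ej; apply/matrixP => i j; rewrite ord1.
by case: (unliftP ord0 j) => [k ->|->].
Qed.

Lemma class_0 (a : int) (b : 'I_m -> int) :
  (cE m *~ a + \sum_j cEi j *~ b j) 0 ord0 = a.
Proof.
rewrite mxE mulrz_mxE cE_0 mul1r summxE big1 ?addr0 // => j _.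
by rewrite mulrz_mxE cEi_0 mul0r.
Qed.

Lemma class_j (a : int) (b : 'I_m -> int) i :
  (cE m *~ a + \sum_j cEi j *~ b j) 0 (lift ord0 i) = b i.
Proof.
rewrite mxE mulrz_mxE cE_j mul0r add0r summxE (bigD1 i) //= mulrz_mxE cEi_j eqxx.
rewrite mul1r big1 ?addr0 // => j ji.
by rewrite mulrz_mxE cEi_j eq_sym (negPf ji) mul0r.
Qed.

Lemma coroot_exchange D (i j : 'I_m) (e : j == i.+1 :> nat) :
  pairing D (coroot n (Exchange e)) = D 0 (lift ord0 j) - D 0 (lift ord0 i).
Proof.
rewrite /pairing /coroot mxB_E ![cei _ 0 ord0]cEi_0 subrr mulr0 sub0r.
have E (l : 'I_m) : (cei i - cei j : 'rV[int]_m.+1) (0 : 'I_1) (lift ord0 l) = (l == i)%:R - (l == j)%:R.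
  by rewrite mxB_E ![cei _ 0 (lift _ _)]cEi_j.
under eq_bigr do rewrite E mulrBr.
rewrite sumrB opprB (bigD1 j) //= eqxx mulr1 big1 => [|l lj]; last by rewrite (negPf lj) mulr0.
rewrite (bigD1 i) //= eqxx mulr1 big1 => [|l lj]; last by rewrite (negPf lj) mulr0.
by rewrite !addr0.
Qed.

Lemma reflection_exchange_0 D (i j : 'I_m) (e : j == i.+1 :> nat) :
  reflection n (Exchange e) D 0 ord0 = D 0 ord0.
Proof.
by rewrite /reflection mxE mulrz_mxE /Defs.root mxB_E !cEi_0 subrr mul0r addr0.
Qed.

Lemma reflection_exchange_j D (i j : 'I_m) (e : j == i.+1 :> nat) l :
  reflection n (Exchange e) D 0 (lift ord0 l) = D 0 (lift ord0 (tperm i j l)).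
Proof.
have ij : i != j by rewrite -val_eqE /= (eqP e); lia.
rewrite /reflection mxE mulrz_mxE /Defs.root mxB_E !cEi_j coroot_exchange.
case: tpermP => [->|->|/eqP li /eqP lj].
- by rewrite eqxx (negPf ij) subr0 mul1r addrC subrK.
- by rewrite eqxx eq_sym (negPf ij) sub0r mulN1r opprB addrC subrK.
- by rewrite (negPf li) (negPf lj) subrr mul0r addr0.
Qed.

(** The pairing with the Cremona coroot, see [coroot_cremona]: for forms of degree d it is (n - 1) d
    minus the sum of the multiplicities at the first n + 1 points. *)
Definition cremona_shift D : int :=
  D 0 ord0 * (n%:Z - 1) + \sum_(j < m | (j < n.+1)%N) D 0 (lift ord0 j).

Lemma sum_cEi_j (P : pred 'I_m) l : (\sum_(j < m | P j) cEi j) 0 (lift ord0 l) = (P l)%:R.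
Proof.
rewrite summxE; case: (boolP (P l)) => Pl.
  rewrite (bigD1 l) //= cEi_j eqxx big1 ?addr0 // => j /andP[_ jl].
  by rewrite cEi_j eq_sym (negPf jl).
rewrite big1 // => j Pj; rewrite cEi_j; case: eqP => // lj.
by move: Pl; rewrite lj Pj.
Qed.

Lemma sum_cEi_0 (P : pred 'I_m) : (\sum_(j < m | P j) cEi j) 0 ord0 = 0.
Proof. by rewrite summxE big1 // => j _; rewrite cEi_0. Qed.

Lemma coroot_cremona D : pairing D (coroot n Cremona) = cremona_shift D.
Proof.
rewrite /pairing /cremona_shift; set d := coroot n Cremona.
have d0 : d (0 : 'I_1) ord0 = n%:Z - 1.
  rewrite /d mxB_E mulrz_mxE; have -> : ce m = cE m by [].
  by rewrite cE_0 mul1r [X in _ - X]sum_cEi_0 subr0.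
have dj j : d (0 : 'I_1) (lift ord0 j) = - (j < n.+1)%N%:R.
  rewrite /d mxB_E mulrz_mxE; have -> : ce m = cE m by [].
  by rewrite cE_j mul0r [X in _ - X]sum_cEi_j sub0r.
rewrite d0; congr (_ + _); rewrite -sumrN [RHS]big_mkcond; apply: eq_bigr => j _.
by rewrite dj; case: ifP => _; rewrite ?oppr0 ?mulr0 ?oppr0 // mulrN1 opprK.
Qed.

Lemma reflection_cremona_0 D :
  reflection n Cremona D 0 ord0 = D 0 ord0 + cremona_shift D.
Proof.
rewrite /reflection mxE mulrz_mxE /Defs.root mxB_E cE_0 sum_cEi_0 subr0.
by rewrite mul1r coroot_cremona.
Qed.

Lemma reflection_cremona_j D l : reflection n Cremona D 0 (lift ord0 l) =
  D 0 (lift ord0 l) - (if (l < n.+1)%N then cremona_shift D else 0).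
Proof.
rewrite /reflection mxE mulrz_mxE /Defs.root mxB_E cE_j sum_cEi_j sub0r.
by rewrite coroot_cremona mulNr; case: ifP => _; rewrite ?mul1r ?mul0r.
Qed.

Lemma reflections_cat s1 s2 D :
  reflections n (s1 ++ s2) D = reflections n s1 (reflections n s2 D).
Proof. exact: foldr_cat. Qed.

Lemma reflections_rev_cons g w D :
  reflections n (rev (g :: w)) D = reflections n (rev w) (reflection n g D).
Proof. by rewrite rev_cons /reflections foldr_rcons. Qed.

(** The class of the strict transform of a hyperplane passing, among the P_j, through those with j
    in J only. *)
Definition class_minus (J : {set 'I_m}) : H2 m := cE m - \sum_(j < m | j \in J) cEi j.

Lemma class_minus_0 J : class_minus J 0 ord0 = 1.
Proof. by rewrite mxB_E cE_0 sum_cEi_0 subr0. Qed.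

Lemma class_minus_j J l : class_minus J 0 (lift ord0 l) = - (l \in J)%:R.
Proof. by rewrite mxB_E cE_j sum_cEi_j sub0r. Qed.

Lemma card_ord_lt N : (N <= m)%N -> #|[set k : 'I_m | (k < N)%N]| = N.
Proof.
move=> Nm; rewrite -sum1_card; under eq_bigl do rewrite inE.
by rewrite -(big_ord_widen m (fun=> 1%N) Nm) sum1_card card_ord.
Qed.

Lemma down_closed_initial (J : {set 'I_m}) : (n.+1 <= m)%N -> #|J| = n.+1 ->
  (forall i j : 'I_m, j == i.+1 :> nat -> j \in J -> i \in J) ->
  J = [set k : 'I_m | (k < n.+1)%N].
Proof.
move=> nm cJ H; apply/eqP; rewrite eqEcard cJ card_ord_lt // leqnn andbT.
have below k : forall j i : 'I_m, j \in J -> (j = i + k :> nat)%N -> i \in J.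
  elim: k => [|k IH] j i jJ E.
    by rewrite (_ : i = j) //; apply/val_inj; rewrite /= E addn0.
  have jm := ltn_ord j; have j'm : (j.-1 < m)%N by lia.
  by apply: (IH (Ordinal j'm)); [apply: (H _ j) => //=; lia|rewrite /=; lia].
apply/fintype.subsetP => j jJ; rewrite inE -cJ.
have jm := ltn_ord j; rewrite -(card_ord_lt jm); apply/subset_leq_card/fintype.subsetP => i.
by rewrite inE ltnS => ij; apply: (below (j - i)%N j) => //; lia.
Qed.

(* An (n+1)-subset which is not {0, ..., n} becomes smaller by an adjacent
   transposition. *)
Lemma class_minus_orbit (J : {set 'I_m}) : (n.+1 <= m)%N -> #|J| = n.+1 ->
  exists s, class_minus J = reflections n s (Defs.root n Cremona).
Proof.
move=> nm; move: (ltnSn (\sum_(j in J) j)%N); move: {2}(_.+1) => N.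
elim: N J => // N IH J leN cJ.
have [[i [j [e iJ jJ]]]|H] := pselect (exists i j : 'I_m,
    [/\ j == i.+1 :> nat, i \notin J & j \in J]).
  have ij : i != j by rewrite -val_eqE /= (eqP e); lia.
  pose J' := i |: (J :\ j).
  have iJ' : i \notin J :\ j by rewrite !inE (negPf iJ) andbF.
  have cJ' : #|J'| = n.+1 by rewrite cardsU1 iJ' -cJ (cardsD1 j J) jJ.
  have sJ' : (\sum_(k in J') k < N)%N.
    rewrite big_setU1 //=; move: leN; by rewrite (big_setD1 j) //= (eqP e) addSn ltnS.
  have [s Es] := IH J' sJ' cJ'.
  exists (Exchange e :: s); rewrite /reflections /= -/(reflections _ _ _) -Es.
  apply: H2_eq => [|l]; first by rewrite reflection_exchange_0 !class_minus_0.
  rewrite reflection_exchange_j !class_minus_j; congr (- (_%:R)); congr (nat_of_bool _).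
  case: tpermP => [->|->|/eqP li /eqP lj]; rewrite !inE.
  - by rewrite eqxx /= orbF (negPf iJ) eq_sym (negPf ij).
  - by rewrite eqxx jJ.
  - by rewrite (negPf li) lj.
exists [::]; rewrite /reflections /= /class_minus /Defs.root; congr (_ - _).
have -> : J = [set k : 'I_m | (k < n.+1)%N].
  apply: down_closed_initial => // i j e jJ.
  by apply/negPn/negP => iJ; apply: H; exists i, j.
by apply: eq_bigl => j; rewrite inE.
Qed.

End Classes.

(** * Pull-back of forms by the generators *)

Section Sections.
Variables (R : realType) (n m : nat) (hm : (n.+2 <= m)%N).
Local Notation C := (complexes R).
Local Notation poly := (mpoly n.+1 C).
Local Notation mon := (multinom n.+1).
Implicit Types (A : 'M[C]_(n.+1, m)) (D : H2 m) (F : poly) (p : 'cV[C]_n.+1).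

(* The forms cutting out an effective divisor of class [D] on X_A after adding
   or removing multiples of the exceptional divisors. *)
Definition sect A D F : Prop := exists d : nat,
  [/\ D 0 ord0 = d%:Z, homogeneous d F
    & forall j (k : nat), k%:Z <= - D 0 (lift ord0 j) -> mult_ge F (col j A) k].

Lemma sect_homog A D F d : sect A D F -> D 0 ord0 = d%:Z -> homogeneous d F.
Proof. by case=> d' [-> hF _] [<-]. Qed.

Lemma sect_mult A D F j (k : nat) : sect A D F -> k%:Z <= - D 0 (lift ord0 j) ->
  mult_ge F (col j A) k.
Proof. by case=> d [_ _]; exact. Qed.

Lemma col_xcol A i j l : col l (xcol i j A) = col (tperm i j l) A.
Proof. by apply/matrixP => x y; rewrite !mxE. Qed.

Lemma sect_exchange A D F (i j : 'I_m) (e : j == i.+1 :> nat) :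
  sect (gen_matrix hm (Exchange e) A) D F -> sect A (reflection n (Exchange e) D) F.
Proof.
case=> d [D0 hF H]; exists d; split=> //; first by rewrite reflection_exchange_0.
move=> l k; rewrite reflection_exchange_j => kl.
by have := H _ _ kl; rewrite /= col_xcol tpermK.
Qed.

Definition first (k : 'I_n.+1) : 'I_m := widen_ord (ltnW hm) k.

Lemma first_inj : injective first.
Proof. by move=> i j /(congr1 val) /= /val_inj. Qed.

Lemma first_lt k : (first k < n.+1)%N. Proof. exact: (ltn_ord k). Qed.

Lemma firstP (j : 'I_m) : (j < n.+1)%N -> exists k, j = first k.
Proof. by move=> jn; exists (Ordinal jn); exact: val_inj. Qed.

Lemma left_unit A : in_X A -> left_block hm A \in unitmx.
Proof. by move=> /(_ first first_inj); rewrite unitmxE unitfE. Qed.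

Definition normal A : 'M[C]_(n.+1, m) := invmx (left_block hm A) *m A.

Lemma col_first A k : col (first k) A = col k (left_block hm A).
Proof. by apply/matrixP => i j; rewrite !mxE. Qed.

Lemma normal_first A k : in_X A -> col (first k) (normal A) = delta_mx k 0.
Proof.
move=> /left_unit hA; by rewrite /normal [LHS]colE -mulmxA -colE col_first colE mulmxA mulVmx // mul1mx.
Qed.

Lemma normal_first_E A i k : in_X A -> normal A i (first k) = (i == k)%:R.
Proof.
move=> hA; have := congr1 (fun M : 'cV_n.+1 => M i 0) (normal_first k hA).
by rewrite !mxE eqxx andbT.
Qed.

Lemma det_row0 k (M : 'M[C]_k) i : (forall j, M i j = 0) -> \det M = 0.
Proof. by move=> H; rewrite (expand_det_row _ i) big1 // => j _; rewrite H mul0r. Qed.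

(** Replacing the i-th of the first n + 1 columns by the j-th gives a minor of A whose normalised
    matrix would otherwise have a zero row. *)
Lemma normal_neq0 A i (j : 'I_m) : in_X A -> (n.+1 <= j)%N -> normal A i j != 0.
Proof.
move=> hA nj; apply/eqP => E.
pose f l := if l == i then j else first l.
have fi : injective f.
  move=> a b; rewrite /f; case: eqP => [->|ai]; case: eqP => [->//|bi] // H.
  - by move: nj; rewrite H leqNgt first_lt.
  - by move: nj; rewrite -H leqNgt first_lt.
  - exact: first_inj.
have := hA f fi; have -> : colsub f A = left_block hm A *m colsub f (normal A).
  by rewrite /normal mulmx_colsub mulKVmx // left_unit.
rewrite det_mulmx (@det_row0 _ (colsub f (normal A)) i) ?mulr0 ?eqxx // => l.
rewrite mxE /f; case: eqP => // /eqP li.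
by rewrite normal_first_E // eq_sym (negPf li).
Qed.

Lemma cremona_first A k : col (first k) (gen_matrix hm Cremona A) = delta_mx k 0.
Proof. by apply/matrixP => i j; rewrite !mxE first_lt ord1 eqxx andbT. Qed.

Lemma cremona_other A (j : 'I_m) i : (n.+1 <= j)%N ->
  gen_matrix hm Cremona A i j = (normal A i j)^-1.
Proof. by move=> nj; rewrite mxE ltnNge nj. Qed.

Definition lin A k : poly := \sum_(i < n.+1) invmx (left_block hm A) k i *: @var C n i.
Definition crem A k : poly := \prod_(l < n.+1 | l != k) lin A l.

Lemma gen_map_cremona A Phi k : gen_map hm Cremona A Phi k = subst Phi (crem A k).
Proof.
rewrite /gen_map /crem rmorph_prod; apply: eq_bigr => l _.
by rewrite /= /lin linear_sum; apply: eq_bigr => i _; rewrite linearZ /= subst_var.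
Qed.

Lemma meval_lin A p k : meval (fun i => p i 0) (lin A k) = (invmx (left_block hm A) *m p) k 0.
Proof.
rewrite /lin raddf_sum mxE; apply: eq_bigr => i _.
by rewrite /= mevalZ meval_var.
Qed.

Lemma meval_lin_col A j : \col_i meval (fun l => col j A l 0) (lin A i) = col j (normal A).
Proof.
by apply/matrixP => i l; rewrite mxE meval_lin ord1 /normal [in RHS]colE -mulmxA -colE.
Qed.

Lemma meval_lin_colE A j k : meval (fun l => col j A l 0) (lin A k) = normal A k j.
Proof.
by have := congr1 (fun M : 'cV_n.+1 => M k 0) (meval_lin_col A j); rewrite mxE => ->; rewrite mxE.
Qed.

Lemma meval_crem_col A (j : 'I_m) : in_X A -> (n.+1 <= j)%N ->
  \col_i meval (fun l => col j A l 0) (crem A i)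
  = (\prod_i normal A i j) *: col j (gen_matrix hm Cremona A).
Proof.
move=> hA nj; apply/matrixP => i l; rewrite mxE [RHS]mxE [X in _ * X]mxE (cremona_other _ _ nj).
rewrite (bigD1 i) //= mulrAC mulfV ?normal_neq0 // mul1r rmorph_prod.
by apply: eq_bigr => k _; exact: meval_lin_colE.
Qed.

Lemma meval_lin_prod A (j : 'I_m) (e : 'I_n.+1 -> nat) : in_X A -> (n.+1 <= j)%N ->
  meval (fun l => col j A l 0) (\prod_k lin A k ^+ e k) != 0.
Proof.
move=> hA nj; rewrite rmorph_prod /=; apply/prodf_neq0 => k _; rewrite rmorphXn /=.
by apply: expf_neq0; rewrite meval_lin_colE; exact: normal_neq0.
Qed.

Lemma homog_lin A k : homogeneous 1 (lin A k).
Proof. by apply: homog_sum => i _; apply: homogZ; exact: homog_var. Qed.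

Lemma homog_crem A k : homogeneous n (crem A k).
Proof.
have E : (\sum_(l < n.+1 | l != k) 1)%N = n by rewrite sum1_card cardC1 card_ord.
have := @homog_bigprod _ _ _ (index_enum 'I_n.+1) (fun l => l != k) (fun=> 1%N) (lin A) (fun l _ => homog_lin A l).
by rewrite E.
Qed.

Lemma subst_lin_inv A k : in_X A ->
  subst (fun i => \sum_(l < n.+1) left_block hm A i l *: @var C n l) (lin A k) = @var C n k.
Proof.
move=> /left_unit hA; rewrite /lin linear_sum.
transitivity (\sum_(l < n.+1) (invmx (left_block hm A) *m left_block hm A) k l *: @var C n l).
  under [in RHS]eq_bigr do rewrite mxE scaler_suml.
  rewrite [RHS]exchange_big; apply: eq_bigr => i _ /=.
  by rewrite linearZ /= subst_var scaler_sumr; apply: eq_bigr => l _; rewrite scalerA.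
rewrite mulVmx // (bigD1 k) //= mxE eqxx scale1r big1 ?addr0 // => l lk.
by rewrite mxE eq_sym (negPf lk) scale0r.
Qed.

Lemma subst_lin_eq0 A F : in_X A -> subst (lin A) F = 0 -> F = 0.
Proof.
move=> hA E; rewrite -[LHS]subst_id.
rewrite -(eq_subst _ (fun k => subst_lin_inv k hA)) -subst_comp E.
exact: raddf0.
Qed.

Definition mult_first D k : int := - D 0 (lift ord0 (first k)).

(** The standard Cremona transformation turns X^a into the monomial with exponents d - a_k; division
    by X^mu leaves d - a_k - mu_k. These are nonnegative by [exponent_bound] on the support of a
    section, where [absz] is therefore harmless. *)
Definition flip D (d : nat) (a : mon) : mon :=
  Multinom [tuple absz (d%:Z - (a k)%:Z - mult_first D k)%R | k < n.+1].

Lemma flipE D d a k : flip D d a k = absz (d%:Z - (a k)%:Z - mult_first D k)%R.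
Proof. exact: mnmE. Qed.

Definition flip_form D d F : poly := \sum_(a <- msupp F) mcoeff a F *: mono C (flip D d a).

(** For mu_k >= 0 this is the vertex criterion, the k-th column of the new matrix being a coordinate
    vertex; for mu_k < 0 it follows from a_k <= d. *)
Lemma exponent_bound A D F d a k : D 0 ord0 = d%:Z ->
  sect (gen_matrix hm Cremona A) D F -> mcoeff a F != 0 ->
  (a k)%:Z + mult_first D k <= d%:Z.
Proof.
move=> D0 sF aF; have hF := sect_homog sF D0; have da := (homogP d F).1 hF a aF.
have ak : (a k <= d)%N by rewrite -da mdegE (bigD1 k) //= leq_addr.
case E : (mult_first D k) => [mu|mu]; last by lia.
have := @sect_mult _ _ _ (first k) mu sF; rewrite -[- _]/(mult_first D k) E lexx => /(_ isT).
rewrite cremona_first => /(mult_ge_vertex _ _ hF)/(_ a aF); lia.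
Qed.

Lemma flip_degree A D F d a : D 0 ord0 = d%:Z ->
  sect (gen_matrix hm Cremona A) D F -> mcoeff a F != 0 ->
  (mdeg (flip D d a))%:Z = D 0 ord0 + cremona_shift n D.
Proof.
move=> D0 sF aF; have hF := sect_homog sF D0; have da := (homogP d F).1 hF a aF.
rewrite mdegE (big_morph Posz PoszD (erefl _)).
have E k : Posz (flip D d a k) = d%:Z - (a k)%:Z - mult_first D k.
  by rewrite flipE; have := exponent_bound k D0 sF aF; lia.
under eq_bigr do rewrite E.
rewrite !sumrB sumr_const card_ord -(big_morph Posz PoszD (erefl _)) -mdegE da.
rewrite /cremona_shift big_ord_narrow ?(ltnW hm) // => le.
have -> : \sum_i mult_first D i = - \sum_(i < n.+1) D 0 (lift ord0 (widen_ord le i)).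
  by rewrite -sumrN; apply: eq_bigr => i _; rewrite (bool_irrelevance le (ltnW hm)).
by rewrite D0 opprK -mulr_natr natz [n.+1%:Z]intS; ring.
Qed.

Lemma flip_inj A F D d a b : D 0 ord0 = d%:Z -> sect (gen_matrix hm Cremona A) D F ->
  mcoeff a F != 0 -> mcoeff b F != 0 -> flip D d a = flip D d b -> a = b.
Proof.
move=> D0 sF aF bF E; apply/mnmP => k.
have := congr1 (fun x : mon => x k) E; rewrite /= !flipE.
by have := exponent_bound k D0 sF aF; have := exponent_bound k D0 sF bF; lia.
Qed.

Lemma flip_form_coeff A F D d a : D 0 ord0 = d%:Z -> sect (gen_matrix hm Cremona A) D F ->
  mcoeff a F != 0 -> mcoeff (flip D d a) (flip_form D d F) = mcoeff a F.
Proof.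
move=> D0 sF aF.
rewrite raddf_sum /= (bigD1_seq a) ?msupp_uniq ?mcoeff_msupp //=.
rewrite mcoeffZ mcoeff_mono eqxx mulr1 big_seq_cond big1 ?addr0 // => b.
rewrite mcoeff_msupp => /andP[bF ba]; rewrite mcoeffZ mcoeff_mono.
case: eqP => [e|]; last by rewrite mulr0.
by case/eqP: ba; exact: (flip_inj D0 sF).
Qed.

Lemma flip_form_supp D d F b : mcoeff b (flip_form D d F) != 0 ->
  exists2 a, mcoeff a F != 0 & b = flip D d a.
Proof.
move=> bF; apply: contrapT => H; move/eqP: bF; apply.
rewrite raddf_sum /= big_seq big1 // => a; rewrite mcoeff_msupp => aF.
rewrite mcoeffZ mcoeff_mono; case: eqP => [e|]; last by rewrite mulr0.
by case: H; exists a.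
Qed.

Lemma flip_form_cremona A D d F : D 0 ord0 = d%:Z -> sect (gen_matrix hm Cremona A) D F ->
  flip_form D d F * \prod_k @var C n k ^+ posz (mult_first D k)
  = subst (fun k => \prod_(l < n.+1 | l != k) @var C n l) F
    * \prod_k @var C n k ^+ posz (- mult_first D k).
Proof.
move=> D0 sF; rewrite substE /flip_form !mulr_suml big_seq [RHS]big_seq.
apply: eq_bigr => a; rewrite mcoeff_msupp => aF; rewrite -!scalerAl; congr (_ *: _).
have da := (homogP d F).1 (sect_homog sF D0) a aF.
have -> : \prod_(i < n.+1) (\prod_(l < n.+1 | l != i) @var C n l) ^+ a i
    = \prod_(l < n.+1) @var C n l ^+ (d - a l).
  under eq_bigr do rewrite -prodrXl.
  rewrite (exchange_big_dep predT) //=; apply: eq_bigr => l _.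
  rewrite prodrXr; congr (_ ^+ _); rewrite -da mdegE [X in (X - _)%N](bigD1 l) //= addKn.
  by apply: eq_bigl => k; rewrite eq_sym.
rewrite mono_prod -!big_split; apply: eq_bigr => k _; rewrite /= -!exprD; congr (_ ^+ _).
rewrite flipE; have := exponent_bound k D0 sF aF; have := posz_sub (mult_first D k).
have : (a k <= d)%N by rewrite -da mdegE (bigD1 k) //= leq_addr.
lia.
Qed.

(* The Cremona transformation, of degree n and in coordinates adapted to the first
   n + 1 points, turns a monomial X^a of degree d into the monomial with exponents
   d - a_k; removing the hyperplanes through n of these points leaves a form with
   the multiplicities prescribed by the reflected class. *)
Lemma sect_cremona A D F : in_X A -> F != 0 -> sect (gen_matrix hm Cremona A) D F ->
  exists F1, [/\ sect A (reflection n Cremona D) F1, F1 != 0 &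
    F1 * \prod_k lin A k ^+ posz (mult_first D k)
    = subst (crem A) F * \prod_k lin A k ^+ posz (- mult_first D k)].
Proof.
move=> hA F0 sF; have [d [D0 hF _]] := sF.
pose G := flip_form D d F; pose e := absz (reflection n Cremona D 0 ord0).
have [a0 a0F] : exists a, mcoeff a F != 0.
  apply: contrapT => H; move/eqP: F0; apply; apply/mpolyP => a.
  by rewrite mcoeff0; apply/eqP; apply/negPn/negP => h; apply: H; exists a.
have eE a : mcoeff a F != 0 -> mdeg (flip D d a) = e.
  by move=> aF; apply/eqP; rewrite -eqz_nat /e reflection_cremona_0
    -(flip_degree D0 sF aF) absz_nat.
have D'0 : reflection n Cremona D 0 ord0 = e%:Z.
  by rewrite reflection_cremona_0 -(flip_degree D0 sF a0F) (eE a0).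
have hG : homogeneous e G.
  by apply/homogP => b /flip_form_supp[a aF ->]; exact: eE.
have G0 : G != 0.
  apply/eqP => E; move/eqP: a0F (flip_form_coeff D0 sF a0F); rewrite -/G E => H H'.
  by apply: H; rewrite -H'; exact: mcoeff0.
have rel : subst (lin A) G * \prod_k lin A k ^+ posz (mult_first D k)
    = subst (crem A) F * \prod_k lin A k ^+ posz (- mult_first D k).
  have H := @subst_relation _ _ (lin A) _ F G (fun k => posz (mult_first D k))
    (fun k => posz (- mult_first D k)) (flip_form_cremona D0 sF).
  have Ec k : subst (lin A) (\prod_(l < n.+1 | l != k) @var C n l) = crem A k.
    exact: subst_prod_var.
  by move: H; rewrite (eq_subst F Ec).
exists (subst (lin A) G); split=> //; last first.
  by apply/eqP => /(subst_lin_eq0 hA) E; move/eqP: G0; apply.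
exists e; split=> //.
  by rewrite -[e]mul1n; apply: homog_subst => // i; exact: homog_lin.
move=> j k; rewrite reflection_cremona_j.
have [jn|nj] := ltnP j n.+1; last first.
  rewrite subr0 => kD.
  have mF := sect_mult sF kD.
  have c0 : \prod_i normal A i j != 0.
    by apply/prodf_neq0 => i _; exact: normal_neq0.
  have H : mult_ge (subst (crem A) F) (col j A) k.
    apply: mult_ge_subst; rewrite (meval_crem_col hA nj).
    exact: (mult_ge_scale hF c0 mF).
  have H' : mult_ge ((\prod_k lin A k ^+ posz (mult_first D k)) * subst (lin A) G) (col j A) k.
    rewrite mulrC rel -[k in mult_ge _ _ k]addn0; apply: mult_geM => //; exact: mult_ge0.
  (* The adapted linear forms do not vanish at P_j, so the factor removed has multiplicity 0 there
     and all of k remains. *)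
  rewrite -[k]subn0.
  apply: mult_ge_div H'; split; first exact: mult_ge0.
  by move/mult_ge1/eqP; apply/negP; exact: meval_lin_prod.
move=> kD; have [l jl] := firstP jn; subst j.
(* In adapted coordinates this point is a vertex, where the multiplicity is read off the exponents
   of the flipped form. *)
apply: mult_ge_subst; have -> : \col_i meval (fun i => col (first l) A i 0) (lin A i) = delta_mx l 0.
  by rewrite meval_lin_col normal_first.
apply/(mult_ge_vertex _ _ hG) => b /flip_form_supp[a aF ->].
have := exponent_bound l D0 sF aF; rewrite flipE.
move: D'0 kD; rewrite reflection_cremona_0 D0 /mult_first; lia.
Qed.

(** If mu_j is the exact multiplicity of F at P_j, then c_j = D_j + mu_j is nonnegative because F
    has multiplicity at least -D_j. Adding the c_j E_j to the strict transform of F = 0 gives an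
    effective divisor of class D. *)
Lemma nodal_of_sect A s F : F != 0 -> sect A (reflections n s (Defs.root n Cremona)) F -> in_N A.
Proof.
move=> F0 [d [D0 hF H]]; set D := reflections _ _ _ in D0 H.
have [mu Hmu] := choice (fun j : 'I_m => has_mult_exists (col j A) F0).
have c_ge0 j : 0 <= D 0 (lift ord0 j) + (mu j)%:Z.
  rewrite leNgt; apply/negP => lt; case: (Hmu j) => _; apply; apply: H.
  by move: lt; clear; set x := D _ _; lia.
exists s, F, (fun j => absz (D 0 (lift ord0 j) + (mu j)%:Z)%R).
exists d, mu; split=> //; apply: H2_eq => [|j]; first by rewrite class_0.
by rewrite class_j gez0_abs // addrK.
Qed.

Fixpoint all_in_X (w : seq (generator m)) A : Prop :=
  if w is _ :: w' then in_X (word_matrix hm w A) /\ all_in_X w' A else in_X A.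

Lemma all_in_X_head w A : all_in_X w A -> in_X (word_matrix hm w A).
Proof. by case: w => [|g w] // []. Qed.

Lemma sect_gen A g D F : in_X A -> F != 0 -> sect (gen_matrix hm g A) D F ->
  exists2 F1, F1 != 0 & sect A (reflection n g D) F1.
Proof.
case: g => [i j e|] hA F0 sF; first by exists F => //; exact: sect_exchange sF.
by have [F1 [? ? _]] := sect_cremona hA F0 sF; exists F1.
Qed.

Lemma sect_word A w D F : all_in_X w A -> F != 0 -> sect (word_matrix hm w A) D F ->
  exists2 F1, F1 != 0 & sect A (reflections n (rev w) D) F1.
Proof.
elim: w D F => [|g w IH] D F; first by move=> _ F0 sF; exists F.
case=> _ hw F0 sF; rewrite reflections_rev_cons.
have [F1 F10 sF1] := sect_gen (all_in_X_head hw) F0 sF.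
exact: IH hw F10 sF1.
Qed.

Definition linear_form (a : 'rV[C]_n.+1) : poly := \sum_i a 0 i *: @var C n i.

Lemma meval_linear_form a p : meval (fun i => p i 0) (linear_form a) = (a *m p) 0 0.
Proof.
by rewrite /linear_form raddf_sum mxE; apply: eq_bigr => i _; rewrite /= mevalZ meval_var.
Qed.

Lemma homog_linear_form a : homogeneous 1 (linear_form a).
Proof. by apply: homog_sum => i _; apply: homogZ; exact: homog_var. Qed.

Lemma linear_form_neq0 a : a != 0 -> linear_form a != 0.
Proof.
move=> a0; apply/eqP => E; move/eqP: a0; apply; apply/rowP => i; rewrite mxE.
have := meval_linear_form a (delta_mx i 0); rewrite E meval0 mxE (bigD1 i) //=.
rewrite mxE !eqxx mulr1 big1 ?addr0 // => l li.
by rewrite mxE (negPf li) mulr0.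
Qed.

Lemma sect_hyperplane A (f : 'I_n.+1 -> 'I_m) a : a *m colsub f A = 0 ->
  sect A (class_minus [set f i | i in 'I_n.+1]) (linear_form a).
Proof.
move=> E; exists 1%N; split; [exact: class_minus_0|exact: homog_linear_form|].
move=> j k; rewrite class_minus_j opprK; case: imsetP => [[i _ ->]|_]; last first.
  by case: k => // _; exact: mult_ge0.
case: k => [_|[_|//]]; first exact: mult_ge0.
apply/mult_ge1; rewrite meval_linear_form; have := congr1 (fun M : 'rV_n.+1 => M 0 i) E.
rewrite [in RHS]mxE => H; rewrite -[RHS]H !mxE.
by apply: eq_bigr => l _; rewrite !mxE.
Qed.

(* A vanishing minor would give a hyperplane of class E - sum_(j in J) E_j, which
   is in the orbit of the root of the Cremona generator; pulled back to X_A it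
   would be nodal. *)
Lemma in_X_word A w : in_X A -> ~ in_N A -> all_in_X w A.
Proof.
move=> hA nA; elim: w => [//|g w IH]; split=> // f fi; apply/negP => /det0P[a a0 Ea].
have [s Es] : exists s, class_minus [set f i | i in 'I_n.+1]
    = reflections n s (Defs.root n Cremona).
  by apply: class_minus_orbit; rewrite ?(ltnW hm) // card_imset // card_ord.
have sF := sect_hyperplane Ea.
have [F1 F10 sF1] := sect_gen (all_in_X_head IH) (linear_form_neq0 a0) sF.
have [F2 F20 sF2] := sect_word IH F10 sF1.
apply: nA; apply: (@nodal_of_sect A (rev w ++ g :: s) F2 F20).
by rewrite reflections_cat /= -/(reflections n s _) -Es.
Qed.

End Sections.

(** * Forms on the curve *)

Section ProjectivePoints.
Local Open Scope classical_set_scope.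
Local Open Scope ring_scope.
Variables (K : fieldType) (n : nat).
Implicit Types x y : 'cV[K]_n.+1.

Lemma proj_eq_neq0l x y : proj_eq x y -> x != 0. Proof. by case. Qed.

Lemma proj_eq_neq0r x y : proj_eq x y -> y != 0.
Proof. by case=> x0 [c c0 ->]; rewrite scaler_eq0 negb_or c0. Qed.

Lemma proj_eq_refl x : x != 0 -> proj_eq x x.
Proof. by move=> x0; split=> //; exists 1; rewrite ?oner_neq0 // scale1r. Qed.

Lemma proj_eq_sym x y : proj_eq x y -> proj_eq y x.
Proof.
move=> xy; split; first exact: proj_eq_neq0r xy.
have [_ [c c0 ->]] := xy.
by exists c^-1; rewrite ?invr_neq0 // scalerA mulVf // scale1r.
Qed.

Lemma proj_eq_trans x y z : proj_eq x y -> proj_eq y z -> proj_eq x z.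
Proof.
move=> [x0 [c c0 ->]] [_ [d d0 ->]]; split=> //; exists (d * c); rewrite ?mulf_neq0 //.
by rewrite scalerA.
Qed.

Lemma proj_eq_scale x c : x != 0 -> c != 0 -> proj_eq x (c *: x).
Proof. by move=> x0 c0; split=> //; exists c. Qed.

Lemma cV_neq0 x : x != 0 -> exists i, x i 0 != 0.
Proof.
move=> x0; apply: contrapT => H; move/eqP: x0; apply; apply/colP => i; rewrite mxE.
by apply/eqP/negPn/negP => h; apply: H; exists i.
Qed.

Lemma proj_eq_cross x y : x != 0 -> y != 0 ->
  (forall i j, x i 0 * y j 0 = x j 0 * y i 0) -> proj_eq x y.
Proof.
move=> x0 y0 H; have [i xi] := cV_neq0 x0; split=> //.
have yE : y = (y i 0 / x i 0) *: x.
  apply/colP => j; rewrite mxE; apply: (mulfI xi).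
  by rewrite H; field.
exists (y i 0 / x i 0) => //; apply/eqP => E; move/eqP: y0; apply.
by rewrite yE E scale0r.
Qed.

Lemma cross_proj_eq x y i j : proj_eq x y -> x i 0 * y j 0 = x j 0 * y i 0.
Proof. by case=> _ [c _ ->]; rewrite !mxE; ring. Qed.

End ProjectivePoints.

Section Curve.
Local Open Scope classical_set_scope.
Local Open Scope ring_scope.
Variable R : realType.
Local Notation C := (complexes R).
Local Notation Im := (@complex.Im R).
Variable tau : C.
Hypothesis tau_gt0 : 0 < Im tau.
Local Notation T := (torus tau).
Local Notation prj := (to_torus tau).
Local Notation toC := (@toC R).
Variable n : nat.
Local Notation poly := (mpoly n.+1 C).
Local Notation vec := 'cV[C]_n.+1.
Implicit Types (P Q : poly) (iota : T -> vec) (F G : C -> vec) (x : T) (z : C) (k l : int).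

#[local] Opaque holomorphic_at.

Lemma near_shift (S : C -> Prop) z (l : C) : (\forall t \near (z + l : C), S t) ->
  \forall t \near z, S (t + l).
Proof.
move=> /nearC_P[d d0 H]; apply/nearC_P; exists d => // t tz; apply: H.
by have -> : t + l - (z + l) = t - z by ring.
Qed.

Lemma dnear_shift (S : C -> Prop) z (l : C) : (\forall t \near (z + l : C)^', S t) ->
  \forall t \near (z : C)^', S (t + l).
Proof.
move=> /dnearC_P[d d0 H]; apply/dnearC_P; exists d => // t tz td; apply: H.
  by apply: contra_neq tz => /addIr.
by have -> : t + l - (z + l) = t - z by ring.
Qed.

Lemma near_and (S S' : C -> Prop) z : (\forall t \near z, S t) -> (\forall t \near z, S' t) ->
  \forall t \near z, S t /\ S' t.
Proof.
move=> /nearC_P[d d0 H] /nearC_P[e e0 H']; apply/nearC_P; exists (Num.min d e).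
  by rewrite lt_min d0.
by move=> t; rewrite lt_min => /andP[h1 h2]; split; [exact: H|exact: H'].
Qed.

Lemma dnear_and (S S' : C -> Prop) z : (\forall t \near (z : C)^', S t) ->
  (\forall t \near (z : C)^', S' t) -> \forall t \near (z : C)^', S t /\ S' t.
Proof.
move=> /dnearC_P[d d0 H] /dnearC_P[e e0 H']; apply/dnearC_P; exists (Num.min d e).
  by rewrite lt_min d0.
by move=> t tz; rewrite lt_min => /andP[h1 h2]; split; [exact: H|exact: H'].
Qed.

Lemma near_imp (S S' : C -> Prop) z : (forall t, S t -> S' t) ->
  (\forall t \near z, S t) -> \forall t \near z, S' t.
Proof.
by move=> I /nearC_P[d d0 H]; apply/nearC_P; exists d => // t /H; exact: I.
Qed.

Lemma dnear_imp (S S' : C -> Prop) z : (forall t, S t -> S' t) ->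
  (\forall t \near (z : C)^', S t) -> \forall t \near (z : C)^', S' t.
Proof.
by move=> I /dnearC_P[d d0 H]; apply/dnearC_P; exists d => // t tz /(H t tz); exact: I.
Qed.

Lemma near_forall (I : finType) (S : I -> C -> Prop) z :
  (forall i, \forall t \near z, S i t) -> \forall t \near z, forall i, S i t.
Proof.
move=> H; suff all_i (r : seq I) : \forall t \near z, forall i, i \in r -> S i t.
  by apply: near_imp (all_i (enum I)) => t h i; apply: h; rewrite mem_enum.
elim: r => [|i r IH]; first by apply/nearC_P; exists 1.
apply: near_imp (near_and (H i) IH) => t [h1 h2] j.
by rewrite inE => /predU1P[->|]; [exact: h1|exact: h2].
Qed.

Lemma dnear_forall (I : finType) (S : I -> C -> Prop) z :
  (forall i, \forall t \near (z : C)^', S i t) -> \forall t \near (z : C)^', forall i, S i t.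
Proof.
move=> H; suff all_i (r : seq I) : \forall t \near (z : C)^', forall i, i \in r -> S i t.
  by apply: dnear_imp (all_i (enum I)) => t h i; apply: h; rewrite mem_enum.
elim: r => [|i r IH]; first by apply/dnearC_P; exists 1.
apply: dnear_imp (dnear_and (H i) IH) => t [h1 h2] j.
by rewrite inE => /predU1P[->|]; [exact: h1|exact: h2].
Qed.

Lemma near_dnear (S : C -> Prop) z : (\forall t \near z, S t) -> \forall t \near (z : C)^', S t.
Proof. by move=> /nearC_P[d d0 H]; apply/dnearC_P; exists d => // t _; exact: H. Qed.

Lemma near_self (S : C -> Prop) z : (\forall t \near z, S t) -> S z.
Proof. by move=> /nearC_P[d d0 H]; apply: H; rewrite subrr nrm0. Qed.

Lemma dnear_ex (S : C -> Prop) z : (\forall t \near (z : C)^', S t) -> exists2 t, t != z & S t.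
Proof.
move=> /dnearC_P[d d0 H]; have d2 : 0 < d / 2 by rewrite divr_gt0.
have N : nrm (toC (d / 2) : C) = d / 2 by rewrite nrm_toC gtr0_norm.
have tz : z + toC (d / 2) != z by rewrite -subr_eq0 addrC addKr -nrm_gt0 N.
exists (z + toC (d / 2)); first exact: tz.
apply: (H _ tz); by rewrite addrC addKr N ltr_pdivrMr // ltr_pMr // ltr1n.
Qed.

Lemma near_near (S : C -> Prop) z : (\forall t \near z, S t) ->
  \forall t \near z, \forall s \near t, S s.
Proof.
move=> /nearC_P[d d0 H]; apply/nearC_P; exists d => // t td.
apply/nearC_P; exists (d - nrm (t - z)); first by rewrite subr_gt0.
move=> s st; apply: H; have -> : s - z = (s - t) + (t - z) by ring.
by apply: le_lt_trans (le_nrmD _ _) _; rewrite -ltrBrDr.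
Qed.

Lemma dnear_near (S : C -> Prop) z : (\forall t \near (z : C)^', S t) ->
  \forall t \near z, \forall s \near (t : C)^', S s.
Proof.
move=> /dnearC_P[d d0 H]; apply/nearC_P; exists d => // t td; apply/dnearC_P.
have [->|tz] := eqVneq t z; first by exists d.
exists (Num.min (d - nrm (t - z)) (nrm (t - z))).
  by rewrite lt_min subr_gt0 td nrm_gt0 subr_eq0.
move=> s _; rewrite lt_min => /andP[s1 s2]; apply: H.
  apply/eqP => sz; move: s2; rewrite sz.
  have -> : z - t = - (t - z) by ring.
  by rewrite nrmN ltxx.
have -> : s - z = (s - t) + (t - z) by ring.
by apply: le_lt_trans (le_nrmD _ _) _; rewrite -ltrBrDr.
Qed.

Lemma hol_at_shift (f : C -> C) z (l : C) : holomorphic_at f (z + l) ->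
  holomorphic_at (fun t => f (t + l)) z.
Proof.
move=> /holomorphic_atP[r r0 H]; apply/holomorphic_atP; exists r => // t tr.
have [|a Ha] := H (t + l); first by have -> : t + l - (z + l) = t - z by ring.
exists a => e e0; have [d d0 Hd] := Ha e e0; exists d => // s sd.
have E : s - t = s + l - (t + l) by ring.
by rewrite E; apply: Hd; rewrite -E.
Qed.

Lemma has_order_shift (f : C -> C) z (l : C) k : has_order f (z + l) k ->
  has_order (fun t => f (t + l)) z k.
Proof.
move=> [g [hg g0 E]]; exists (fun t => g (t + l)); split; [exact: hol_at_shift|exact: g0|].
apply: dnear_imp (dnear_shift E) => t ->.
by have -> : t + l - (z + l) = t - z by ring.
Qed.

Definition ev P (v : vec) : C := meval (fun i => v i 0) P.

Lemma ev_sum P v : ev P v = \sum_(m <- msupp P) mcoeff m P * \prod_i v i 0 ^+ m i.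
Proof. exact: meval_sum. Qed.

Lemma evM P Q v : ev (P * Q) v = ev P v * ev Q v.
Proof. exact: rmorphM. Qed.

Lemma ev_subst Phi P v : ev (subst Phi P) v = ev P (\col_i ev (Phi i) v).
Proof. by rewrite /ev meval_subst; apply: meval_eq => i; rewrite mxE. Qed.

Lemma ev_scale d P (c : C) v : homogeneous d P -> ev P (c *: v) = c ^+ d * ev P v.
Proof.
move=> hP; rewrite /ev -(meval_scale _ _ hP); apply: meval_eq => i; by rewrite mxE.
Qed.

Lemma ev_hol P F z : holomorphic_vec_at F z -> holomorphic_at (fun t => ev P (F t)) z.
Proof.
move=> hF; apply: (@hol_at_eq _ (fun t => \sum_(m <- msupp P) mcoeff m P * \prod_i F t i 0 ^+ m i)).
  by apply/nearC_P; exists 1 => // t _; rewrite -ev_sum.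
apply: hol_at_sum => m; apply: hol_atM; first exact: hol_at_cst.
by apply: hol_at_prod => i; apply: hol_atX; exact: hF.
Qed.

Definition lifted iota := forall z, exists F, local_lift iota z F.

Lemma hol_vec_near F z : holomorphic_vec_at F z -> \forall t \near z, holomorphic_vec_at F t.
Proof. by move=> hF; apply: near_forall => i; exact: hol_at_near (hF i). Qed.

Lemma lift_near iota z F : local_lift iota z F -> \forall t \near z, local_lift iota t F.
Proof.
by case=> hF E; apply: near_imp (near_and (hol_vec_near hF) (near_near E)) => t [h1 h2]; split.
Qed.

Lemma lift_eq iota iota' z F : (forall x, proj_eq (iota x) (iota' x)) ->
  local_lift iota z F -> local_lift iota' z F.
Proof.
move=> E [hF H]; split=> //; apply: near_imp H => t Ht.
exact: proj_eq_trans Ht (E _).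
Qed.

Lemma lift_neq0 iota z F : local_lift iota z F -> F z != 0.
Proof. by case=> _ /near_self; exact: proj_eq_neq0l. Qed.

Lemma lift_shift iota z (l : C) F : prj l = 0 -> local_lift iota (z + l) F ->
  local_lift iota z (fun t => F (t + l)).
Proof.
move=> l0 [hF E]; split=> [i|]; first exact: (@hol_at_shift (fun t => F t i 0) z l (hF i)).
by apply: near_imp (near_shift E) => t; rewrite raddfD /= l0 addr0.
Qed.

(** The factor is the quotient of the two lifts in a coordinate that does not vanish at z; it makes
    orders along the curve independent of the lift. *)
Lemma lift_ratio iota z F G : local_lift iota z F -> local_lift iota z G ->
  exists c : C -> C, [/\ holomorphic_at c z, c z != 0 & \forall t \near z, G t = c t *: F t].
Proof.
move=> hF hG; have [i Fi] := cV_neq0 (lift_neq0 hF).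
have [[hF' EF] [hG' EG]] := (hF, hG).
have hc : holomorphic_at (fun t => G t i 0 * (F t i 0)^-1) z.
  by apply: hol_atM; [exact: hG'|apply: hol_atV; [exact: hF'|exact: Fi]].
have E : \forall t \near z, G t = (G t i 0 * (F t i 0)^-1) *: F t.
  apply: near_imp (near_and (near_and EF EG) (ccont_neq0 (hol_at_ccont (hF' i)) Fi)).
  move=> t [[h1 h2] Ft]; have [_ [c _ EGt]] := proj_eq_trans h1 (proj_eq_sym h2).
  by rewrite EGt; congr (_ *: _); rewrite mxE mulfK.
exists (fun t => G t i 0 * (F t i 0)^-1); split; [exact: hc| |exact: E].
apply/eqP => c0; have := near_self E; rewrite c0 scale0r => /eqP.
by rewrite (negPf (lift_neq0 hG)).
Qed.

(** Order at x of the restriction of the form P to the curve. For a lifted curve no k exists if P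
    vanishes identically on it, so having an order also says that it does not. *)
Definition corder iota P x k := forall z F, prj z = x -> local_lift iota z F ->
  has_order (fun t => ev P (F t)) z k.

(** Two lifts over the same point differ by a lattice translation and a nonvanishing holomorphic
    factor c, which multiplies a form of degree d by c^d. *)
Lemma corder_intro iota P d x k z F : homogeneous d P -> prj z = x -> local_lift iota z F ->
  has_order (fun t => ev P (F t)) z k -> corder iota P x k.
Proof.
move=> hP zx hF H z' F' z'x hF'.
have l0 : prj (z - z') = 0 by rewrite raddfB /= zx z'x subrr.
have zE : z' + (z - z') = z by rewrite addrC subrK.
have hF2 : local_lift iota z' (fun t => F (t + (z - z'))) by apply: lift_shift; rewrite ?zE.
have H2 : has_order (fun t => ev P (F (t + (z - z')))) z' k.
  by apply: (@has_order_shift (fun t => ev P (F t))); rewrite zE.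
have [c [hc c0 E]] := lift_ratio hF2 hF'.
have Hc : has_order (fun t => c t ^+ d) z' 0.
  by apply: has_order0; [exact: hol_atX|exact: expf_neq0].
have := has_orderM Hc H2; rewrite add0r; apply: has_order_eq.
by apply: dnear_imp (near_dnear E) => t ->; rewrite (ev_scale _ _ hP).
Qed.

Lemma corder_uniq iota P x k l : lifted iota -> corder iota P x k -> corder iota P x l -> k = l.
Proof.
move=> hi hk hl; have [z zx] := to_torus_surj x; have [F hF] := hi z.
exact: has_order_uniq (hk z F zx hF) (hl z F zx hF).
Qed.

Lemma corderM iota P Q x k l : corder iota P x k -> corder iota Q x l ->
  corder iota (P * Q) x (k + l).
Proof.
move=> hk hl z F zx hF; have := has_orderM (hk z F zx hF) (hl z F zx hF).
by apply: has_order_eq; apply/dnearC_P; exists 1 => // t _ _; rewrite evM.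
Qed.

Lemma corder_cst iota (c : C) x : c != 0 -> corder iota (cst n c) x 0.
Proof.
move=> c0 z F zx hF; have := has_order_cst z c0.
by apply: has_order_eq; apply/dnearC_P; exists 1 => // t _ _; rewrite /ev mevalC.
Qed.

Lemma corder1 iota x : corder iota 1 x 0.
Proof.
have := @corder_cst iota 1 x (oner_neq0 _).
by rewrite (_ : cst n 1 = 1) // /cst mpolyC1.
Qed.

Lemma corder_prod iota (I : Type) (r : seq I) (S : pred I) (P : I -> poly) (k : I -> int) x :
  (forall i, S i -> corder iota (P i) x (k i)) ->
  corder iota (\prod_(i <- r | S i) P i) x (\sum_(i <- r | S i) k i).
Proof.
move=> H; elim: r => [|i r IH]; first by rewrite !big_nil; exact: corder1.
by rewrite !big_cons; case: ifP => Si //; apply: corderM => //; exact: H.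
Qed.

Lemma corderX iota P x k (e : nat) : corder iota P x k -> corder iota (P ^+ e) x (k * e%:Z).
Proof.
move=> H; elim: e => [|e IH]; first by rewrite mulr0; exact: corder1.
by rewrite exprS intS mulrDr mulr1; exact: corderM.
Qed.

Lemma has_order_vanish (f : C -> C) z k : has_order f z k ->
  ~ \forall t \near (z : C)^', f t = 0.
Proof.
move=> [F [hF F0 EF]] E.
have F0' := near_dnear (ccont_neq0 (hol_at_ccont hF) F0).
have [t tz [[E1 E2] Ft]] := dnear_ex (dnear_and (dnear_and EF E) F0').
by move/eqP: E1; rewrite E2 eq_sym mulf_eq0 (negPf Ft) orbF (negPf (subr_expz_neq0 k tz)).
Qed.

Lemma order_ge (f h : C -> C) z (k : nat) l : has_order f z l -> holomorphic_at h z ->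
  (\forall t \near (z : C)^', f t = (t - z) ^+ k * h t) -> k%:Z <= l.
Proof.
move=> Hf /holomorphic_atP[r r0 hh] E.
case: (hol_order tau_gt0 r0 hh) => [h0|[j [g [hg g0 Eg]]]].
  exfalso; apply: (has_order_vanish Hf).
  by apply: dnear_imp (dnear_and E (near_dnear h0)) => t [-> ->]; rewrite mulr0.
have Hg : has_order (fun t => (t - z) ^+ (k + j) * g t) z (k + j)%:Z.
  exists g; split; [by apply/holomorphic_atP; exists r|exact: g0|].
  by apply/dnearC_P; exists 1 => // t _ _; rewrite -exprnP.
have -> : l = (k + j)%:Z.
  apply: (has_order_uniq Hf); apply: has_order_eq Hg.
  have [d d0 Hd] := (dnearC_P _ _).1 E.
  apply/dnearC_P; exists (Num.min d r); first by rewrite lt_min d0.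
  move=> t tz; rewrite lt_min => /andP[t1 t2].
  by rewrite (Hd _ tz t1) (Eg _ t2) mulrA -exprD.
by rewrite lez_nat leq_addr.
Qed.


Lemma hol_has_order (f : C -> C) z : holomorphic_at f z ->
  (\forall t \near z, f t = 0) \/ exists k : nat, has_order f z k.
Proof.
move=> /holomorphic_atP[r r0 hf]; case: (hol_order tau_gt0 r0 hf) => [|[k [g [hg g0 E]]]].
  by left.
right; exists k, g; split; [by apply/holomorphic_atP; exists r|exact: g0|].
by apply/dnearC_P; exists r => // t _ tr; rewrite (E _ tr) -exprnP.
Qed.

Lemma corder_ge0 iota P x k : lifted iota -> corder iota P x k -> 0 <= k.
Proof.
move=> hi hk; have [z zx] := to_torus_surj x; have [F hF] := hi z.
apply: (@order_ge _ (fun t => ev P (F t)) z 0%N k (hk z F zx hF)).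
  by apply: ev_hol; case: hF.
by apply/dnearC_P; exists 1 => // t _ _; rewrite expr0 mul1r.
Qed.

Lemma corder_lift iota P d x z F : homogeneous d P -> prj z = x -> local_lift iota z F ->
  ~ (\forall t \near z, ev P (F t) = 0) -> exists k : nat, corder iota P x k.
Proof.
move=> hP zx hF nz; have [//|[k Hk]] := hol_has_order (ev_hol P hF.1).
by exists k; exact: corder_intro hP zx hF Hk.
Qed.

Lemma corder_eq0 iota P d x : lifted iota -> homogeneous d P -> ev P (iota x) != 0 ->
  corder iota P x 0.
Proof.
move=> hi hP Px; have [z zx] := to_torus_surj x; have [F hF] := hi z.
apply: (corder_intro hP zx hF); apply: has_order0; first by apply: ev_hol; case: hF.
have [_ /near_self[_ [c c0 E]]] := hF; apply/eqP => E0; move/eqP: Px; apply.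
by rewrite -zx E (ev_scale _ _ hP) E0 mulr0.
Qed.

Lemma lo_order (G : poly) (g : C -> vec) z (k : nat) : lo k G ->
  (forall i, holomorphic_at (fun t => g t i 0) z) ->
  exists2 h : C -> C, holomorphic_at h z
    & forall t, ev G ((t - z) *: g t) = (t - z) ^+ k * h t.
Proof.
move=> hG hg.
exists (fun t => \sum_(m <- msupp G) mcoeff m G * ((t - z) ^+ (mdeg m - k) * \prod_i g t i 0 ^+ m i)).
  apply: hol_at_sum => m; apply: hol_atM; first exact: hol_at_cst.
  apply: hol_atM; first by apply: hol_atX; exact: hol_at_subr.
  by apply: hol_at_prod => i; apply: hol_atX; exact: hg.
move=> t; rewrite ev_sum mulr_sumr; apply: eq_big_seq => m; rewrite mcoeff_msupp => mG.
have km : (k <= mdeg m)%N by rewrite leqNgt; apply/negP => /hG /eqP; rewrite (negPf mG).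
rewrite [RHS]mulrCA; congr (_ * _); rewrite [RHS]mulrA -exprD subnKC //.
under eq_bigr do rewrite mxE exprMn.
by rewrite big_split /= mdegE (big_morph _ (exprD (t - z)) (expr0 (t - z))).
Qed.

Lemma vec_divide F z : holomorphic_vec_at F z -> exists2 g : C -> vec,
  (forall i, holomorphic_at (fun t => g t i 0) z) & \forall t \near z, F t = F z + (t - z) *: g t.
Proof.
move=> hF.
have H i : exists g : C -> C, holomorphic_at g z /\ \forall t \near z, F t i 0 = F z i 0 + (t - z) * g t.
  have /holomorphic_atP[r r0 hf] := hF i.
  have [g [E hg]] := hol_divide tau_gt0 r0 hf.
  exists g; split; first by apply/holomorphic_atP; exists r.
  by apply/nearC_P; exists r.
have [g Hg] := choice H; exists (fun t => \col_i g i t).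
  move=> i; apply: hol_at_eq (Hg i).1.
  by apply/nearC_P; exists 1 => // t _; rewrite mxE.
apply: near_imp (near_forall (fun i => (Hg i).2)) => t h; apply/colP => i.
by rewrite !mxE h.
Qed.

(** Near z the lift is F z + (t - z) g(t), and a polynomial without terms of degree < k around F z
    becomes divisible by (t - z)^k. *)
Lemma corder_mult iota P d x p (k : nat) l : lifted iota -> homogeneous d P ->
  proj_eq (iota x) p -> mult_ge P p k -> corder iota P x l -> k%:Z <= l.
Proof.
move=> hi hP xp mP Hl; have [z zx] := to_torus_surj x; have [F hF] := hi z.
have [hF1 /near_self EF] := hF; rewrite zx in EF.
have [_ [c c0 Ec]] := proj_eq_sym (proj_eq_trans EF xp).
have mF : mult_ge P (F z) k by rewrite Ec; exact: mult_ge_scale hP c0 mP.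
have [g hg E] := vec_divide hF1.
have [h hh Eh] := lo_order mF hg.
apply: (@order_ge _ h z k l (Hl z F zx hF) hh).
apply: near_dnear; apply: near_imp E => t ->; rewrite -Eh.
by rewrite /ev -[RHS]/(ev (shift (F z) P) _) /ev meval_shift; apply: meval_eq => i; rewrite !mxE.
Qed.

Lemma corder_root iota P d x l : lifted iota -> homogeneous d P -> iota x != 0 ->
  ev P (iota x) = 0 -> corder iota P x l -> 1 <= l.
Proof.
move=> hi hP x0 E; apply: (@corder_mult iota P d x (iota x) 1%N l) => //.
  exact: proj_eq_refl.
exact/mult_ge1.
Qed.

(* By bisection of a fundamental parallelogram. *)
Lemma torus_connected (S : T -> Prop) :
  (forall z, (\forall t \near z, S (prj t)) \/ (\forall t \near z, ~ S (prj t))) ->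
  forall x y, S x -> S y.
Proof.
move=> H x y Sx.
pose Q (a b d : R) := (forall p q : R, a <= p <= a + d * 1 -> b <= q <= b + d * 1 -> S (prj (pt tau p q)))
  \/ (forall p q : R, a <= p <= a + d * 1 -> b <= q <= b + d * 1 -> ~ S (prj (pt tau p q))).
have [Q1|Q1] : Q 0 0 1.
- apply: (@rect_bisect R Q 1 1) => //.
    move=> a b d d0 Q1 Q2 Q3 Q4.
    have Ea : a + d / 2 * 1 + d / 2 * 1 = a + d * 1 by field.
    have Eb : b + d / 2 * 1 + d / 2 * 1 = b + d * 1 by field.
    have dd : 0 < d / 2 by rewrite divr_gt0.
    rewrite /Q Ea in Q2; rewrite /Q Eb in Q3; rewrite /Q Ea Eb in Q4; rewrite /Q in Q1.
    have c1 : a <= a + d / 2 * 1 <= a + d / 2 * 1 by lra.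
    have c2 : b <= b + d / 2 * 1 <= b + d / 2 * 1 by lra.
    have c3 : a + d / 2 * 1 <= a + d / 2 * 1 <= a + d * 1 by lra.
    have c4 : b + d / 2 * 1 <= b + d / 2 * 1 <= b + d * 1 by lra.
    (* The four quarters share this corner, which decides for all of them. *)
    have [S0|S0] := pselect (S (prj (pt tau (a + d / 2 * 1) (b + d / 2 * 1)))).
      left=> p q /andP[p1 p2] /andP[q1 q2].
      case: (leP p (a + d / 2 * 1)) => hp; case: (leP q (b + d / 2 * 1)) => hq.
      - by case: Q1 => Q1; [apply: Q1; apply/andP|case: (Q1 _ _ c1 c2 S0)].
      - by case: Q3 => Q3; [apply: Q3; apply/andP; rewrite // ltW|case: (Q3 _ _ c1 c4 S0)].
      - by case: Q2 => Q2; [apply: Q2; apply/andP; rewrite // ltW|case: (Q2 _ _ c3 c2 S0)].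
      - by case: Q4 => Q4; [apply: Q4; apply/andP; rewrite // ltW|case: (Q4 _ _ c3 c4 S0)].
    right=> p q /andP[p1 p2] /andP[q1 q2].
    case: (leP p (a + d / 2 * 1)) => hp; case: (leP q (b + d / 2 * 1)) => hq.
    - by case: Q1 => Q1; [case: S0; exact: Q1|apply: Q1; apply/andP].
    - by case: Q3 => Q3; [case: S0; exact: Q3|apply: Q3; apply/andP; rewrite // ltW].
    - by case: Q2 => Q2; [case: S0; exact: Q2|apply: Q2; apply/andP; rewrite // ltW].
    - by case: Q4 => Q4; [case: S0; exact: Q4|apply: Q4; apply/andP; rewrite // ltW].
  move=> p q _ _.
  have N0 : 0 < 1 + nrm tau by rewrite ltr_wpDr // nrm_ge0.
  have close r : 0 < r -> exists2 e : R, 0 < e & forall a b d, 0 < d -> d < e ->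
      a <= p <= a + d * 1 -> b <= q <= b + d * 1 -> forall p' q',
      a <= p' <= a + d * 1 -> b <= q' <= b + d * 1 -> nrm (pt tau p' q' - pt tau p q) < r.
    move=> r0; exists (r / (1 + nrm tau)); first by rewrite divr_gt0.
    move=> a b d d0; rewrite ltr_pdivlMr // => dr hp hq p' q' hp' hq'.
    rewrite ptB; apply: le_lt_trans (nrm_pt _ _ _) _; apply: le_lt_trans dr.
    rewrite mulrDr mulr1 lerD //; first by rewrite ler_norml; lra.
    by rewrite ler_wpM2r ?nrm_ge0 // ler_norml; lra.
  case: (H (pt tau p q)) => /nearC_P[r r0 Hr]; have [e e0 He] := close r r0; exists e => //.
    move=> a b d d0 de hp hq; left=> p' q' hp' hq'; apply: Hr.
    exact: (He a b d).
  move=> a b d d0 de hp hq; right=> p' q' hp' hq'; apply: Hr.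
  exact: (He a b d).
- have [p [q [hp hq <-]]] := prj_surj_rect tau_gt0 0 0 y.
  by apply: Q1; lra.
- exfalso; have [p [q [hp hq E]]] := prj_surj_rect tau_gt0 0 0 x.
  by apply: (Q1 p q); rewrite ?E //; lra.
Qed.

(** Identity principle: the points near which the form is not identically zero along the curve form
    an open and closed subset of the torus. *)
Lemma corder_exists iota P d x k : lifted iota -> homogeneous d P -> corder iota P x k ->
  forall y, exists l, corder iota P y l.
Proof.
move=> hi hP Hx y; apply: (@torus_connected (fun y => exists l, corder iota P y l) _ x y); last by exists k.
move=> z; have [F hF] := hi z.
have [E|[l Hl]] := hol_has_order (ev_hol P hF.1).
  right; apply: near_imp (near_and (near_near E) (lift_near hF)) => t [Et hFt] [l Hl].
  exact: (has_order_vanish (Hl t F erefl hFt) (near_dnear Et)).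
left; have := has_order_near Hl => /dnearC_P[d1 d10 H1].
have /nearC_P[d2 d20 H2] := lift_near hF.
apply/nearC_P; exists (Num.min d1 d2); first by rewrite lt_min d10.
move=> t; rewrite lt_min => /andP[t1 t2]; have [->|tz] := eqVneq t z.
  by exists l; exact: corder_intro hP erefl hF Hl.
by exists 0; exact: corder_intro hP erefl (H2 t t2) (H1 t tz t1).
Qed.

Lemma ev_linear (a : 'rV[C]_n.+1) v : ev (linear_form a) v = (a *m v) 0 0.
Proof. exact: meval_linear_form. Qed.

Lemma hyperplane_divisorE iota a (D : T -> int) : hyperplane_divisor iota a D ->
  lifted iota /\ forall x, corder iota (linear_form a) x (D x).
Proof.
move=> H; split=> [z|x]; first by have [F hF _] := H z; exists F.
have [z zx] := to_torus_surj x; have [F hF Ho] := H z.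
apply: (corder_intro (homog_linear_form a) zx hF); rewrite -zx.
by apply: has_order_eq Ho; apply/dnearC_P; exists 1 => // t _ _; rewrite ev_linear.
Qed.

(* [s] is (n + 1) v in the notation of the theorem. *)
Definition hyperplane_sum iota (s : T) : Prop := exists a D,
  (forall x, corder iota (linear_form a) x (D x)) /\ sums D n.+1 s.

(* The quotient of a form of degree d by the d-th power of a linear form is
   a meromorphic function on the torus. *)
Lemma corder_sums iota s P d x k : lifted iota -> hyperplane_sum iota s -> homogeneous d P ->
  corder iota P x k ->
  exists D, (forall x, corder iota P x (D x)) /\ sums D (d%:Z * n.+1%:Z) (s *~ d).
Proof.
move=> hi [a [D0 [HD0 S0]]] hP Hx.
have [D HD] := choice (corder_exists hi hP Hx); exists D; split=> //.
pose f y := ev P (iota y) * (ev (linear_form a) (iota y)) ^ (- d%:Z).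
have Hf z : has_order (fun t => f (prj t)) z (D (prj z) + D0 (prj z) * - d%:Z).
  have [F hF] := hi z.
  have := has_orderM (HD _ z F erefl hF) (has_order_expz (- d%:Z) (HD0 _ z F erefl hF)).
  apply: has_order_eq; apply: near_dnear; apply: near_imp hF.2 => t [_ [c c0 E]].
  rewrite /f E (ev_scale _ _ hP) (ev_scale _ _ (homog_linear_form a)) expr1.
  by rewrite -!exprnN exprMn invfM mulrACA mulfV ?mul1r // expf_neq0.
have := sumsD (abel tau_gt0 (D := fun y => D y + D0 y * - d%:Z) Hf) (sumsZ d%:Z S0).
rewrite !add0r mulrC; apply: eq_sums => y.
by rewrite mulrN subrK.
Qed.

(* [image_on_curve] for arbitrary forms. *)
Definition limit (Phi : 'I_n.+1 -> poly) iota x (q : vec) : Prop := exists z F G,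
  [/\ prj z = x, local_lift iota z F, holomorphic_vec_at G z,
    \forall t \near (z : C)^', proj_eq (\col_k ev (Phi k) (F t)) (G t)
    & proj_eq (G z) q].

Definition forms (Phi : 'I_n.+1 -> poly) (d : nat) := forall i : 'I_n.+1, homogeneous d (Phi i).

Lemma ev_col_scale Phi d (c : C) v : forms Phi d ->
  \col_k ev (Phi k) (c *: v) = c ^+ d *: \col_k ev (Phi k) v.
Proof. by move=> hP; apply/colP => k; rewrite !mxE (ev_scale _ _ (hP k)). Qed.

Lemma ev_col_proj Phi d v v' : forms Phi d -> proj_eq v v' ->
  \col_k ev (Phi k) v != 0 -> proj_eq (\col_k ev (Phi k) v) (\col_k ev (Phi k) v').
Proof.
move=> hP [_ [c c0 ->]] nz; rewrite (ev_col_scale _ _ hP).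
by apply: proj_eq_scale => //; exact: expf_neq0.
Qed.

Lemma proj_eq_limit F G z : holomorphic_vec_at F z -> holomorphic_vec_at G z ->
  F z != 0 -> G z != 0 -> (\forall t \near (z : C)^', proj_eq (F t) (G t)) -> proj_eq (F z) (G z).
Proof.
move=> hF hG F0 G0 E; apply: proj_eq_cross => // i j.
apply: (@ccont_eq _ (fun t => F t i 0 * G t j 0) (fun t => F t j 0 * G t i 0)).
- by apply: hol_at_ccont; apply: hol_atM; [exact: hF|exact: hG].
- by apply: hol_at_ccont; apply: hol_atM; [exact: hF|exact: hG].
- by apply: dnear_imp E => t; exact: cross_proj_eq.
Qed.

Lemma limit_data Phi d iota x q z F : forms Phi d -> limit Phi iota x q -> prj z = x ->
  local_lift iota z F -> exists G, [/\ holomorphic_vec_at G z,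
    \forall t \near (z : C)^', proj_eq (\col_k ev (Phi k) (F t)) (G t) & proj_eq (G z) q].
Proof.
move=> hP [z' [F' [G [z'x hF' hG E Gq]]]] zx hF.
have l0 : prj (z' - z) = 0 by rewrite raddfB /= zx z'x subrr.
have zE : z + (z' - z) = z' by rewrite addrC subrK.
exists (fun t => G (t + (z' - z))); split.
- by move=> i; apply: (@hol_at_shift (fun t => G t i 0)); rewrite zE; exact: hG.
- have hF2 : local_lift iota z (fun t => F' (t + (z' - z))) by apply: lift_shift; rewrite ?zE.
  have E2 : \forall t \near (z : C)^', proj_eq (\col_k ev (Phi k) (F' (t + (z' - z)))) (G (t + (z' - z))).
    by apply: (@dnear_shift (fun t => proj_eq (\col_k ev (Phi k) (F' t)) (G t))); rewrite zE.
  have EF := near_and hF.2 hF2.2.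
  apply: dnear_imp (dnear_and (near_dnear EF) E2) => t [[h1 h2] h3].
  apply: (proj_eq_trans (proj_eq_sym _) h3); apply: (ev_col_proj hP); last exact: proj_eq_neq0l h3.
  exact: (proj_eq_trans h2 (proj_eq_sym h1)).
- by rewrite zE.
Qed.

Lemma limit_uniq Phi d iota x q q' : forms Phi d -> limit Phi iota x q ->
  limit Phi iota x q' -> proj_eq q q'.
Proof.
move=> hP [z [F [G [zx hF hG E Gq]]]] L'.
have [G' [hG' E' Gq']] := limit_data hP L' zx hF.
apply: proj_eq_trans (proj_eq_sym Gq) (proj_eq_trans _ Gq').
apply: proj_eq_limit => //; try exact: proj_eq_neq0l.
- exact: proj_eq_neq0l Gq.
- exact: proj_eq_neq0l Gq'.
by apply: dnear_imp (dnear_and E E') => t [h1 h2]; exact: proj_eq_trans (proj_eq_sym h1) h2.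
Qed.

(** The scalar s absorbs the common zeros of the forms along the curve, and the remaining vector G,
    which does not vanish, lifts the image curve. *)
Lemma limit_lift Phi d iota iota1 : forms Phi d -> (forall x, limit Phi iota x (iota1 x)) ->
  forall z F, local_lift iota z F -> exists (G : C -> vec) (s : C -> C) (k : nat),
    [/\ local_lift iota1 z G, has_order s z k
      & \forall t \near (z : C)^', \col_k ev (Phi k) (F t) = s t *: G t].
Proof.
move=> hP H z F hF; have [G [hG E Gq]] := limit_data hP (H (prj z)) erefl hF.
have G0 := proj_eq_neq0l Gq; have [i Gi] := cV_neq0 G0.
have Gi_near := near_dnear (ccont_neq0 (hol_at_ccont (hG i)) Gi).
have lG : local_lift iota1 z G.
  split=> //; have hFn := lift_near hF; have En := dnear_near E.
  have hGn := hol_vec_near hG.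
  have Gn := ccont_neq0 (hol_at_ccont (hG i)) Gi.
  apply: near_imp (near_and (near_and hFn En) (near_and hGn Gn)) => t [[h1 h2] [h3 h4]].
  have Gt0 : G t != 0 by apply: contraNneq h4 => ->; rewrite mxE.
  apply: (limit_uniq hP _ (H (prj t))); exists t, F, G; split=> //.
  exact: proj_eq_refl.
have hs : holomorphic_at (fun t => ev (Phi i) (F t) * (G t i 0)^-1) z.
  by apply: hol_atM; [apply: ev_hol; case: hF|apply: hol_atV; [exact: hG|exact: Gi]].
have Es : \forall t \near (z : C)^', \col_k ev (Phi k) (F t) = (ev (Phi i) (F t) * (G t i 0)^-1) *: G t
    /\ ev (Phi i) (F t) * (G t i 0)^-1 != 0.
  apply: dnear_imp (dnear_and E Gi_near) => t [/proj_eq_sym[_ [c c0 Ec]] Gti].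
  have -> : ev (Phi i) (F t) = c * G t i 0.
    by have := congr1 (fun M : vec => M i 0) Ec; rewrite !mxE.
  by rewrite mulfK.
have [hs0|[k Hk]] := hol_has_order hs.
  have [t _ [[_ /eqP H1] H2]] := dnear_ex (dnear_and Es (near_dnear hs0)).
  by case: H1.
exists G, (fun t => ev (Phi i) (F t) * (G t i 0)^-1), k; split=> //.
by apply: dnear_imp Es => t [].
Qed.

(** Since a lift G does not vanish, k is the least order at x of the forms Phi_i along the curve;
    see [order_at_min]. *)
Definition order_at (Phi : 'I_n.+1 -> poly) iota iota1 x k : Prop :=
  exists z F G (s : C -> C), [/\ prj z = x, local_lift iota z F, local_lift iota1 z G,
    has_order s z k & \forall t \near (z : C)^', \col_i ev (Phi i) (F t) = s t *: G t].

Lemma limit_lifted Phi d iota iota1 : lifted iota -> forms Phi d ->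
  (forall x, limit Phi iota x (iota1 x)) -> lifted iota1.
Proof.
move=> hi hP H z; have [F hF] := hi z.
by have [G [_ [_ [hG _ _]]]] := limit_lift hP H hF; exists G.
Qed.

Lemma limit_order Phi d iota iota1 : lifted iota -> forms Phi d ->
  (forall x, limit Phi iota x (iota1 x)) ->
  exists o : T -> nat, forall x, order_at Phi iota iota1 x (o x).
Proof.
move=> hi hP H; have H' x : exists k : nat, order_at Phi iota iota1 x k.
  have [z zx] := to_torus_surj x; have [F hF] := hi z.
  have [G [s [k [hG Hs E]]]] := limit_lift hP H hF.
  by exists k, z, F, G, s.
by have [o Ho] := choice H'; exists o.
Qed.

Lemma corder_push Phi d e iota iota1 P x k l : forms Phi d -> homogeneous e P ->
  order_at Phi iota iota1 x k -> corder iota1 P x l ->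
  corder iota (subst Phi P) x (l + k * e%:Z).
Proof.
move=> hP he [z [F [G [s [zx hF hG Hs E]]]]] Hl.
apply: (corder_intro (homog_subst he hP) zx hF).
have := has_orderM (Hl z G zx hG) (has_order_expz e%:Z Hs); apply: has_order_eq.
by apply: dnear_imp E => t E; rewrite ev_subst E (ev_scale _ _ he) mulrC -exprnP.
Qed.

Lemma corder_pull Phi d e iota iota1 P x k l : forms Phi d -> homogeneous e P ->
  order_at Phi iota iota1 x k -> corder iota (subst Phi P) x l ->
  corder iota1 P x (l - k * e%:Z).
Proof.
move=> hP he [z [F [G [s [zx hF hG Hs E]]]]] Hl.
apply: (corder_intro he zx hG).
have := has_orderM (Hl z F zx hF) (has_order_expz (- e%:Z) Hs); rewrite mulrN.
apply: has_order_eq; have [f [hf f0 Ef]] := Hs.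
have s0 : \forall t \near (z : C)^', s t != 0.
  have fn := near_dnear (ccont_neq0 (hol_at_ccont hf) f0).
  have [d0 d00 Hd] := (dnearC_P _ _).1 (dnear_and Ef fn).
  apply/dnearC_P; exists d0 => // t tz td; have [-> ft] := Hd t tz td.
  by rewrite mulf_neq0 // subr_expz_neq0.
apply: dnear_imp (dnear_and E s0) => t [Et st]; rewrite ev_subst Et (ev_scale _ _ he).
by rewrite mulrAC -exprnN mulfV ?mul1r // expf_neq0.
Qed.

Lemma order_at_min Phi d iota iota1 x k (l : 'I_n.+1 -> int) : lifted iota -> lifted iota1 ->
  forms Phi d -> order_at Phi iota iota1 x k -> (forall i, corder iota (Phi i) x (l i)) ->
  (forall i, k <= l i) /\ exists i, l i = k.
Proof.
move=> hi hi1 hP Ho Hl.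
have V i : corder iota1 (@var C n i) x (l i - k).
  have := @corder_pull Phi d 1 iota iota1 (@var C n i) x k (l i) hP (homog_var _ i) Ho.
  by rewrite subst_var mulr1; apply; exact: Hl.
split=> [i|]; first by have := corder_ge0 hi1 (V i); rewrite subr_ge0.
have [z zx] := to_torus_surj x; have [G hG] := hi1 z.
have [i Gi] := cV_neq0 (lift_neq0 hG); exists i.
have := has_order_uniq (V i z G zx hG); move/(_ 0) => H.
apply/eqP; rewrite -subr_eq0; apply/eqP/H/has_order0; first by apply: ev_hol; case: hG.
by rewrite /ev meval_var.
Qed.

(** Dividing all coordinates by (t - z)^o keeps them holomorphic and makes the [i0]-th one nonzero
    at z. *)
Lemma limit_exists Phi iota x (o : int) (l : 'I_n.+1 -> int) i0 : lifted iota ->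
  (forall i, corder iota (Phi i) x (l i)) -> (forall i, o <= l i) -> l i0 = o ->
  exists q, limit Phi iota x q.
Proof.
move=> hi Hl ol li0; have [z zx] := to_torus_surj x; have [F hF] := hi z.
have [g Hg] := choice (fun i => Hl i z F zx hF).
pose G t : vec := \col_i ((t - z) ^+ absz (l i - o)%R * g i t).
have hG : holomorphic_vec_at G z.
  move=> i; have [hgi _ _] := Hg i.
  apply: (@hol_at_eq _ (fun t => (t - z) ^+ absz (l i - o)%R * g i t)).
    by apply/nearC_P; exists 1 => // t _; rewrite mxE.
  by apply: hol_atM; [apply: hol_atX; exact: hol_at_subr|exact: hgi].
have E : \forall t \near (z : C)^', \col_k ev (Phi k) (F t) = (t - z) ^ o *: G t.
  have near_i i : \forall t \near (z : C)^', ev (Phi i) (F t) = (t - z) ^ l i * g i t.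
    by have [_ _ Ei] := Hg i.
  have [d d0 Hd] := (dnearC_P _ _).1 (dnear_forall near_i).
  apply/dnearC_P; exists d => // t tz td; apply/colP => i; rewrite !mxE (Hd t tz td).
  rewrite mulrA exprnP -expfzDr ?subr_eq0 //; congr (_ ^ _ * _).
  by have := ol i; lia.
have Gi0 : G z i0 0 != 0.
  by rewrite mxE li0 (subrr (o : int)) absz0 expr0 mul1r; have [_ ? _] := Hg i0.
have G0 : G z != 0 by apply: contraNneq Gi0 => ->; rewrite mxE.
exists (G z), z, F, G; split=> //; last exact: proj_eq_refl.
have Gn := near_dnear (ccont_neq0 (hol_at_ccont (hG i0)) Gi0).
have [d d0 Hd] := (dnearC_P _ _).1 (dnear_and E Gn).
apply/dnearC_P; exists d => // t tz td; have [-> Gt] := Hd t tz td.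
have Gt0 : G t != 0 by apply: contraNneq Gt => ->; rewrite mxE.
by apply/proj_eq_sym/proj_eq_scale => //; exact: subr_expz_neq0.
Qed.

Lemma effective_degree1 (E : T -> int) s : sums E 1 s -> (forall x, 0 <= E x) ->
  forall x, E x = (x == s)%:Z.
Proof.
move=> [l [ul E0 S1 Ss]] Epos.
have [x0 x0l Ex0] : exists2 x0, x0 \in l & 0 < E x0.
  apply: contrapT => H; have : \sum_(x <- l) E x = 0.
    rewrite big_seq big1 // => x xl; apply/eqP; rewrite eq_le Epos andbT leNgt.
    by apply/negP => h; apply: H; exists x.
  by rewrite S1.
have rest : forall x, x != x0 -> E x = 0.
  move=> x xx0; have [xl|xl] := boolP (x \in l); last exact: E0.
  have : \sum_(i <- l | i != x0) E i == 0.
    have : 0 <= \sum_(i <- l | i != x0) E i by apply: sumr_ge0.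
    have := S1; rewrite (bigD1_seq x0) //=; move: (\sum_(i <- l | _) _) Ex0 => b; lia.
  rewrite psumr_eq0 => [/allP/(_ x xl)|i _]; last exact: Epos.
  by rewrite xx0 => /eqP.
have E1 : E x0 = 1.
  have := S1; rewrite (bigD1_seq x0) //= big1 ?addr0 // => x; exact: rest.
have -> : s = x0.
  by rewrite -Ss (bigD1_seq x0) //= E1 mulr1z big1 ?addr0 // => x /rest ->; rewrite mulr0z.
by move=> x; have [->|/rest ->] := eqVneq x x0; rewrite ?E1.
Qed.

Lemma sum_mem (r : seq T) y : uniq r -> \sum_(p <- r) (y == p)%:Z = (y \in r)%:Z.
Proof.
move=> ur; rewrite -(count_uniq_mem y ur); elim: r {ur} => [|p r IH]; first by rewrite big_nil.
by rewrite big_cons IH /= PoszD eq_sym.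
Qed.

(** A hyperplane section has degree n + 1 and sum s. Removing n known points leaves an effective
    divisor of degree 1, hence a point, which the sum determines. *)
Lemma hyperplane_residual iota s (a : 'rV[C]_n.+1) (r : seq T) x k : lifted iota ->
  (forall x, iota x != 0) -> hyperplane_sum iota s -> corder iota (linear_form a) x k ->
  uniq r -> size r = n -> (forall y, y \in r -> ev (linear_form a) (iota y) = 0) ->
  forall y, corder iota (linear_form a) y ((y \in r)%:Z + (y == s - \sum_(p <- r) p)%:Z).
Proof.
move=> hi i0 hs Hx ur sr Hr; have ha := homog_linear_form a.
have [D [HD SD]] := corder_sums hi hs ha Hx.
have Sr : sums (fun y => (y \in r)%:Z) n (\sum_(p <- r) p).
  have := @sums_sum _ _ _ r predT (fun p y => (y == p)%:Z) (fun=> 1) id (fun p => sums_point p).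
  have -> : \sum_(i <- r) (1 : int) = n by rewrite big_const_seq count_predT sr iter_addr_0 natz.
  by apply: eq_sums => y; exact: sum_mem.
have SE : sums (fun y => D y - (y \in r)%:Z) 1 (s - \sum_(p <- r) p).
  have := sumsD SD (sumsZ (-1) Sr); rewrite mulr1z mulrN1z mulrN1 mul1r.
  by rewrite [n.+1%:Z]intS -addrA subrr addr0; apply: eq_sums => y; rewrite mulrN1.
move=> y; rewrite -(effective_degree1 SE); first by rewrite addrC subrK.
move=> p; rewrite subr_ge0; case: (boolP (p \in r)) => pr; last exact: corder_ge0 (HD p).
exact: corder_root hi ha (i0 p) (Hr p pr) (HD p).
Qed.

End Curve.

(** * The action of a word on the curve *)

Section Words.
Variable R : realType.
Local Notation C := (complexes R).
Local Notation Im := (@complex.Im R).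
Variable tau : C.
Hypothesis tau_gt0 : 0 < Im tau.
Local Notation T := (torus tau).
Local Notation prj := (to_torus tau).
Variables (n m : nat) (hm : (n.+2 <= m)%N).
Local Notation poly := (mpoly n.+1 C).
Local Notation vec := 'cV[C]_n.+1.
Implicit Types (A : 'M[C]_(n.+1, m)) (P Q : poly) (iota : T -> vec) (x y : T) (z : C)
  (u : 'I_m -> T) (D : H2 m) (s : T).

#[local] Opaque holomorphic_at.
Local Notation fst := (first hm).

Lemma lifted_neq0 iota x : lifted iota -> iota x != 0.
Proof.
move=> hi; have [z <-] := to_torus_surj x; have [F [_ /near_self E]] := hi z.
exact: proj_eq_neq0r E.
Qed.

Lemma ev_neq0_proj P d (v v' : vec) : homogeneous d P -> proj_eq v v' ->
  (ev P v != 0) = (ev P v' != 0).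
Proof.
move=> hP [_ [c c0 ->]]; rewrite (ev_scale _ _ hP) mulf_eq0 expf_eq0 (negPf c0).
by rewrite andbF.
Qed.

Definition good A iota u s : Prop :=
  [/\ lifted iota, forall j, proj_eq (iota (u j)) (col j A) & hyperplane_sum iota s].

Lemma columns_distinct A (i j : 'I_m) : in_X A -> (0 < n)%N -> i != j ->
  ~ proj_eq (col i A) (col j A).
Proof.
move=> hA n0 ij [_ [c c0 E]].
have n1 : (1 < n.+1)%N by [].
pose a : 'I_n.+1 := ord0; pose b : 'I_n.+1 := Ordinal n1.
have ab : a != b by [].
(* Two transpositions send the first two column indices to i and j, which gives a minor with two
   proportional columns. *)
pose p := tperm (fst a) i; pose p' := tperm (p (fst b)) j.
pose f (k : 'I_n.+1) := p' (p (fst k)).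
have fi : injective f by move=> k l /perm_inj/perm_inj/first_inj.
have pa : p (fst a) = i by rewrite /p tpermL.
have pb : i != p (fst b).
  by apply/eqP => e; move/eqP: ab; apply; exact: first_inj (perm_inj (etrans pa e)).
have fa : f a = i by rewrite /f pa /p' tpermD // eq_sym.
have fb : f b = j by rewrite /f /p' tpermL.
have := hA f fi; apply/negP; rewrite negbK -det_tr; apply/det0P.
exists (c *: delta_mx 0 a - delta_mx 0 b).
  apply/eqP => /rowP/(_ a); rewrite !mxE !eqxx (negPf ab) /= subr0 mulr1 => /eqP.
  by rewrite (negPf c0).
apply/rowP => k; rewrite mulmxBl -scalemxAl -!rowE !mxE fa fb.
by have := congr1 (fun M : vec => M k 0) E; rewrite !mxE => ->; rewrite subrr.
Qed.

Lemma good_inj A iota u s : good A iota u s -> in_X A -> (0 < n)%N -> injective u.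
Proof.
move=> [_ hu _] hA n0 i j E; apply/eqP/negPn/negP => ij.
apply: (columns_distinct hA n0 ij); apply: proj_eq_trans (proj_eq_sym (hu i)) _.
by rewrite E; exact: hu.
Qed.

(* The points P_1, ..., P_(n+1) span the projective space. *)
Lemma linear_corder A iota u s (a : 'rV[C]_n.+1) x : good A iota u s -> in_X A -> a != 0 ->
  exists k, corder iota (linear_form a) x k.
Proof.
move=> [hi hu _] hA a0; have ha := homog_linear_form a.
have [k ak] : exists k, (a *m left_block hm A) 0 k != 0.
  apply: contrapT => H; move/eqP: a0; apply.
  rewrite -[a](mulmxK (left_unit hm hA)) (_ : a *m _ = 0) ?mul0mx //.
  by apply/rowP => k; rewrite [RHS]mxE; apply/eqP/negPn/negP => h; apply: H; exists k.
have H : ev (linear_form a) (iota (u (fst k))) != 0.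
  rewrite (ev_neq0_proj ha (hu _)) ev_linear col_first.
  by move: ak; rewrite !mxE; under [in X in _ -> X]eq_bigr do rewrite mxE.
exact: (corder_exists tau_gt0 (P := linear_form a) hi ha (corder_eq0 hi ha H) x).
Qed.

Lemma exists_hyperplane iota (r : seq T) : size r = n ->
  exists2 a : 'rV[C]_n.+1, a != 0 & forall p, p \in r -> ev (linear_form a) (iota p) = 0.
Proof.
move=> sr; pose M : 'M[C]_(n.+1, n) := \matrix_(i, j) iota (nth 0 r j) i 0.
have : kermx M != 0.
  by rewrite kermx_eq0 /row_free neq_ltn ltnS rank_leq_col.
case/rowV0Pn => a /sub_kermxP aM a0; exists a => // p pr; rewrite ev_linear.
have pn : (index p r < n)%N by rewrite -sr index_mem.
have := congr1 (fun N : 'rV_n => N 0 (Ordinal pn)) aM; rewrite [RHS]mxE => E.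
by rewrite -[RHS]E !mxE; apply: eq_bigr => i _; rewrite !mxE /= nth_index.
Qed.

(* Take the hyperplane through x and n - 1 of the points P_j; two choices of these are
   needed to move the residual point away from y. *)
Lemma separation A iota u s x y : good A iota u s -> in_X A -> (1 < n)%N ->
  exists a : 'rV[C]_n.+1, ev (linear_form a) (iota x) = 0
    /\ corder iota (linear_form a) y (y == x)%:Z.
Proof.
move=> hg hA n1; have ui := good_inj hg hA (ltnW n1); have [hi _ hs] := hg.
pose S j := (u j != x) && (u j != y).
pose r0 := map u (seq.filter S (enum 'I_m)).
have ur0 : uniq r0 by rewrite map_inj_uniq // filter_uniq // enum_uniq.
(* At most two of the m >= n + 2 distinct points u_j are equal to x or y. *)
have sr0 : (n <= size r0)%N.
  rewrite size_map; have := count_predC S (enum 'I_m); rewrite -!size_filter size_enum_ord.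
  have : (size (map u (seq.filter (predC S) (enum 'I_m))) <= size [:: x; y])%N.
    apply: uniq_leq_size; first by rewrite map_inj_uniq // filter_uniq // enum_uniq.
    move=> p /mapP[j]; rewrite mem_filter /S /= negb_and !negbK !inE => /andP[H _] ->.
    exact: H.
  by rewrite size_map /=; move: hm; lia.
have r0P p : p \in r0 -> (p != x) && (p != y).
  by move=> /mapP[j]; rewrite mem_filter => /andP[H _] ->.
have : size (take n r0) = n by rewrite size_takel.
have : uniq (take n r0) by exact: take_uniq.
have : forall p, p \in take n r0 -> (p != x) && (p != y) by move=> p /mem_take; exact: r0P.
case: (take n r0) => [|p1 [|p2 t]] tP; [by move=> _ n0; exfalso; move: n1; rewrite -n0| |].
  by move=> _ n0; exfalso; move: n1; rewrite -n0.
move=> ut st.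
have one p : p != x -> p != y -> uniq (p :: t) -> (forall q, q \in t -> (q != x) && (q != y)) ->
    exists a : 'rV[C]_n.+1, ev (linear_form a) (iota x) = 0 /\
    corder iota (linear_form a) y ((y == x)%:Z + (y == s - \sum_(q <- [:: x, p & t]) q)%:Z).
  move=> px py upt tP'.
  have [a a0 Ha] := @exists_hyperplane iota [:: x, p & t] st.
  have [k Hk] := linear_corder x hg hA a0.
  have ux : uniq [:: x, p & t].
    rewrite cons_uniq upt andbT inE negb_or eq_sym px; apply/negP => /tP'.
    by rewrite eqxx.
  exists a; split; first by apply: Ha; rewrite inE eqxx.
  have H := hyperplane_residual tau_gt0 hi (fun q => lifted_neq0 q hi) hs Hk ux st Ha.
  have := H y; rewrite !inE [y == p]eq_sym (negPf py) /=.
  by have [yt|_] := boolP (y \in t); [have := tP' y yt; rewrite eqxx andbF|rewrite orbF].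
have [/andP[p1x p1y] /andP[p2x p2y]] : (p1 != x) && (p1 != y) /\ (p2 != x) && (p2 != y).
  by split; apply: tP; rewrite !inE eqxx ?orbT.
have tP' q : q \in t -> (q != x) && (q != y) by move=> qt; apply: tP; rewrite !inE qt !orbT.
move: ut; rewrite /= !inE negb_or => /andP[/andP[p12 p1t] /andP[p2t ut]].
have u1 : uniq (p1 :: t) by rewrite /= p1t.
have u2 : uniq (p2 :: t) by rewrite /= p2t.
have [a1 [E1 H1]] := one p1 p1x p1y u1 tP'.
have [a2 [E2 H2]] := one p2 p2x p2y u2 tP'.
case: (eqVneq y (s - \sum_(q <- [:: x, p1 & t]) q)) H1 => [y1 _|_ H1]; last first.
  by exists a1; split=> //; rewrite -[(y == x)%:Z]addr0.
case: (eqVneq y (s - \sum_(q <- [:: x, p2 & t]) q)) H2 => [y2 _|_ H2]; last first.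
  by exists a2; split=> //; rewrite -[(y == x)%:Z]addr0.
(* If both residual points were y, the two sums would agree and force p1 = p2. *)
move/eqP: p12; case; move: y1; rewrite y2 !big_cons => /addrI/oppr_inj/addrI/addIr.
exact: esym.
Qed.

Lemma corder_neq0 iota P x (k : int) : lifted iota -> corder iota P x k -> P != 0.
Proof.
move=> hi Hk; apply/eqP => P0; have [z zx] := to_torus_surj x; have [F hF] := hi z.
apply: (has_order_vanish (Hk z F zx hF)); apply/dnearC_P; exists 1 => // t _ _.
by rewrite /ev P0 meval0.
Qed.

Lemma corder_factor iota P Q d x (k : int) : lifted iota -> homogeneous d P ->
  corder iota (P * Q) x k -> exists l : nat, corder iota P x l.
Proof.
move=> hi hP Hk; have [z zx] := to_torus_surj x; have [F hF] := hi z.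
apply: (corder_lift tau_gt0 hP zx hF) => E; apply: (has_order_vanish (Hk z F zx hF)).
by apply: near_dnear; apply: near_imp E => t E; rewrite evM E mul0r.
Qed.

(* The order at x of the fixed part sum_j -D_j u_j of the restriction of the class D
   to the curve. *)
Definition base_order u D x : int := \sum_(j < m) - D 0 (lift ord0 j) * (x == u j)%:Z.

(* Sections of class D whose restrictions to the curve have no base point apart from
   those imposed by the multiplicities. *)
Definition tight A iota u D (I : Type) (f : I -> poly) : Prop :=
  (forall i, sect A D (f i)) /\ forall x, exists i, corder iota (f i) x (base_order u D x).

(** Quantifying over all families and classes makes the property stable under composition, see
    [transforms_comp]. The common factor M must have an order everywhere on the curve, so that
    orders can be subtracted. *)
Definition pulls_back A iota u A' iota' u' (Phi : 'I_n.+1 -> poly) (w : H2 m -> H2 m) : Prop :=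
  forall (I : Type) (f : I -> poly) D, tight A' iota' u' D f ->
  exists (F : I -> poly) M e, [/\ tight A iota u (w D) F, homogeneous e M,
    forall x, exists k : int, corder iota M x k & forall i, subst Phi (f i) = F i * M].

Lemma base_order_split u D x : base_order u D x =
  \sum_(k < n.+1) mult_first hm D k * (x == u (fst k))%:Z
  + \sum_(j < m | ~~ (j < n.+1)%N) - D 0 (lift ord0 j) * (x == u j)%:Z.
Proof.
rewrite /base_order (bigID (fun j : 'I_m => (j < n.+1)%N)) /=; congr (_ + _).
rewrite big_ord_narrow ?(ltnW hm) // => le; apply: eq_bigr => k _.
by rewrite (bool_irrelevance le (ltnW hm)).
Qed.

Lemma sect_zero A D F : sect A D F -> sect A D 0.
Proof.
case=> d [D0 _ _]; exists d; split=> //; first exact: homog0.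
by move=> j k _; apply/mult_geE; rewrite raddf0; exact: lo_zero.
Qed.

(** * One Cremona transformation along the curve *)

Section CremonaStep.
Variables (A : 'M[C]_(n.+1, m)) (iota : T -> vec) (u : 'I_m -> T) (s : T).
Hypotheses (hg : good A iota u s) (hA : in_X A) (n0 : (0 < n)%N).
Local Notation A1 := (gen_matrix hm Cremona A).

Let hi : lifted iota. Proof. by case: hg. Qed.
Let hu j : proj_eq (iota (u j)) (col j A). Proof. by case: hg. Qed.
Let hs : hyperplane_sum iota s. Proof. by case: hg. Qed.
Let ui : injective u. Proof. exact: good_inj hg hA n0. Qed.

(** The last intersection of the curve with the hyperplane through the first n + 1 points other than
    the i-th. The transformation contracts this hyperplane to the i-th vertex, so this is the new
    parameter of index i. *)
Definition residual (i : 'I_n.+1) : T := s - \sum_(l < n.+1 | l != i) u (fst l).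

(** By injectivity of u this is the indicator function of the first n + 1 points. *)
Definition vertices y : int := \sum_(l < n.+1) (y == u (fst l))%:Z.

Lemma ev_lin_u i j : (ev (lin hm A i) (iota (u j)) != 0) = (normal hm A i j != 0).
Proof.
by rewrite (ev_neq0_proj (homog_lin hm A i) (hu j)) -meval_lin_colE.
Qed.

Lemma lin_linear_form i : lin hm A i = linear_form (row i (invmx (left_block hm A))).
Proof. by apply: eq_bigr => l _; rewrite mxE. Qed.

Lemma lin_order i y : corder iota (lin hm A i) y
  (vertices y - (y == u (fst i))%:Z + (y == residual i)%:Z).
Proof.
pose r := [seq u (fst l) | l <- index_enum 'I_n.+1 & l != i].
have ur : uniq r.
  rewrite map_inj_uniq; first by rewrite filter_uniq // index_enum_uniq.
  by move=> l l' /ui /first_inj.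
have sr : size r = n.
  by rewrite size_map size_filter -sum1_count sum1_card cardC1 card_ord.
have Hr p : p \in r -> ev (lin hm A i) (iota p) = 0.
  move=> /mapP[l]; rewrite mem_filter => /andP[li _] ->; apply/eqP/negPn.
  by rewrite ev_lin_u normal_first_E // [i == l]eq_sym (negPf li) eqxx.
have E : (y \in r)%:Z = vertices y - (y == u (fst i))%:Z.
  rewrite -sum_mem // big_map big_filter /vertices [in RHS](bigD1 i) //=.
  by rewrite addrAC subrr add0r.
have Er : residual i = s - \sum_(p <- r) p by rewrite big_map big_filter.
have a0 : row i (invmx (left_block hm A)) != 0.
  apply/eqP => a0; have := ev_lin_u i (fst i).
  by rewrite lin_linear_form a0 ev_linear mul0mx mxE eqxx normal_first_E // eqxx oner_eq0.
have [k Hk] := linear_corder y hg hA a0.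
rewrite -E Er lin_linear_form.
have Hr' p : p \in r -> ev (linear_form (row i (invmx (left_block hm A)))) (iota p) = 0.
  by rewrite -lin_linear_form; exact: Hr.
have H := hyperplane_residual tau_gt0 hi (fun q => lifted_neq0 q hi) hs Hk ur sr Hr'.
exact: H y.
Qed.

Arguments lin_order : clear implicits.

Lemma vertices_first i : vertices (u (fst i)) = 1.
Proof.
rewrite /vertices (bigD1 i) //= eqxx big1 // => l li.
by rewrite (inj_eq ui) (inj_eq (@first_inj _ _ hm)) eq_sym (negPf li).
Qed.

Lemma residual_neq i : residual i != u (fst i).
Proof.
apply/eqP => E; have := lin_order i (u (fst i)); rewrite vertices_first E eqxx subrr add0r.
have : corder iota (lin hm A i) (u (fst i)) 0.
  by apply: (corder_eq0 hi (homog_lin hm A i)); rewrite ev_lin_u normal_first_E // eqxx oner_eq0.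
by move=> h0 h1; have := corder_uniq hi h0 h1.
Qed.

Lemma residual_inj : injective residual.
Proof.
move=> i j /addrI/oppr_inj E; apply: (@first_inj _ _ hm); apply: ui.
have := erefl (\sum_(l < n.+1) u (fst l)).
by rewrite {1}(bigD1 i) //= [RHS](bigD1 j) //= E => /addIr.
Qed.

(** At the l-th of the first n + 1 points every linear factor except the l-th vanishes: n - 1 of the
    factors if l <> i, all n if l = i. Each factor also vanishes at its residual point. *)
Definition crem_order i y : int := (n%:Z - 1) * vertices y + (y == u (fst i))%:Z
  + \sum_(l < n.+1 | l != i) (y == residual l)%:Z.

Lemma crem_orderP i y : corder iota (crem hm A i) y (crem_order i y).
Proof.
have := @corder_prod _ _ _ iota _ (index_enum 'I_n.+1) (fun l => l != i) _ _ y (fun l _ => lin_order l y).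
rewrite -/(crem hm A i); set k := \sum_(l <- _ | _) _; suff -> : k = crem_order i y by [].
rewrite /k big_split /= sumrB /crem_order; congr (_ + _).
have -> : \sum_(l < n.+1 | l != i) (y == u (fst l))%:Z = vertices y - (y == u (fst i))%:Z.
  by rewrite /vertices [in RHS](bigD1 i) //= addrAC subrr add0r.
rewrite sumr_const (_ : #|_| = n) ?cardC1 ?card_ord //.
by rewrite -mulr_natr natz opprB mulrBl mul1r; ring.
Qed.

Arguments crem_orderP : clear implicits.

Lemma crem_order_ge i y : (n%:Z - 1) * vertices y <= crem_order i y.
Proof.
rewrite /crem_order -addrA lerDl addr_ge0 //; exact: sumr_ge0.
Qed.

(** The forms have no further common zero on the curve: at the l-th residual point take i = l; at
    the l-th vertex, if it is not a residual point, take any i <> l. *)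
Lemma crem_order_min y : exists i, crem_order i y = (n%:Z - 1) * vertices y.
Proof.
suff [i [yu yq]] : exists i, y != u (fst i) /\ forall l, l != i -> y != residual l.
  exists i; rewrite /crem_order (negPf yu) addr0 big1 ?addr0 // => l li.
  by rewrite (negPf (yq l li)).
have [[l yl]|H] := pselect (exists l, y = residual l).
  exists l; rewrite yl residual_neq; split=> // l' l'l.
  by rewrite (inj_eq residual_inj) eq_sym.
have Hq l : y != residual l by apply/eqP => e; apply: H; exists l.
have [[l yl]|Hu] := pselect (exists l, y = u (fst l)); last first.
  by exists ord0; split=> //; apply/eqP => e; apply: Hu; exists ord0.
have n1 : (1 < n.+1)%N by [].
have [i il] : exists i : 'I_n.+1, i != l.
  by have [->|] := eqVneq l ord0; [exists (Ordinal n1)|exists ord0; rewrite eq_sym].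
exists i; split=> //; rewrite yl (inj_eq ui) (inj_eq (@first_inj _ _ hm)) eq_sym.
exact: il.
Qed.

Lemma forms_crem : forms (crem hm A) n.
Proof. by move=> i; exact: homog_crem. Qed.

Lemma crem_limit_exists : exists iota1, forall x, limit (crem hm A) iota x (iota1 x).
Proof.
have H x : exists q, limit (crem hm A) iota x q.
  have [i0 E0] := crem_order_min x.
  exact: (limit_exists tau_gt0 hi (fun i => crem_orderP i x) (fun i => crem_order_ge i x) E0).
by have [iota1 H1] := choice H; exists iota1.
Qed.

Variable iota1 : T -> vec.
Hypothesis Hlim : forall x, limit (crem hm A) iota x (iota1 x).

Let hi1 : lifted iota1. Proof. exact: limit_lifted tau_gt0 _ _ _ _ _ hi forms_crem Hlim. Qed.

Lemma crem_order_at x : order_at (crem hm A) iota iota1 x ((n%:Z - 1) * vertices x).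
Proof.
have [o Ho] := limit_order tau_gt0 hi forms_crem Hlim.
suff <- : (o x)%:Z = (n%:Z - 1) * vertices x by exact: Ho.
have [H [i Hi]] := order_at_min tau_gt0 hi hi1 forms_crem (Ho x) (fun i => crem_orderP i x).
have [i' Hi'] := crem_order_min x.
apply/eqP; rewrite eq_le -{1}Hi' H /= -Hi; exact: crem_order_ge.
Qed.

Lemma var_order i x : corder iota1 (@var C n i) x
  ((x == u (fst i))%:Z + \sum_(l < n.+1 | l != i) (x == residual l)%:Z).
Proof.
have := @corder_pull _ _ _ _ n 1 iota iota1 (@var C n i) x _ (crem_order i x) forms_crem
  (homog_var _ i) (crem_order_at x).
rewrite subst_var => /(_ (crem_orderP i x)).
rewrite (_ : crem_order i x - _ = (x == u (fst i))%:Z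
  + \sum_(l < n.+1 | l != i) (x == residual l)%:Z) //.
rewrite /crem_order mulr1; move: (_ * vertices x) (\sum_(l < n.+1 | _) _) => V S.
by rewrite addrAC [V + _]addrC addrK.
Qed.

Arguments var_order : clear implicits.

Definition cremona_points (j : 'I_m) : T :=
  if (j < n.+1)%N then residual (inord j) else u j.

Lemma cremona_points_first i : cremona_points (fst i) = residual i.
Proof. by rewrite /cremona_points first_lt inord_val. Qed.

(** By [var_order], the hyperplane X_0 = 0 cuts the image curve at the 0-th old point and at the n
    residual points of index other than 0; their sum is the new hyperplane sum. *)
Lemma good_cremona : exists s1, good A1 iota1 cremona_points s1.
Proof.
exists (u (fst ord0) + \sum_(l < n.+1 | l != ord0) residual l); split=> //.
  move=> j; have [jn|nj] := ltnP j n.+1.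
    have [i ->] := firstP hm jn; rewrite cremona_points_first cremona_first.
    (* At the i-th residual point all coordinates but the i-th vanish, so the image is the i-th
       vertex. *)
    have E0 l : l != i -> iota1 (residual i) l 0 = 0.
      move=> li; apply/eqP/negPn/negP => nz.
      have h0 : corder iota1 (@var C n l) (residual i) 0.
        by apply: (corder_eq0 hi1 (homog_var _ l)); rewrite /ev meval_var.
      have il : i != l by rewrite eq_sym.
      have := corder_uniq hi1 (var_order l (residual i)) h0; rewrite (bigD1 i il) /= eqxx.
      have : 0 <= \sum_(i0 < n.+1 | (i0 != l) && (i0 != i)) (residual i == residual i0)%:Z :> int.
        exact: sumr_ge0.
      by move: (\sum_(i0 < _ | _) _) (_ == u _) => S [] /=; lia.
    have ne := lifted_neq0 (residual i) hi1.
    have Ei : iota1 (residual i) = iota1 (residual i) i 0 *: delta_mx i 0.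
      apply/colP => l; rewrite !mxE andbT; case: eqP => [->|/eqP/E0 ->]; rewrite ?mulr1 ?mulr0 //.
    have c0 : iota1 (residual i) i 0 != 0.
      by apply: contraNneq ne => c0; rewrite Ei c0 scale0r.
    rewrite Ei; apply: proj_eq_sym; apply: proj_eq_scale => //.
    by apply/eqP => /colP/(_ i); rewrite !mxE eqxx => /eqP; rewrite oner_eq0.
  (* At the remaining P_j the Cremona forms are not all zero, so the limit is obtained by plain
     evaluation. *)
  rewrite /cremona_points ltnNge nj /=; apply: (limit_uniq forms_crem (Hlim (u j))).
  have [z zx] := to_torus_surj (u j); have [F hF] := hi z.
  pose G t : vec := \col_k ev (crem hm A k) (F t).
  have hG : holomorphic_vec_at G z.
    move=> i; apply: (@hol_at_eq _ (fun t => ev (crem hm A i) (F t))).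
      by apply/nearC_P; exists 1 => // t _; rewrite mxE.
    by apply: ev_hol; case: hF.
  have p0 : \prod_i normal hm A i j != 0.
    by apply/prodf_neq0 => i _; exact: normal_neq0.
  have FP : proj_eq (F z) (col j A).
    by apply: proj_eq_trans (near_self hF.2) _; rewrite zx.
  have A10 : col j A1 != 0.
    apply/eqP => E; have := congr1 (fun M : vec => M ord0 0) E.
    rewrite [LHS]mxE cremona_other // [RHS]mxE => /eqP; rewrite invr_eq0.
    by apply/negP; exact: normal_neq0.
  have GP : proj_eq (G z) (col j A1).
    have E : \col_k ev (crem hm A k) (col j A) = (\prod_i normal hm A i j) *: col j A1.
      exact: meval_crem_col.
    apply: proj_eq_sym; apply: (@proj_eq_trans _ _ _ (\col_k ev (crem hm A k) (col j A))).
      by rewrite E; apply: proj_eq_scale.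
    apply: (ev_col_proj forms_crem (proj_eq_sym FP)).
    by rewrite E scaler_eq0 negb_or p0.
  exists z, F, G; split=> //.
  have [i Gi] := cV_neq0 (proj_eq_neq0l GP).
  apply: dnear_imp (near_dnear (ccont_neq0 (hol_at_ccont (hG i)) Gi)) => t Gt.
  by apply: proj_eq_refl; apply: contraNneq Gt => E; rewrite /G E mxE.
have El : linear_form (delta_mx 0 ord0) = @var C n ord0.
  rewrite /linear_form (bigD1 ord0) //= mxE !eqxx scale1r big1 ?addr0 // => i i0.
  by rewrite mxE (negPf i0) andbF scale0r.
exists (delta_mx 0 ord0), (fun x => (x == u (fst ord0))%:Z + \sum_(l < n.+1 | l != ord0) (x == residual l)%:Z).
split; first by move=> x; rewrite El; exact: var_order.
rewrite [n.+1%:Z]intS; apply: sumsD; first exact: sums_point.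
have := @sums_sum _ _ _ (index_enum 'I_n.+1) (fun l => l != ord0) (fun l x => (x == residual l)%:Z)
  (fun=> 1) residual (fun l => sums_point _).
by rewrite sumr_const cardC1 card_ord natz.
Qed.

(** The factor divided out in [sect_cremona] is a product of adapted linear forms, whose orders on
    the curve are known from [lin_order]; they account for all the zeros that pull-back adds. *)
Lemma tight_cremona : in_X A1 ->
  pulls_back A iota u A1 iota1 cremona_points (crem hm A) (reflection n Cremona).
Proof.
move=> hA1 I f D [sf tf]; have [s1 hg1] := good_cremona.
have u1i := good_inj hg1 hA1 n0.
(* Some member has exactly this order at the k-th new point, so the multiplicity is nonnegative and
   the negative powers in [sect_cremona] are trivial. *)
have base_q k : base_order cremona_points D (residual k) = mult_first hm D k.
  rewrite /base_order (bigD1 (fst k)) //= cremona_points_first eqxx mulr1 big1 ?addr0 // => j jk.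
  by rewrite -cremona_points_first (inj_eq u1i) eq_sym (negPf jk) mulr0.
have mu_ge0 k : 0 <= mult_first hm D k.
  by have [i Hi] := tf (residual k); rewrite -base_q; exact: corder_ge0 tau_gt0 _ _ _ _ _ hi1 Hi.
have pos k : (posz (mult_first hm D k))%:Z = mult_first hm D k.
  by have := mu_ge0 k; case: (mult_first hm D k).
have neg k : posz (- mult_first hm D k) = 0%N.
  by have := mu_ge0 k; case: (mult_first hm D k) => [[|e]|e].
pose M := \prod_k lin hm A k ^+ posz (mult_first hm D k).
have neg1 : \prod_k lin hm A k ^+ posz (- mult_first hm D k) = 1.
  by rewrite big1 // => k _; rewrite neg expr0.
(* A nonzero member shows that the reflected class has nonnegative degree, so that zero members can
   be pulled back to the zero section. *)
have [i0 Hi0] := tf (u (fst ord0)).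
have [F0 [sF0 _ _]] := sect_cremona hA (corder_neq0 hi1 Hi0) (sf i0).
have HF i : exists F1, sect A (reflection n Cremona D) F1 /\ subst (crem hm A) (f i) = F1 * M.
  have [fi0|fi0] := eqVneq (f i) 0.
    by exists 0; split; [exact: sect_zero sF0|rewrite fi0 mul0r raddf0].
  have [F1 [sF1 _ rel]] := sect_cremona hA fi0 (sf i).
  by exists F1; split=> //; rewrite /M rel neg1 mulr1.
have [F /all_and2[sF relF]] := choice HF.
have MO x : corder iota M x (\sum_k (vertices x - (x == u (fst k))%:Z + (x == residual k)%:Z)
    * mult_first hm D k).
  have := @corder_prod _ _ _ iota _ (index_enum 'I_n.+1) predT _ _ x
    (fun l _ => corderX (posz (mult_first hm D l)) (lin_order l x)).
  set S := (X in corder _ _ _ X -> _) => H.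
  have ES : S = \sum_k (vertices x - (x == u (fst k))%:Z + (x == residual k)%:Z) * mult_first hm D k.
    by apply: eq_bigr => k _; rewrite -[in RHS](pos k).
  by rewrite -ES.
exists F, M, (\sum_k posz (mult_first hm D k))%N; split=> //; last 2 first.
- apply: homog_bigprod => k _; have := homogX (posz (mult_first hm D k)) (homog_lin hm A k).
  by rewrite mul1n.
- by move=> x; eexists; exact: MO.
split=> // x; have [i Hi] := tf x; exists i.
have [d [D0 hf _]] := sf i; have [d' [_ hF _]] := sF i.
have H1 := corder_push forms_crem hf (crem_order_at x) Hi.
rewrite relF in H1; have [l Hl] := corder_factor hi hF H1.
(* The order of M is cancelled from that of the pulled-back member; the coordinates of the reflected
   class then identify what remains with its base order. *)
have E := corder_uniq hi (corderM Hl (MO x)) H1.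
suff -> : base_order u (reflection n Cremona D) x = l by exact: Hl.
move: E; rewrite !base_order_split.
have -> : \sum_(j < m | ~~ (j < n.+1)%N) - reflection n Cremona D 0 (lift ord0 j) * (x == u j)%:Z
    = \sum_(j < m | ~~ (j < n.+1)%N) - D 0 (lift ord0 j) * (x == cremona_points j)%:Z.
  apply: eq_bigr => j jn; rewrite reflection_cremona_j /cremona_points (negPf jn).
  by rewrite subr0.
have -> : \sum_k mult_first hm D k * (x == cremona_points (fst k))%:Z
    = \sum_k mult_first hm D k * (x == residual k)%:Z.
  by apply: eq_bigr => k _; rewrite cremona_points_first.
have -> : \sum_k mult_first hm (reflection n Cremona D) k * (x == u (fst k))%:Z
    = \sum_k mult_first hm D k * (x == u (fst k))%:Z + cremona_shift n D * vertices x.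
  rewrite /vertices mulr_sumr -big_split; apply: eq_bigr => k _ /=.
  by rewrite /mult_first reflection_cremona_j first_lt opprB addrC mulrDl mulrC [X in X + _]mulrC; ring.
have -> : cremona_shift n D = d%:Z * (n%:Z - 1) - \sum_k mult_first hm D k.
  rewrite /cremona_shift D0; congr (_ + _); rewrite -sumrN big_ord_narrow ?(ltnW hm) // => le.
  by apply: eq_bigr => k _; rewrite /mult_first opprK (bool_irrelevance le (ltnW hm)).
have -> : \sum_k (vertices x - (x == u (fst k))%:Z + (x == residual k)%:Z) * mult_first hm D k
    = vertices x * (\sum_k mult_first hm D k)
      - \sum_k mult_first hm D k * (x == u (fst k))%:Z
      + \sum_k mult_first hm D k * (x == residual k)%:Z.
  rewrite mulr_sumr -sumrB -big_split; apply: eq_bigr => k _ /=; ring.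
move: (\sum_k mult_first hm D k) (\sum_(j < m | _) _) => a b.
move: (\sum_k _ * (_ == u _)%:Z) (\sum_k _ * (_ == residual _)%:Z) => a' b'.
move: (vertices x) => V E.
have -> : l%:Z = b' + b + (n%:Z - 1) * V * d%:Z - (V * a - a' + b') by rewrite -E addrK.
ring.
Qed.

End CremonaStep.


(** * Composition along a word *)

Lemma limit_var iota x : lifted iota -> limit (@var C n) iota x (iota x).
Proof.
move=> hi; have [z zx] := to_torus_surj x; have [F hF] := hi z.
have [hF1 hF2] := hF; exists z, F, F; split=> //; last by rewrite -zx; exact: near_self hF2.
apply: dnear_imp (near_dnear hF2) => t Ft.
rewrite (_ : \col_k _ = F t); first exact: proj_eq_refl (proj_eq_neq0l Ft).
by apply/colP => k; rewrite mxE /ev meval_var.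
Qed.

Lemma good_exchange A iota u s (i j : 'I_m) (e : j == i.+1 :> nat) : good A iota u s ->
  good (gen_matrix hm (Exchange e) A) iota (fun l => u (tperm i j l)) s.
Proof. by case=> hi hu hs; split=> // l; rewrite /= col_xcol. Qed.

Lemma pulls_back_exchange A iota u (i j : 'I_m) (e : j == i.+1 :> nat) :
  pulls_back A iota u (gen_matrix hm (Exchange e) A) iota (fun l => u (tperm i j l))
    (@var C n) (reflection n (Exchange e)).
Proof.
move=> I f D [sf tf]; exists f, 1, 0%N; split.
- split=> [k|x]; first exact: sect_exchange (sf k).
  have [k Hk] := tf x; exists k; suff -> : base_order u (reflection n (Exchange e) D) x
    = base_order (fun l => u (tperm i j l)) D x by [].
  rewrite /base_order [RHS](reindex_inj (@perm_inj _ (tperm i j))).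
  by apply: eq_bigr => l _; rewrite reflection_exchange_j tpermK.
- exact: homog1.
- by move=> x; exists 0; exact: corder1.
- by move=> k; rewrite subst_id mulr1.
Qed.

Definition gen_forms (g : generator m) A : 'I_n.+1 -> poly :=
  if g is Cremona then crem hm A else @var C n.

Lemma gen_map_subst g A Phi : gen_map hm g A Phi = fun k => subst Phi (gen_forms g A k).
Proof.
apply/funext => k; case: g => [i j e|]; last exact: gen_map_cremona.
by rewrite /= subst_var.
Qed.

Definition transforms A iota u A' (Phi : 'I_n.+1 -> poly) (w : H2 m -> H2 m)
    iota' u' : Prop :=
  [/\ exists d, forms Phi d, forall x, limit Phi iota x (iota' x),
      exists s, good A' iota' u' s & pulls_back A iota u A' iota' u' Phi w].

Lemma transforms_gen g A iota u s : good A iota u s -> in_X A -> in_X (gen_matrix hm g A) ->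
  (0 < n)%N -> exists iota' u',
  transforms A iota u (gen_matrix hm g A) (gen_forms g A) (reflection n g) iota' u'.
Proof.
move=> hg hA hA1 n0; case: g hA1 => [i j e|] hA1.
  exists iota, (fun l => u (tperm i j l)); split.
  - by exists 1%N => l; exact: homog_var.
  - by move=> x; apply: limit_var; case: hg.
  - by exists s; exact: good_exchange.
  - exact: pulls_back_exchange.
have [iota1 Hlim] := crem_limit_exists hg hA n0.
exists iota1, (cremona_points u s); split=> //.
- by exists n; exact: forms_crem.
- exact: good_cremona hg hA n0 _ Hlim.
- exact: tight_cremona hg hA n0 _ Hlim hA1.
Qed.

Lemma transforms_comp A iota u A1 Phi w iota1 u1 A2 Psi w' iota2 u2 : lifted iota ->
  transforms A iota u A1 Phi w iota1 u1 -> transforms A1 iota1 u1 A2 Psi w' iota2 u2 ->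
  transforms A iota u A2 (fun k => subst Phi (Psi k)) (fun D => w (w' D)) iota2 u2.
Proof.
move=> hi [[d hd] L1 [s1 hg1] p1] [[d' hd'] L2 g2 p2]; split; [| |exact: g2|].
- by exists (d * d')%N => k; exact: homog_subst (hd' k) hd.
- move=> x; have [z zx] := to_torus_surj x; have [F hF] := hi z.
  have [G [s [k [hG Hs E]]]] := limit_lift tau_gt0 hd L1 hF.
  have [H [hH E' Hq]] := limit_data hd' (L2 x) zx hG.
  exists z, F, H; split; [exact: zx|exact: hF|exact: hH| |exact: Hq].
  have [h [hh h0 Eh]] := Hs.
  have hn := near_dnear (ccont_neq0 (hol_at_ccont hh) h0).
  have [e e0 He] := (dnearC_P _ _).1 (dnear_and (dnear_and E E') (dnear_and Eh hn)).
  apply/dnearC_P; exists e => // t tz te; have [[E1 E2] [E3 E4]] := He t tz te.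
  apply: (proj_eq_trans _ E2); have st : s t != 0 by rewrite E3 mulf_neq0 ?subr_expz_neq0.
  have -> : \col_k0 ev (subst Phi (Psi k0)) (F t) = s t ^+ d' *: \col_k0 ev (Psi k0) (G t).
    rewrite -(ev_col_scale _ _ hd') -E1; apply/colP => l; by rewrite !mxE ev_subst.
  apply/proj_eq_sym/proj_eq_scale; last exact: expf_neq0.
  exact: proj_eq_neq0l E2.
- move=> I f D Tf; have [F1 [M1 [e1 [T1 hM1 oM1 E1]]]] := p2 I f D Tf.
  have [F [M [e [TF hM oM E]]]] := p1 I F1 _ T1.
  exists F, (M * subst Phi M1), (e + d * e1)%N; split; [exact: TF| | |].
  + by apply: homogM; [exact: hM|exact: homog_subst].
  + move=> x; have [k Hk] := oM x; have [k1 Hk1] := oM1 x.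
    have [o Ho] := limit_order tau_gt0 hi hd L1.
    by eexists; apply: corderM Hk (corder_push hd hM1 (Ho x) Hk1).
  + move=> i; have -> : subst (fun k => subst Phi (Psi k)) (f i) = subst Phi (subst Psi (f i)).
      by rewrite subst_comp.
    by rewrite E1 substM E mulrA.
Qed.

Lemma transforms_word A iota u s w : good A iota u s -> all_in_X hm w A -> (0 < n)%N ->
  exists iota' u', transforms A iota u (word_matrix hm w A) (word_map hm w A)
    (fun D => reflections n (rev w) D) iota' u'.
Proof.
move=> hg hw n0; have [hi _ _] := hg; elim: w hw => [|g w IH] hw.
  exists iota, u; split.
  - by exists 1%N => l; exact: homog_var.
  - by move=> x; exact: limit_var.
  - by exists s.
  - move=> I f D Tf; exists f, 1, 0%N; split=> //.
    + exact: homog1.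
    + by move=> x; exists 0; exact: corder1.
    + by move=> k; rewrite subst_id mulr1.
have [hA2 hw'] := hw; have [iota1 [u1 H1]] := IH hw'.
have [_ _ [s1 hg1] _] := H1.
have [iota2 [u2 H2]] := transforms_gen hg1 (all_in_X_head hw') hA2 n0.
exists iota2, u2; have := transforms_comp hi H1 H2; rewrite /= gen_map_subst.
have -> : (fun D => reflections n (rev (g :: w)) D) = (fun D => reflections n (rev w) (reflection n g D)).
  by apply/funext => D; rewrite reflections_rev_cons.
exact.
Qed.

End Words.

(** * Fixed parts *)

Section FixedParts.
Variable R : realType.
Local Notation C := (complexes R).
Local Notation Im := (@complex.Im R).
Variable tau : C.
Hypothesis tau_gt0 : 0 < Im tau.
Local Notation T := (torus tau).
Local Notation prj := (to_torus tau).
Variables (n m : nat) (hm : (n.+2 <= m)%N).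
Local Notation poly := (mpoly n.+1 C).
Local Notation vec := 'cV[C]_n.+1.
Implicit Types (A : 'M[C]_(n.+1, m)) (P Q : poly) (iota : T -> vec) (x y : T) (z : C)
  (u : 'I_m -> T) (D : H2 m) (s : T).

#[local] Opaque holomorphic_at.

Lemma base_order_point u D j : injective u -> base_order u D (u j) = - D 0 (lift ord0 j).
Proof.
move=> ui; rewrite /base_order (bigD1 j) //= eqxx mulr1 big1 ?addr0 // => i ij.
by rewrite (inj_eq ui) eq_sym (negPf ij) mulr0.
Qed.

Lemma base_order_out u D x : (forall j, x != u j) -> base_order u D x = 0.
Proof. by move=> xu; rewrite /base_order big1 // => j _; rewrite (negPf (xu j)) mulr0. Qed.

Lemma point_dec u x : (exists j, x = u j) \/ (forall j, x != u j).
Proof.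
have [H|H] := pselect (exists j, x = u j); [by left|right=> j].
by apply/eqP => e; apply: H; exists j.
Qed.

Lemma sect_order_ge A iota u s D P x (k : int) : good A iota u s -> injective u ->
  sect A D P -> corder iota P x k -> base_order u D x <= k.
Proof.
move=> [hi hu _] ui sP Hk; have [[j xj]|xu] := point_dec u x; last first.
  by rewrite base_order_out //; exact: corder_ge0 tau_gt0 _ _ _ _ _ hi Hk.
subst x; rewrite base_order_point //; have [d [_ hP _]] := sP.
have k0 := corder_ge0 tau_gt0 hi Hk.
case E : (- D 0 (lift ord0 j)) => [a|a]; last by lia.
apply: (corder_mult tau_gt0 hi hP (hu j) _ Hk); apply: (sect_mult sP).
by rewrite E.
Qed.

(* On the curve, the divisor of the gcd G is that of M, plus the base points of D', and
   the fixed multiplicities at the P_j account for the rest. *)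
Lemma fixed_part_order A iota u s (I : Type) (f F : I -> poly) M e D' B :
  good A iota u s -> injective u -> tight A iota u D' F -> homogeneous e M ->
  (forall x, exists k : int, corder iota M x k) -> (forall i, f i = F i * M) ->
  fixed_part_class A f B ->
  exists G d, [/\ homogeneous d G, B 0 ord0 = d%:Z
    & forall x (k : int), corder iota M x k ->
      corder iota G x (k + base_order u D' x + base_order u B x)].
Proof.
move=> hg ui [sF tF] hM oM fE [G [c [[Gf Gmax] minc [d [nu [G0 hG hnu BE]]]]]].
have [hi hu _] := hg.
exists G, d; split=> //; first by rewrite BE class_0.
have Bj j : B 0 (lift ord0 j) = (c j)%:Z - (nu j)%:Z by rewrite BE class_j.
(* M is a common factor, so G = N M. The excess N of the gcd has to cut out on the curve exactly the
   base orders of D' and B together. *)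
have [N GNM] : divides M G by apply: Gmax => i; exists (F i).
have M0 : M != 0 by apply: contraNneq G0 => E; rewrite GNM E mulr0.
have N0 : N != 0 by apply: contraNneq G0 => E; rewrite GNM E mul0r.
have [dN hN] : exists dN, homogeneous dN N.
  by apply: (@homog_factor _ _ d N M); rewrite -GNM.
move=> x k Hk.
have [i Hi] := tF x; have [dF [_ hF _]] := sF i.
have Fi0 := corder_neq0 hi Hi.
have [Q FQN] : exists Q, F i = Q * N.
  have [Q EQ] := Gf i; exists Q; apply: (mulIf M0).
  by rewrite -fE EQ GNM mulrA.
have [dQ hQ] : exists dQ, homogeneous dQ Q.
  by apply: (@homog_factor _ _ dF Q N); rewrite -FQN.
have HQN : corder iota (Q * N) x (base_order u D' x) by rewrite -FQN.
have HNQ : corder iota (N * Q) x (base_order u D' x) by rewrite mulrC.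
have [lQ HQ] := corder_factor tau_gt0 hi hQ HQN.
have [lN HN] := corder_factor tau_gt0 hi hN HNQ.
have sumE := corder_uniq hi (corderM HQ HN) HQN.
suff -> : k + base_order u D' x + base_order u B x = lN%:Z + k.
  by rewrite GNM; exact: corderM.
suff : base_order u D' x + base_order u B x = lN%:Z by lia.
have [[j xj]|xu] := point_dec u x; last first.
  by move: sumE; rewrite !base_order_out //; lia.
subst x; move: sumE; rewrite !base_order_point // Bj => sumE.
(* As G Q = f i has multiplicity at least c_j and G has multiplicity nu_j, the order of Q is at
   least c_j - nu_j, which bounds that of N from above. *)
have QG : mult_ge (G * Q) (col j A) (c j).
  have -> : G * Q = f i by rewrite fE FQN GNM; ring.
  by case: (minc j) => + _; exact.
have lQge : (c j - nu j)%:Z <= lQ%:Z.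
  exact: corder_mult tau_gt0 _ _ _ _ _ _ _ _ hi hQ (hu j) (mult_ge_div (hnu j) QG) HQ.
have [a Ha] := has_mult_exists (col j A) M0.
have [i1 Hi1] : exists i, ~ mult_ge (f i) (col j A) (c j).+1 by case: (minc j).
pose b := posz (- D' 0 (lift ord0 j)).
have Fb : mult_ge (F i1) (col j A) b.
  rewrite /b; case E : (- D' 0 (lift ord0 j)) => [b'|b'] /=; last exact: mult_ge0.
  by apply: (sect_mult (sF i1)); rewrite E.
(* A member F M of least multiplicity c_j shows b + a <= c_j, whence N = G / M has order at least
   nu_j - a >= nu_j - c_j + b; this is the opposite bound. *)
have bac : (b + a <= c j)%N.
  rewrite leqNgt; apply/negP => lt; apply: Hi1; rewrite fE.
  by apply: mult_ge_le lt _; apply: mult_geM => //; case: Ha.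
have lNge : (nu j - a)%:Z <= lN%:Z.
  apply: corder_mult tau_gt0 _ _ _ _ _ _ _ _ hi hN (hu j) (mult_ge_div Ha _) HN.
  by rewrite mulrC -GNM; case: (hnu j).
have : - D' 0 (lift ord0 j) <= b%:Z by rewrite /b; case: (- D' _ _) => [?|?] /=; lia.
move: b (- D' _ _) (c j) (nu j) sumE lQge bac lNge {Fb hnu QG} => b b1 c1 nu1; lia.
Qed.

(** One inequality comes from a member f_i of least order at x, the other from a member F_i of least
    order; each is compared with the lower bound [sect_order_ge] on the other side. *)
Lemma tight_order A iota u s A' iota' u' s' (Phi : 'I_n.+1 -> poly) d (I : Type) (f F : I -> poly)
    M D D' x (k o : int) :
  good A iota u s -> injective u -> good A' iota' u' s' -> injective u' -> forms Phi d ->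
  order_at Phi iota iota' x o -> tight A' iota' u' D f -> tight A iota u D' F ->
  (forall i, subst Phi (f i) = F i * M) -> corder iota M x k ->
  k + base_order u D' x = base_order u' D x + o * D 0 ord0.
Proof.
move=> hg ui hg' ui' hP Ho [sf tf] [sF tF] E Hk.
have [hi _ _] := hg; have [hi' _ _] := hg'.
apply/eqP; rewrite eq_le; apply/andP; split.
  have [i Hi] := tf x; have [e [D0 hf _]] := sf i; have [e' [_ hF _]] := sF i.
  have H := corder_push hP hf Ho Hi; rewrite E in H.
  have [l Hl] := corder_factor tau_gt0 hi hF H.
  have := sect_order_ge hg ui (sF i) Hl; have := corder_uniq hi (corderM Hl Hk) H.
  rewrite D0; lia.
have [i Hi] := tF x; have [e [D0 hf _]] := sf i.
have H := corderM Hi Hk; rewrite -E in H.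
have := sect_order_ge hg' ui' (sf i) (corder_pull hP hf Ho H).
by rewrite D0; lia.
Qed.

Lemma base_order_sums u D : sums (base_order u D) (\sum_j - D 0 (lift ord0 j))
  (\sum_j u j *~ - D 0 (lift ord0 j)).
Proof.
have H (j : 'I_m) := sumsZ (- D 0 (lift ord0 j)) (sums_point (u j)).
have := @sums_sum _ _ _ (index_enum 'I_m) predT _ _ _ H; rewrite /=.
have -> : \sum_(i < m) 1 * - D 0 (lift ord0 i) = \sum_j - D 0 (lift ord0 j).
  by apply: eq_bigr => j _; rewrite mul1r.
by apply: eq_sums => x; apply: eq_bigr => j _; rewrite mulrC.
Qed.

(** By [fixed_part_order] the divisor of the gcd G on the curve is that of M plus the base orders of
    D' and B, and [tight_order] rewrites M plus D' as the divisor in the conclusion. Abel's theorem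
    gives the sum for G; the base orders of B are subtracted. *)
Lemma fixed_part_sums A iota u s A' iota' u' s' (Phi : 'I_n.+1 -> poly) d w (I : Type)
    (f : I -> poly) D B (o : T -> nat) x0 :
  good A iota u s -> injective u -> good A' iota' u' s' -> injective u' -> forms Phi d ->
  pulls_back A iota u A' iota' u' Phi w -> (forall x, order_at Phi iota iota' x (o x)) ->
  tight A' iota' u' D f -> fixed_part_class A (fun i => subst Phi (f i)) B ->
  exists e, sums (fun x => base_order u' D x + (o x)%:Z * D 0 ord0) e
    (s *~ B 0 ord0 + \sum_j u j *~ B 0 (lift ord0 j)).
Proof.
move=> hg ui hg' ui' hP p Ho Tf FB; have [F [M [e [TF hM oM E]]]] := p I f D Tf.
have [G [dG [hG B0 HG]]] := fixed_part_order hg ui TF hM oM E FB.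
have [k0 Hk0] := oM x0; have [hi _ hs] := hg.
have [DG [HDG SG]] := corder_sums tau_gt0 hi hs hG (HG x0 k0 Hk0).
eexists; have := sumsD SG (sumsZ (-1) (base_order_sums u B)).
have -> : s *~ dG + (\sum_j u j *~ - B 0 (lift ord0 j)) *~ -1
    = s *~ B 0 ord0 + \sum_j u j *~ B 0 (lift ord0 j).
  rewrite B0 mulrz_suml; congr (_ + _); apply: eq_bigr => j _.
  by rewrite -mulrzA mulrN1 opprK.
apply: eq_sums => x; have [k Hk] := oM x.
rewrite -(tight_order hg ui hg' ui' hP (Ho x) Tf TF E Hk) mulrN1.
by rewrite (corder_uniq hi (HDG x) (HG x k Hk)) addrK.
Qed.

Lemma tight_var A iota u s : good A iota u s -> tight A iota u (cE m) (@var C n).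
Proof.
move=> [hi _ _]; split=> [i|x].
  exists 1%N; split; [exact: cE_0|exact: homog_var|].
  by move=> j [_|k]; [exact: mult_ge0|rewrite cE_j].
have [i xi] := cV_neq0 (lifted_neq0 x hi); exists i.
have -> : base_order u (cE m) x = 0.
  by rewrite /base_order big1 // => j _; rewrite cE_j oppr0 mul0r.
by apply: (corder_eq0 hi (homog_var _ i)); rewrite /ev meval_var.
Qed.

(** Otherwise all P_l would be divisible by (t - z)^(k + 1) along the curve, and so would the
    combination. *)
Lemma corder_combination iota (c : 'I_n.+1 -> C) (P : 'I_n.+1 -> poly) d x (k : nat) :
  lifted iota -> (forall l, homogeneous d (P l)) -> corder iota (\sum_l c l *: P l) x k ->
  exists l (k' : nat), corder iota (P l) x k' /\ (k' <= k)%N.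
Proof.
move=> hi hP Hk; apply: contrapT => H.
have [z zx] := to_torus_surj x; have [F hF] := hi z.
have Hl l : exists h : C -> C, holomorphic_at h z /\
    \forall t \near (z : C)^'%classic, ev (P l) (F t) = (t - z) ^+ k.+1 * h t.
  have [E|[k' Hk']] := hol_has_order tau_gt0 (ev_hol (P l) hF.1).
    exists (fun=> 0); split; first exact: hol_at_cst.
    by apply: near_dnear; apply: near_imp E => t ->; rewrite mulr0.
  have kk' : (k < k')%N.
    rewrite ltnNge; apply/negP => le; apply: H; exists l, k'; split=> //.
    exact: corder_intro (hP l) zx hF Hk'.
  have [g [hg _ Eg]] := Hk'; exists (fun t => (t - z) ^+ (k' - k.+1) * g t); split.
    by apply: hol_atM; [apply: hol_atX; exact: hol_at_subr|exact: hg].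
  by apply: dnear_imp Eg => t ->; rewrite mulrA -exprD subnKC // exprnP.
have [h Hh] := choice Hl.
have : k.+1%:Z <= k%:Z; last by lia.
apply: (@order_ge _ _ tau_gt0 _ (fun t => \sum_l c l * h l t) z k.+1 k (Hk z F zx hF)).
  by apply: hol_at_sum => l; apply: hol_atM; [exact: hol_at_cst|exact: (Hh l).1].
apply: dnear_imp (dnear_forall (fun l => (Hh l).2)) => t Ht.
rewrite /ev raddf_sum mulr_sumr; apply: eq_bigr => l _ /=.
by rewrite mevalZ -/(ev (P l) (F t)) Ht mulrCA.
Qed.

Lemma base_order_Ei u (i : 'I_m) x : base_order u (cE m - cEi i) x = (x == u i)%:Z.
Proof.
rewrite /base_order (bigD1 i) //= mxB_E cE_j cEi_j eqxx sub0r opprK mul1r big1 ?addr0 // => j ji.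
by rewrite mxB_E cE_j cEi_j (negPf ji) subr0 oppr0 mul0r.
Qed.

(** A linear form vanishing at p = P_i is a combination of the minors p_k X_l - p_l X_k for a fixed
    k with p_k <> 0. For the hyperplane of [separation], one of these minors must have order at x no
    larger than that of the hyperplane. *)
Lemma tight_minors A iota u s (i : 'I_m) : good A iota u s -> injective u -> in_X A -> (1 < n)%N ->
  tight A iota u (cE m - cEi i) (minors_at (col i A) (@var C n)).
Proof.
move=> hg ui hA n1; have [hi hu _] := hg; set p := col i A.
have hm1 kl : homogeneous 1 (minors_at p (@var C n) kl).
  rewrite /minors_at -scaleNr; apply: homogD; apply: homogZ; exact: homog_var.
have sM kl : sect A (cE m - cEi i) (minors_at p (@var C n) kl).
  exists 1%N; split=> //; first by rewrite mxB_E cE_0 cEi_0 subr0.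
  move=> j [|k]; first by move=> _; exact: mult_ge0.
  rewrite mxB_E cE_j cEi_j sub0r opprK; have [->|_] := eqVneq j i; last by [].
  case: k => // _; apply/mult_ge1; rewrite /minors_at mevalB !mevalZ !meval_var -/p.
  by rewrite mulrC subrr.
split=> // x; rewrite base_order_Ei.
have [a [E Ha]] := separation tau_gt0 hm (u i) x hg hA n1.
have [p0 [c c0 pE]] := proj_eq_sym (hu i).
have [k pk] := cV_neq0 p0.
have ap : \sum_l a 0 l * p l 0 = 0.
  move: E; rewrite ev_linear pE -scalemxAr mxE => /eqP; rewrite mulf_eq0 (negPf c0) /= => /eqP.
  by rewrite mxE.
have aE : linear_form a = \sum_l (a 0 l / p k 0) *: minors_at p (@var C n) (k, l).
  rewrite /minors_at /= /linear_form.
  under [RHS]eq_bigr do rewrite scalerBr !scalerA divfK //.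
  rewrite sumrB -scaler_suml; have -> : \sum_l a 0 l / p k 0 * p l 0 = 0.
    by under eq_bigr do rewrite mulrAC; rewrite -mulr_suml ap mul0r.
  by rewrite scale0r subr0.
rewrite aE in Ha.
have [l [k' [Hk' le]]] := @corder_combination _ _ _ 1 _ (x == u i) hi (fun l => hm1 (k, l)) Ha.
exists (k, l); have := sect_order_ge hg ui (sM (k, l)) Hk'; rewrite base_order_Ei => ge.
by have -> : (x == u i)%:Z = k'%:Z by lia.
Qed.

(** For n = 1, [n_gt1] derives that all doubles x + x coincide; this point is the double of a
    quarter period and differs from 0 + 0. *)
Lemma half_period_neq0 : prj (pt tau (1 / 2) 0) != 0.
Proof.
have <- : prj (pt tau 0 0) = 0 by rewrite /pt !toC0 mul0r addr0 raddf0.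
apply/eqP => /(prj_pt_eq tau_gt0)[a [_ [E _]]].
rewrite add0r in E; have h0 : -1 < 1 / 2 :> R by lra.
have h1 : 1 / 2 < 1 :> R by lra.
have h2 : 0 < 1 / 2 :> R by lra.
rewrite E in h0 h1 h2; have a0 := int_small tau_gt0 h0 h1.
by move: h2; rewrite a0 mulr0z ltxx.
Qed.

Lemma killed_proportional (a : 'rV[C]_n.+1) (v v' : vec) : n = 1%N -> a != 0 ->
  v != 0 -> v' != 0 -> (a *m v) 0 0 = 0 -> (a *m v') 0 0 = 0 -> proj_eq v v'.
Proof.
move=> n1 a0 v0 v'0 av av'; apply: proj_eq_cross => // i j.
have [->//|ij] := eqVneq i j.
have two (w : vec) : (a *m w) 0 0 = a 0 i * w i 0 + a 0 j * w j 0.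
  rewrite mxE (bigD1 i) //= (bigD1 j) 1?eq_sym //= big1 ?addr0 // => l /andP[li lj].
  exfalso; move: li lj ij; rewrite -!val_eqE /=.
  by have := ltn_ord i; have := ltn_ord j; have := ltn_ord l; lia.
rewrite !two in av av'.
have [k ak] : exists k, a 0 k != 0.
  apply: contrapT => H; move/eqP: a0; apply; apply/rowP => k; rewrite mxE.
  by apply/eqP/negPn/negP => h; apply: H; exists k.
have [ki|kj] : k = i \/ k = j.
  have [->|ki] := eqVneq k i; [by left|right]; apply/val_inj.
  move: ki ij; rewrite -!val_eqE /=.
  by have := ltn_ord i; have := ltn_ord j; have := ltn_ord k; lia.
- subst k; apply: (mulfI ak).
  have E1 : a 0 i * v i 0 = - (a 0 j * v j 0) by apply/eqP; rewrite -addr_eq0 av.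
  have E2 : a 0 i * v' i 0 = - (a 0 j * v' j 0) by apply/eqP; rewrite -addr_eq0 av'.
  by rewrite mulrA E1 mulrCA E2; ring.
- subst k; apply: (mulfI ak).
  have E1 : a 0 j * v j 0 = - (a 0 i * v i 0) by apply/eqP; rewrite -addr_eq0 addrC av.
  have E2 : a 0 j * v' j 0 = - (a 0 i * v' i 0) by apply/eqP; rewrite -addr_eq0 addrC av'.
  by rewrite mulrCA E2 mulrA E1; ring.
Qed.

(* On a line, each hyperplane section would be of the form 2x with a fixed sum. *)
Lemma n_gt1 A iota u s : good A iota u s -> in_X A ->
  (forall x y, proj_eq (iota x) (iota y) -> x = y) -> (1 < n)%N.
Proof.
move=> hg hA inj; have [hi hu hs] := hg.
have i0 x : iota x != 0 by exact: lifted_neq0.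
rewrite ltnNge; apply/negP => n1; have := half_period_neq0; apply/negP/negPn/eqP.
have [n0|n0] := posnP n.
  apply: inj; apply: proj_eq_cross => // i j; suff -> : i = j by [].
  by apply/val_inj; have := ltn_ord i; have := ltn_ord j => /=; move: n0; lia.
have {n1 n0} n1 : n = 1%N by lia.
have dbl x : x + x = s.
  have sx : size [:: x] = n by rewrite n1.
  have [a a0 Ha] := @exists_hyperplane R tau n iota [:: x] sx.
  have [k Hk] := linear_corder tau_gt0 hm x hg hA a0.
  have H := hyperplane_residual tau_gt0 hi i0 hs Hk (erefl : uniq [:: x]) sx Ha.
  have E : ev (linear_form a) (iota (s - x)) = 0.
    apply/eqP/negPn/negP => nz; have h0 := corder_eq0 hi (homog_linear_form a) nz.
    have := corder_uniq hi (H (s - x)) h0; rewrite big_seq1 eqxx.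
    by case: (_ \in _).
  have Ex := Ha x (mem_head _ _); rewrite !ev_linear in E Ex.
  have := inj _ _ (killed_proportional n1 a0 (i0 x) (i0 (s - x)) Ex E) => {1}->.
  by rewrite subrK.
have -> : prj (pt tau (1 / 2) 0) = prj (pt tau (1 / 4) 0) + prj (pt tau (1 / 4) 0).
  by rewrite -raddfD; congr (prj _); rewrite /pt toC0 mul0r !addr0 -toCD; congr (toC _); field.
by rewrite dbl -(dbl 0) addr0.
Qed.

Lemma pullback_sum iota (v : T) : is_pullback_of_E iota (fun x => point_divisor v x *+ n.+1) ->
  lifted iota /\ hyperplane_sum iota (v *+ n.+1).
Proof.
move=> [a [D' [/hyperplane_divisorE[hi HD'] [f Hf]]]]; split=> //.
exists a, D'; split=> //.
have S0 := abel tau_gt0 (D := fun x => point_divisor v x *+ n.+1 - D' x) Hf.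
have := sumsD (sumsZ n.+1%:Z (sums_point v)) (sumsZ (-1) S0).
rewrite mul1r mul0r mul0rz !addr0 -pmulrn; apply: eq_sums => x.
by rewrite /point_divisor mulrN1 opprB addrC -mulr_natr natz subrK.
Qed.

Lemma corder_eq iota iota' P x (k : int) : (forall y, proj_eq (iota y) (iota' y)) ->
  corder iota P x k -> corder iota' P x k.
Proof.
move=> E H z F zx hF; apply: H zx _; apply: lift_eq hF => y.
exact: proj_eq_sym.
Qed.

(** A limit is unique only as a point of P^n, so the curve constructed along the word is exchanged
    here for the given one, whose vectors may differ by scalars. *)
Lemma transforms_eq A iota u A' (Phi : 'I_n.+1 -> poly) w iota1 iota' u' : lifted iota ->
  (forall x, limit Phi iota x (iota' x)) -> transforms A iota u A' Phi w iota1 u' ->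
  transforms A iota u A' Phi w iota' u'.
Proof.
move=> hi L' [[d hd] L1 [s [hi1 hu1 [a [D [HD SD]]]]] p].
have E x := limit_uniq hd (L1 x) (L' x); have E' x := proj_eq_sym (E x).
split; [by exists d|exact: L'| |].
- exists s; split; first exact: limit_lifted tau_gt0 _ _ _ _ _ hi hd L'.
    by move=> j; exact: proj_eq_trans (E' _) (hu1 j).
  by exists a, D; split=> // x; exact: corder_eq E (HD x).
- move=> I f D0 [sf tf]; apply: (p I f D0); split=> // x.
  by have [i Hi] := tf x; exists i; exact: corder_eq E' Hi.
Qed.

(** If the images agree, the separating hyperplane through x also vanishes at y, which it does only
    for y = x. *)
Lemma good_separated A iota u s x y : good A iota u s -> in_X A -> (1 < n)%N ->
  proj_eq (iota x) (iota y) -> x = y.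
Proof.
move=> hg hA n1 xy; have [hi _ _] := hg; have [a [ax Ha]] := separation tau_gt0 hm x y hg hA n1.
have ha := homog_linear_form a; have := corder_root tau_gt0 hi ha (lifted_neq0 y hi) _ Ha.
have -> : ev (linear_form a) (iota y) = 0.
  by apply/eqP; rewrite -[_ == _]negbK -(ev_neq0_proj ha xy) ax eqxx.
by move=> /(_ erefl); case: eqP.
Qed.

Lemma subst_minors_at p (Phi : 'I_n.+1 -> poly) kl :
  subst Phi (minors_at p (@var C n) kl) = minors_at p Phi kl.
Proof. by rewrite /minors_at raddfB /= !linearZ /= !subst_var. Qed.

End FixedParts.

(** * Comparison of sums in the torus *)

Theorem theorem4p1 (R : realType) (n m : nat) (hm : (n.+2 <= m)%N)
    (A : 'M[complexes R]_(n.+1, m)) (hA : in_Y A)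
    (tau : complexes R) (htau : 0 < 'Im tau)
    (iota : torus tau -> 'cV[complexes R]_n.+1)
    (hiota : embedding iota) (hdeg : has_degree iota n.+1)
    (w : seq (generator m))
    (A' : 'M[complexes R]_(n.+1, m)) (hA' : A' = word_matrix hm w A)
    (iota' : torus tau -> 'cV[complexes R]_n.+1)
    (hiota' : forall x : torus tau, image_on_curve hm w A iota x (iota' x))
    (u : 'I_m -> torus tau) (hu : forall i, proj_eq (iota (u i)) (col i A))
    (u' : 'I_m -> torus tau) (hu' : forall i, proj_eq (iota' (u' i)) (col i A'))
    (v : torus tau)
    (hv : is_pullback_of_E iota (fun x => point_divisor v x *+ n.+1))
    (v' : torus tau)
    (hv' : is_pullback_of_E iota' (fun x => point_divisor v' x *+ n.+1))
    (b : 'M[int]_m.+1)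
    (hb0 : pullback_E A (word_map hm w A)
       (cE m *~ b ord0 ord0 + \sum_(j < m) cEi j *~ b ord0 (lift ord0 j)))
    (hb : forall i : 'I_m, pullback_Ei A (word_map hm w A) (col i A')
       (cE m *~ b (lift ord0 i) ord0
        + \sum_(j < m) cEi j *~ b (lift ord0 i) (lift ord0 j))) :
  [/\ forall i : 'I_m,
        u' i = v *~ (n.+1%:Z * b (lift ord0 i) ord0)
               + \sum_(j < m) u j *~ b (lift ord0 i) (lift ord0 j),
      forall x x' : torus tau,
        image_on_curve hm w A iota x (iota' x') -> x' = x
    & v' *+ n.+1 = v *~ (n.+1%:Z * b ord0 ord0)
                   + \sum_(j < m) u j *~ b ord0 (lift ord0 j)].
Proof.
have tau_gt0 : 0 < complex.Im tau by move: htau; rewrite -complexIm ltcR.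
have [hX hN _] := hA; have [hi hs] := pullback_sum tau_gt0 hv.
have hg : good A iota u (v *+ n.+1) by split.
have n1 := n_gt1 tau_gt0 hm hg hX hiota.1; have n0 := ltnW n1.
have ui := good_inj hm hg hX n0; have hw := in_X_word hm w hX hN.
have hX' : in_X A' by rewrite hA'; exact: all_in_X_head.
have L' x : limit (word_map hm w A) iota x (iota' x) := hiota' x.
have [iota1 [u1 T1]] := transforms_word tau_gt0 hg hw n0.
have [[d0 hd0] _ [s' hg'] pb] := transforms_eq tau_gt0 hi L' T1.
rewrite -hA' in hg' pb.
have inj' x y : proj_eq (iota' x) (iota' y) -> x = y.
  exact: (good_separated tau_gt0 hm hg' hX' n1).
have [hi' hu1 _] := hg'.
have u1E i : u1 i = u' i.
  by apply: inj'; exact: proj_eq_trans (hu1 i) (proj_eq_sym (hu' i)).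
have ui' := good_inj hm hg' hX' n0.
have [o Ho] := limit_order tau_gt0 hi hd0 L'.
(* The class E of the coordinate forms imposes no base points, so the fixed part B computes the sum
   of the common zeros o of the forms of the word. *)
have SB B : fixed_part_class A (word_map hm w A) B -> exists e, sums (fun x => (o x)%:Z) e
    ((v *+ n.+1) *~ B 0 ord0 + \sum_j u j *~ B 0 (lift ord0 j)).
  have -> : word_map hm w A = fun i => subst (word_map hm w A) (@var _ n i).
    by apply/funext => i; rewrite subst_var.
  move=> FB; have [e He] := fixed_part_sums tau_gt0 hm 0 hg ui hg' ui' hd0 pb Ho (tight_var hg') FB.
  exists e; apply: eq_sums He => x; rewrite cE_0 mulr1 /base_order big1 ?add0r // => j _.
  by rewrite cE_j oppr0 mul0r.
have mulb (k : int) : v *+ n.+1 *~ k = v *~ (n.+1%:Z * k) by rewrite mulrzA -pmulrn.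
split.
- move=> i; have [B1 [B [FB1 FB E]]] := hb i; have [e He] := SB B FB.
  have FB1' : fixed_part_class A
      (fun kl => subst (word_map hm w A) (minors_at (col i A') (@var _ n) kl)) B1.
    suff -> : (fun kl => subst (word_map hm w A) (minors_at (col i A') (@var _ n) kl))
      = minors_at (col i A') (word_map hm w A) by [].
    by apply/funext => kl; exact: subst_minors_at.
  have [e1 He1] := fixed_part_sums tau_gt0 hm 0 hg ui hg' ui' hd0 pb Ho
    (tight_minors tau_gt0 hm i hg' ui' hX' n1) FB1'.
  (* The minors contribute o plus the base point imposed by E - E_i; subtracting o leaves the point
     u'_i alone. *)
  have S1 : sums (fun x => (x == u1 i)%:Z) (e1 + e * -1)
      ((v *+ n.+1) *~ b (lift ord0 i) ord0 + \sum_j u j *~ b (lift ord0 i) (lift ord0 j)).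
    have := sumsD He1 (sumsZ (-1) He).
    have -> : (v *+ n.+1) *~ B1 0 ord0 + \sum_j u j *~ B1 0 (lift ord0 j)
        + ((v *+ n.+1) *~ B 0 ord0 + \sum_j u j *~ B 0 (lift ord0 j)) *~ -1
        = (v *+ n.+1) *~ b (lift ord0 i) ord0 + \sum_j u j *~ b (lift ord0 i) (lift ord0 j).
      rewrite mulrN1z opprD addrACA -mulrzBr -sumrB.
      have := congr1 (fun D : H2 m => D 0 ord0) E; rewrite class_0 mxB_E => ->.
      congr (_ + _); apply: eq_bigr => j _.
      have := congr1 (fun D : H2 m => D 0 (lift ord0 j)) E; rewrite class_j mxB_E => ->.
      by rewrite mulrzBr.
    apply: eq_sums => x; rewrite base_order_Ei mxB_E cE_0 cEi_0 subr0 mulr1 mulrN1.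
    by rewrite addrK.
  have [_] := sums_uniq S1 (sums_point (u1 i)).
  by rewrite u1E mulb => ->.
- move=> x x' Hx; apply: inj'; exact: (limit_uniq hd0 Hx (L' x)).
have [d [B [hd FB E]]] := hb0; have [e He] := SB B FB.
have [_ [a [D' [HD' SD']]]] := pullback_sum tau_gt0 hv'.
(* A hyperplane of the target pulls back to a form of degree d whose divisor is the hyperplane
   section of the image curve plus o; comparing the two sums gives (n + 1) v'. *)
have HP x := corder_push hd (homog_linear_form a) (Ho x) (HD' x).
have [DP [HDP SDP]] := corder_sums tau_gt0 hi hs (homog_subst (homog_linear_form a) hd) (HP 0).
have SP : sums DP (n.+1%:Z + e) (v' *+ n.+1 +
    ((v *+ n.+1) *~ B 0 ord0 + \sum_j u j *~ B 0 (lift ord0 j))).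
  apply: eq_sums (sumsD SD' He) => x.
  by rewrite (corder_uniq hi (HDP x) (HP x)) mulr1.
have [_ Es] := sums_uniq SDP SP; rewrite muln1 in Es.
have -> : v' *+ n.+1 = (v *+ n.+1) *~ d
    - ((v *+ n.+1) *~ B 0 ord0 + \sum_j u j *~ B 0 (lift ord0 j)) by rewrite Es addrK.
have := congr1 (fun D : H2 m => D 0 ord0) E; rewrite class_0 mxB_E mulrz_mxE cE_0 mul1r => ->.
rewrite opprD addrA -mulrzBr -mulb; congr (_ + _); rewrite -sumrN; apply: eq_bigr => j _.
have := congr1 (fun D : H2 m => D 0 (lift ord0 j)) E; rewrite class_j mxB_E mulrz_mxE cE_j mul0r sub0r.
by move=> ->; rewrite mulrNz.
Qed.
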